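(* Let $\mathfrak{F}\subset B(\mathcal{X})$ satisfy $L_b(\mathcal{X})\subset\mathfrak{F}$ and Hypothesis $(\mathbf{H_1})$. Then the following are equivalent: (i) $\Phi$ is asymptotically stable with respect to $\mathfrak{F}$; (ii) $\Phi$ is eventually continuous with respect to $\mathfrak{F}$ on $\mathcal{X}$, and there exists $z\in\mathcal{X}$ such that $\Phi$ satisfies the lower bound condition $(\mathcal{C}_1)$ at $z$; (iii) there exists $z\in\mathcal{X}$ such that $\Phi$ is eventually continuous with respect to $\mathfrak{F}$ at $z$ and satisfies the lower bound condition $(\mathcal{C}_1)$ at $z$.
   Context: Standing setting: $(\mathcal{X},\rho)$ is a Polish space with Borel $\sigma$-algebra; $\Phi=\{\Phi_t\}_{t\ge0}$ is a càdlàg Feller Markov process on $\mathcal{X}$ (hence strong Markov), realized as a Markov family $(\Omega,\mathcal{F},\{\Phi_t\},\{\mathcal{F}_t\},\{\mathbb{P}^x\}_{x\in\mathcal{X}})$ with expectations $\mathbb{E}^x$, and transition kernels $P_t(x,\cdot)$. $B(\mathcal{X})$ denotes Borel real functions, $B_b(\mathcal X)$ the bounded ones, $L_b(\mathcal{X})$ bounded Lipschitz functions, $B(z,r)=\{y:\rho(y,z)<r\}$, $\langle f,\mu\rangle=\int f\,d\mu$. Let $\mathcal{A}=\{f\in B(\mathcal{X}):\int|f(y)|P_t(x,dy)<\infty\ \forall x\in\mathcal X,\ t\ge0\}$, and for $f\in\mathcal{A}$ set $P_tf(x)=\int f(y)P_t(x,dy)$, $Q_tf(x)=\frac1t\int_0^tP_sf(x)\,ds$,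 $Q_t(x,\cdot)=\frac1t\int_0^tP_s(x,\cdot)\,ds$. A probability measure $\mu$ is invariant if $\int P_t(x,A)\mu(dx)=\mu(A)$ for all $t,A$. Definitions: $\Phi$ is asymptotically stable with respect to $\mathfrak{F}$ if it has a unique invariant probability measure $\mu$, $\mathfrak{F}\subset L^1(\mu)$, and $\lim_{t\to\infty}|P_tf(x)-\langle f,\mu\rangle|=0$ for all $x\in\mathcal X$, $f\in\mathfrak{F}$. Lower bound condition $(\mathcal{C}_1)$ at $z$: for every $r>0$, $\inf_{x\in\mathcal{X}}\liminf_{t\to\infty}P_t(x,B(z,r))>0$. For $\mathfrak{F}\subset\mathcal{A}$, $\Phi$ is eventually continuous with respect to $\mathfrak{F}$ at $x$ if for every $f\in\mathfrak{F}$, $\limsup_{x'\to x}\limsup_{t\to\infty}|P_tf(x')-P_tf(x)|=0$; ''on $\mathcal X$'' means at every $x\in\mathcal X$. A family $\{\xi_t\}_{t\ge0}$ of random variables is uniformly integrable if $\lim_{K\to\infty}\sup_t\mathbb{E}(|\xi_t|\chi_{\{|\xi_t|\ge K\}})=0$. Hypothesis $(\mathbf{H_1})$: for every $f\in\mathfrak{F}$ and $x\in\mathcal{X}$, $\{f(\Phi_t)\}_{t\ge0}$ is uniformly integrable under $\mathbb{P}^x$. *)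

(* Defs.v *)
From HB Require Import structures.
From mathcomp Require Import all_boot all_order all_algebra.
From mathcomp Require Import all_classical all_reals all_analysis.
From mathcomp Require Import measurable_realfun.
Set Implicit Arguments. Unset Strict Implicit. Unset Printing Implicit Defensive.
Import Order.TTheory GRing.Theory Num.Theory.
Import numFieldNormedType.Exports.
Local Open Scope classical_set_scope.
Local Open Scope ring_scope.

(** * The state space: a metric space (X, rho) with rho = mdist,
    equipped with its Borel sigma-algebra.  MathComp measurable types must be
    pointed, hence the auxiliary point x0. *)
Section borel_space.
Variables (R : realType) (X : metricType R).

Definition pointed_of (p : X) : Type := X.

Variable (x0 : X).
#[non_forgetful_inheritance]
HB.instance Definition _ := Choice.on (pointed_of x0).
#[non_forgetful_inheritance]
HB.instance Definition _ := isPointed.Build (pointed_of x0) x0.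

Definition borel_of := g_sigma_algebraType (@open X : set (set (pointed_of x0))).

End borel_space.

Definition polish (R : realType) (X : metricType R) :=
  (forall F : set_system X, ProperFilter F -> cauchy F -> exists l : X, F --> l) /\
  (exists D : set X, countable D /\ dense D).

Section markov.
Variables (R : realType) (X : metricType R) (x0 : X).
Variables (dO : measure_display) (Omega : measurableType dO).
Variables (Ft : R -> set (set Omega)) (Phi : R -> Omega -> X)
  (Px : X -> probability Omega R).

Local Notation XB := (borel_of x0).
Local Notation rho := (@mdist R X).

Definition Pt (t : R) (x : X) : set XB -> \bar R :=
  pushforward (Px x) (Phi t : Omega -> XB).

Definition cadlag_feller_markov_family : Prop :=
  (forall t, 0 <= t -> sigma_algebra setT (Ft t)) /\
  (forall t, 0 <= t -> Ft t `<=` measurable) /\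
  (forall s t, 0 <= s -> s <= t -> Ft s `<=` Ft t) /\
  (forall t, 0 <= t -> forall A : set XB, measurable A ->
      Ft t (Phi t @^-1` A)) /\
  (forall L : set Omega, measurable L ->
      measurable_fun setT (fun x : XB => Px x L)) /\
  (forall x : X, Px x [set w | Phi 0 w = x] = 1%E) /\
  (forall (x : X) (s t : R) (A : set XB) (B : set Omega),
      0 <= s -> 0 <= t -> measurable A -> Ft s B ->
      Px x (B `&` Phi (s + t) @^-1` A) =
      (\int[Px x]_(w in B) Pt t (Phi s w) A)%E) /\
  (forall (w : Omega) (t : R), 0 <= t ->
      (fun s => Phi s w) @ t^'+ --> Phi t w) /\
  (forall (w : Omega) (t : R), 0 < t ->
      exists l : X, (fun s => Phi s w) @ t^'- --> l) /\
  (forall t, 0 <= t -> forall g : X -> R, continuous g ->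
      (exists M : R, forall x, `|g x| <= M) ->
      continuous (fun x : X =>
        fine (\int[Pt t x]_(y in [set: XB]) (g y)%:E)%E)).

Definition Ptf (t : R) (f : X -> R) (x : X) : R :=
  fine (\int[Pt t x]_(y in [set: XB]) (f y)%:E)%E.

Definition class_A (f : X -> R) : Prop :=
  measurable_fun [set: XB] (f : XB -> R) /\
  forall (x : X) (t : R), 0 <= t ->
    (\int[Pt t x]_(y in [set: XB]) (`|f y|)%:E < +oo)%E.

Definition invariant (mu : probability XB R) : Prop :=
  forall t, 0 <= t -> forall A : set XB, measurable A ->
    (\int[mu]_(x in [set: XB]) Pt t x A)%E = mu A.

Definition pairing (f : X -> R) (mu : probability XB R) : R :=
  fine (\int[mu]_(x in [set: XB]) (f x)%:E)%E.

Definition asymptotically_stable (F : set (X -> R)) : Prop :=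
  exists mu : probability XB R,
    invariant mu /\
    (forall nu : probability XB R, invariant nu ->
       forall A : set XB, measurable A -> nu A = mu A) /\
    (forall f, F f -> mu.-integrable [set: XB] (fun x => (f x)%:E)) /\
    (forall (x : X) f, F f ->
       (fun t => `|Ptf t f x - pairing f mu|) @ +oo --> (0 : R)).

Definition lower_bound_C1 (z : X) : Prop :=
  forall r : R, 0 < r ->
    (0 < ereal_inf [set limf_einf (fun t => Pt t x [set y | (rho y z < r)%R]) (+oo%R : set_system R)
                   | x in [set: X]])%E.

Definition eventually_continuous_at (F : set (X -> R)) (x : X) : Prop :=
  forall f, F f ->
    limf_esup (fun x' : X =>
       limf_esup (fun t : R => (`|Ptf t f x' - Ptf t f x|)%:E) (+oo%R : set_system R))
      (nbhs x) = 0%E.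

Definition eventually_continuous (F : set (X -> R)) : Prop :=
  forall x, eventually_continuous_at F x.

Definition unif_integrable_Px (f : X -> R) (x : X) : Prop :=
  (fun K : R => ereal_sup
     [set (\int[Px x]_(w in [set w | (K <= `|f (Phi t w)|)%R]) (`|f (Phi t w)|)%:E)%E
     | t in [set t : R | (0 <= t)%R]]) @ (+oo%R : set_system R) --> 0%E.

Definition hyp_H1 (F : set (X -> R)) : Prop :=
  forall f, F f -> forall x : X, unif_integrable_Px f x.

End markov.

Definition bounded_lipschitz (R : realType) (X : metricType R) (f : X -> R) :=
  (exists M : R, forall x, `|f x| <= M) /\
  (exists L : R, forall x y, `|f x - f y| <= L * mdist x y).

Definition borel_fun (R : realType) (X : metricType R) (x0 : X) (f : X -> R) :=
  measurable_fun [set: borel_of x0] (f : borel_of x0 -> R).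

(* Main.v *)
Require Import Defs.
From HB Require Import structures.
From mathcomp Require Import all_boot all_order all_algebra.
From mathcomp Require Import all_classical all_reals all_analysis.
From mathcomp Require Import measurable_realfun giry.
From mathcomp Require Import lra ring.
Set Implicit Arguments. Unset Strict Implicit. Unset Printing Implicit Defensive.
Import Order.TTheory GRing.Theory Num.Theory.
Import numFieldNormedType.Exports.
Local Open Scope classical_set_scope.
Local Open Scope ring_scope.

(** (i) implies (ii): all the [P_t f x] share the limit [<f, mu>], and any point of
    the support of [mu] satisfies the lower bound.

    (iii) implies (i).  For bounded [f], running two independent copies from [x] and
    [y] until both sit near [z] shows that [P_t f x - P_t f y] tends to [0].  If the
    laws [P_t(z, .)] were not asymptotically tight, they would charge, at times
    [t_k], uniformly separated sets [H_k].  Let [f_k] be a Lipschitz bump at [H_k].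
    By a Baire category argument on the points charged by the laws [P_t(z, .)],
    either [P_(t_k) f_k] is bounded below on a fixed charged ball for all large [k],
    so that infinitely many disjoint sets eventually carry a fixed mass, or some
    point [u] has [P_(t_k) f_k u] small for infinitely many [k], and a gliding hump
    [sum_i f_(k_i)] contradicts [P_t f u - P_t f z -> 0].

    A limit of [P_t(z, .)] along an ultrafilter is then countably additive on open
    sets up to regularisation, which yields an invariant probability [mu] by
    Caratheodory's extension; convergence on bounded Lipschitz functions and
    uniqueness follow.  For unbounded [f] in [F], density of Lipschitz functions in
    [L^1(mu)] gives [P_t f -> <f, mu>] in [L^1(mu)], hence, by eventual continuity,
    at [z]; uniform integrability and repeated visits to a neighbourhood of [z] carry
    the limit to every [x]. *)

(** * Expectations of bounded measurable functions, and kernels *)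

(** The obstacle throughout is that the time thresholds in eventual continuity and in the lower
    bound depend on the starting point, with no uniformity even on a small ball. Failures are
    therefore recorded along a sequence of bad times and fed to dominated convergence; where only a
    limsup is controlled, the integrand is replaced by its maximum with the bound, which turns the
    limsup into a limit.

    The sets [H_k] must be separated by a fixed distance so that bumps at arbitrary unions of them
    share one Lipschitz constant: only then is the gliding hump an admissible test function.

    For lack of uniform thresholds, tightness never produces a compact set of large mass. It
    controls finite intersections of finite unions of balls, at times growing with the number of
    factors, and this suffices for continuity along increasing open covers, the property on which
    the extension to a measure rests.

    Repeated visits to [z] are handled without stopping times: one follows a subprobability
    dominated by the law of the process started at [x] and removes a fixed fraction of it at each
    stage. Domination carries uniform integrability to every stage. *)

Section expectation.
Context d (T : measurableType d) (R : realType).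
Implicit Types (m : {finite_measure set T -> \bar R}) (f g : T -> R).

Definition bounded_measurable f :=
  measurable_fun [set: T] f /\ exists M : R, forall x, `|f x| <= M.

Definition itg (m : {measure set T -> \bar R}) f := m.-integrable [set: T] (EFin \o f).

Lemma bm_itg m f : bounded_measurable f -> itg m f.
Proof.
move=> [mf [M Mf]]; apply: (le_integrable measurableT _ _
  (finite_measure_integrable_cst m M measurableT)).
- exact/measurable_EFinP.
- move=> x _ /=; rewrite lee_fin; exact: le_trans (Mf x) (ler_norm _).
Qed.

Lemma bm_cst c : bounded_measurable (fun _ : T => c).
Proof. by split; [exact: measurable_cst | exists `|c|]. Qed.

Lemma bmD f g : bounded_measurable f -> bounded_measurable g ->
  bounded_measurable (fun x => f x + g x).
Proof.
move=> [mf [M Mf]] [mg [N Ng]]; split; first exact: measurable_funD.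
by exists (M + N) => x; rewrite (le_trans (ler_normD _ _))// lerD.
Qed.

Lemma bmN f : bounded_measurable f -> bounded_measurable (fun x => - f x).
Proof.
move=> [mf [M Mf]]; split; first exact: measurable_funN.
by exists M => x; rewrite normrN.
Qed.

Lemma bmB f g : bounded_measurable f -> bounded_measurable g ->
  bounded_measurable (fun x => f x - g x).
Proof. by move=> bf bg; apply: bmD => //; exact: bmN. Qed.

Lemma bmM f g : bounded_measurable f -> bounded_measurable g ->
  bounded_measurable (fun x => f x * g x).
Proof.
move=> [mf [M Mf]] [mg [N Ng]]; split; first exact: measurable_funM.
by exists (M * N) => x; rewrite normrM ler_pM.
Qed.

Lemma bm_norm f : bounded_measurable f -> bounded_measurable (fun x => `|f x|).
Proof.
move=> [mf [M Mf]]; split; first exact: measurableT_comp.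
by exists M => x; rewrite normr_id.
Qed.

Lemma bm_max f g : bounded_measurable f -> bounded_measurable g ->
  bounded_measurable (fun x => Num.max (f x) (g x)).
Proof.
move=> [mf [M Mf]] [mg [N Ng]]; split; first exact: measurable_maxr.
exists (Num.max M N) => x; rewrite maxEle; case: ifPn => _.
  by rewrite le_max Ng orbT.
by rewrite le_max Mf.
Qed.

Lemma bm_indic A : measurable A -> bounded_measurable (\1_A : T -> R).
Proof.
move=> mA; split; first exact: measurable_indic.
by exists 1 => x; rewrite indicE; case: (_ \in _); rewrite ?normr1// normr0.
Qed.

Lemma Rint_le m f g : itg m f -> itg m g -> (forall x, f x <= g x) ->
  \int[m]_x f x <= \int[m]_x g x.
Proof. by move=> mf mg fg; apply: le_Rintegral. Qed.

Lemma itgD (m : {measure set T -> \bar R}) f g : itg m f -> itg m g -> itg m (fun x => f x + g x).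
Proof.
move=> mf mg; rewrite /itg (_ : _ \o _ = (EFin \o f) \+ (EFin \o g))%E//.
exact: integrableD.
Qed.

Lemma itgB (m : {measure set T -> \bar R}) f g : itg m f -> itg m g -> itg m (fun x => f x - g x).
Proof.
move=> mf mg; rewrite /itg (_ : _ \o _ = (EFin \o f) \- (EFin \o g))%E//.
exact: integrableB.
Qed.

Lemma itgZ (m : {measure set T -> \bar R}) (c : R) f : itg m f -> itg m (fun x => c * f x).
Proof. by move=> mf; apply: (integrableZl measurableT c mf). Qed.

Lemma itg_norm (m : {measure set T -> \bar R}) f : itg m f -> itg m (fun x => `|f x|).
Proof. exact: integrable_norm. Qed.

Lemma le_itg (m : {measure set T -> \bar R}) f g : measurable_fun [set: T] f -> itg m g ->
  (forall x, `|f x| <= g x) -> itg m f.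
Proof.
move=> mf ig fg; apply: (le_integrable measurableT _ _ ig).
  exact/measurable_EFinP.
by move=> x _ /=; rewrite lee_fin (le_trans (fg x))// ler_norm.
Qed.

Lemma itg_measurable (m : {measure set T -> \bar R}) f : itg m f -> measurable_fun [set: T] f.
Proof. by move=> /integrableP[/measurable_EFinP]. Qed.

Lemma itg_mul_indic (m : {measure set T -> \bar R}) f A : measurable A -> itg m f ->
  itg m (fun x => f x * \1_A x).
Proof.
move=> mA mf; apply: (le_itg _ (itg_norm mf)).
  by apply: measurable_funM; [exact: itg_measurable mf|exact: measurable_indic].
move=> x; rewrite normrM indicE; case: (_ \in _).
  by rewrite normr1 mulr1.
by rewrite normr0 mulr0.
Qed.

Lemma Rint_indic m A : measurable A -> \int[m]_x (\1_A x : R) = fine (m A).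
Proof. by move=> mA; rewrite /Rintegral integral_indic// setIT. Qed.

Lemma Rint_cst (m : probability T R) (c : R) : \int[m]_x c = c.
Proof. by rewrite Rintegral_cst// [X in fine X]probability_setT mulr1. Qed.

Lemma Rint_dct m (f_ : nat -> T -> R) f (M : R) :
  (forall n, measurable_fun [set: T] (f_ n)) -> (forall n x, `|f_ n x| <= M) ->
  (forall x, f_ ^~ x @ \oo --> f x) ->
  (fun n => \int[m]_x f_ n x) @ \oo --> \int[m]_x f x.
Proof.
move=> mf_ Mf_ ff; apply/fine_cvg; rewrite fineK; last first.
  apply: integrable_fin_num => //; apply: bm_itg; split.
    by apply: (measurable_fun_cvg mf_) => x _; exact: ff.
  exists M => x; rewrite -(cvg_lim _ (cvg_norm (ff x)))//.
  apply: limr_le; first by apply/cvg_ex; eexists; exact: (cvg_norm (ff x)).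
  by apply: nearW => n; exact: Mf_.
apply: (@dominated_cvg _ _ _ m _ measurableT (fun n x => (f_ n x)%:E) (EFin \o f)
   (cst M%:E)) => //.
- by move=> n; exact/measurable_EFinP.
- by move=> x _; apply/cvg_EFin; [exact: nearW|exact: ff].
- exact: finite_measure_integrable_cst.
- by move=> n x _; rewrite lee_fin; exact: Mf_.
Qed.

End expectation.

(** * Integration against a mixture of kernels *)

Section bind.
Context d1 d2 (T1 : measurableType d1) (T2 : measurableType d2) (R : realType).
Variables (mu : giry T1 R) (k : T1 -> giry T2 R) (nu : giry T2 R).
Hypothesis mk : forall A, measurable A -> measurable_fun [set: T1] (k ^~ A).

Lemma measurable_integral_bind (h : T2 -> \bar R) : measurable_fun [set: T2] h ->
  (forall x, 0 <= h x)%E -> measurable_fun [set: T1] (fun x => \int[k x]_y h y)%E.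
Proof.
move=> mh h0; apply: (@measurableT_comp _ _ _ _ _ _ (giry_int ^~ h) _ k).
  exact: measurable_giry_int.
exact: measurable_giry_codensity.
Qed.

Lemma measurable_Rint_bind (h : T2 -> R) : (forall x, itg (k x) h) ->
  measurable_fun [set: T1] (fun x => \int[k x]_y h y).
Proof.
move=> ih.
have mh : measurable_fun [set: T2] h := itg_measurable (ih point).
rewrite (_ : (fun _ => _) = fun x =>
  fine (\int[k x]_y (EFin \o h)^\+ y)%E - fine (\int[k x]_y (EFin \o h)^\- y)%E); last first.
  apply/funext => x; rewrite /Rintegral integralE fineB//.
    exact: integrable_pos_fin_num (ih x).
  exact: integrable_neg_fin_num (ih x).
apply: measurable_funB; (apply: measurableT_comp => //; apply: measurable_integral_bind;
   [|by move=> ?; exact: funepos_ge0 || exact: funeneg_ge0]).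
  by apply: measurable_funepos; exact/measurable_EFinP.
by apply: measurable_funeneg; exact/measurable_EFinP.
Qed.

Hypothesis nuE : forall A, measurable A -> nu A = (\int[mu]_x k x A)%E.

(** [nu] agrees on measurable sets with the Giry bind of [mu] and [k], hence has the same integrals,
    and the bind formula for nonnegative functions applies. *)
Lemma integral_bind (h : T2 -> \bar R) : measurable_fun [set: T2] h ->
  (forall x, 0 <= h x)%E -> (\int[nu]_y h y = \int[mu]_x \int[k x]_y h y)%E.
Proof.
move=> mh h0; have mk' : measurable_fun [set: T1] k by exact: measurable_giry_codensity.
rewrite -[RHS](giry_int_bind mu mk' mh h0) /giry_int.
apply: eq_measure_integral => A mA _; rewrite [LHS]nuE//=.
by rewrite [RHS]giry_int_map//; exact: measurable_giry_ev.
Qed.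

Lemma itg_bind_norm (h : T2 -> R) : itg nu h -> (forall x, itg (k x) h) ->
  itg mu (fun x => \int[k x]_y `|h y|).
Proof.
move=> ih ikh; apply/integrableP; split.
  by apply/measurable_EFinP/measurable_Rint_bind => x; exact: itg_norm.
have /integrableP[mh] := ih; rewrite integral_bind//; last first.
  exact: measurableT_comp.
congr (_ < _)%E; apply: eq_integral => x _ /=.
rewrite ger0_norm; last by apply: Rintegral_ge0 => y _.
rewrite fineK//; apply: integrable_fin_num => //.
exact: itg_norm.
Qed.

Lemma itg_of_bind (h : T2 -> R) : measurable_fun [set: T2] h -> (forall x, itg (k x) h) ->
  itg mu (fun x => \int[k x]_y `|h y|) -> itg nu h.
Proof.
move=> mh ikh /integrableP[_ ih]; apply/integrableP; split; first exact/measurable_EFinP.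
rewrite integral_bind//; last by apply: measurableT_comp => //; exact/measurable_EFinP.
move: ih; congr (_ < _)%E; apply: eq_integral => x _ /=.
rewrite ger0_norm; last by apply: Rintegral_ge0 => y _.
rewrite fineK//; apply: integrable_fin_num => //.
exact: itg_norm.
Qed.

Lemma itg_bind (h : T2 -> R) : itg nu h -> (forall x, itg (k x) h) ->
  itg mu (fun x => \int[k x]_y h y).
Proof.
move=> ih ikh; apply: le_itg (itg_bind_norm ih ikh) _.
  exact: measurable_Rint_bind.
by move=> x; apply: le_normr_Rintegral => //; exact: ikh.
Qed.

(** The nonnegative formula is applied to the two parts of [h]; each is dominated by [|h|], so all
    integrals involved are finite and may be subtracted. *)
Lemma Rint_bind (h : T2 -> R) : itg nu h -> (forall x, itg (k x) h) ->
  \int[nu]_y h y = \int[mu]_x \int[k x]_y h y.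
Proof.
move=> ih ikh.
have mh := itg_measurable ih; have mEh : measurable_fun setT (EFin \o h) by exact/measurable_EFinP.
have fp x : \int[k x]_y h y = fine (\int[k x]_y (EFin \o h)^\+ y)%E -
    fine (\int[k x]_y (EFin \o h)^\- y)%E.
  rewrite /Rintegral integralE fineB//.
    exact: integrable_pos_fin_num (ikh x).
  exact: integrable_neg_fin_num (ikh x).
have bnd (g : T2 -> \bar R) : measurable_fun setT g -> (forall y, 0 <= g y)%E ->
    (forall y, g y <= `|(h y)%:E|)%E ->
    mu.-integrable setT (fun x => \int[k x]_y g y)%E /\
    (forall x, \int[k x]_y g y \is a fin_num)%E /\ (\int[nu]_y g y \is a fin_num)%E.
  move=> mg g0 gh; have kf x : (\int[k x]_y g y \is a fin_num)%E.
    rewrite ge0_fin_numE; last by apply: integral_ge0 => y _; exact: g0.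
    have /integrableP[_] := ikh x; apply: le_lt_trans; apply: ge0_le_integral => //.
    exact: measurableT_comp.
  have nf : (\int[nu]_y g y < +oo)%E.
    have /integrableP[_] := ih; apply: le_lt_trans; apply: ge0_le_integral => //.
    exact: measurableT_comp.
  split; last split => //.
    apply/integrableP; split; first exact: measurable_integral_bind.
    under eq_integral do rewrite gee0_abs ?integral_ge0//.
    by rewrite -integral_bind.
  by rewrite ge0_fin_numE//; exact: integral_ge0.
have lep y : ((EFin \o h)^\+ y <= `|(h y)%:E|)%E.
  by rewrite -/((abse \o (EFin \o h)) y) fune_abse leeDl.
have len y : ((EFin \o h)^\- y <= `|(h y)%:E|)%E.
  by rewrite -/((abse \o (EFin \o h)) y) fune_abse leeDr.
have [ip [fpk fpn]] := bnd _ (measurable_funepos mEh) (funepos_ge0 _) lep.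
have [im [fmk fmn]] := bnd _ (measurable_funeneg mEh) (funeneg_ge0 _) len.
rewrite [LHS]/Rintegral integralE fineB//.
rewrite !integral_bind//; [|exact: measurable_funeneg|exact: measurable_funepos].
under [RHS]eq_Rintegral do rewrite fp.
rewrite RintegralB//.
- by congr (fine _ - fine _); apply: eq_integral => x _; rewrite fineK.
- by apply: eq_integrable ip => // x _; rewrite /= fineK.
- by apply: eq_integrable im => // x _; rewrite /= fineK.
Qed.

End bind.

(** * Asymptotic equality by coupling *)

Section borel.
Context (R : realType) (X : metricType R) (x0 : X).
Local Notation XB := (borel_of x0).

Lemma borel_open (A : set X) : open A -> measurable (A : set XB).
Proof. by move=> oA; exact: sub_sigma_algebra. Qed.

Lemma open_mball (z : X) r : open [set y | mdist z y < r].
Proof.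
rewrite openE => y /= zy; apply/nbhs_ballP; exists (r - mdist z y); first by rewrite /= subr_gt0.
move=> u; rewrite ballEmdist/= => yu.
by rewrite (le_lt_trans (metric_triangle z y u))// -ltrBrDl.
Qed.

Lemma borel_continuous (f : X -> R) : continuous f -> measurable_fun [set: XB] (f : XB -> R).
Proof.
move=> /continuousP cf; apply: (measurability _ (RGenOpens.measurableE R)).
move=> _ [_ [a [b ->] <-]]; rewrite setTI; apply: borel_open.
exact/cf/interval_open.
Qed.

End borel.

(** Turns a limsup bound into a genuine limit, so that dominated convergence can stand in for the
    reverse Fatou lemma. *)
Lemma cvg_max_cst (R : realType) (b : nat -> R) (c : R) :
  (forall e, 0 < e -> \forall n \near \oo, b n <= c + e) ->
  (fun n => Num.max (b n) c) @ \oo --> c.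
Proof.
move=> bc; apply/cvgrPdist_le => e e0; near=> n.
have : b n <= c + e by near: n; exact: bc.
rewrite maxEle; case: ifPn => [_ _|]; first by rewrite subrr normr0 ltW.
by rewrite -ltNge => cb bce; rewrite ler_distlC; apply/andP; split; lra.
Unshelve. all: by end_near. Qed.

Section semigroup.
Context (R : realType) (X : metricType R) (x0 : X).
Local Notation XB := (borel_of x0).
Variable p : R -> XB -> probability XB R.

Definition Pop (t : R) (f : X -> R) (x : X) : R := \int[p t x]_y f y.

Definition ev_cont (f : X -> R) (z : X) := forall e : R, 0 < e ->
  exists2 r : R, 0 < r & forall u, mdist z u < r ->
  exists T : R, forall t, T <= t -> `|Pop t f u - Pop t f z| <= e.

(** The mass [a] depends on the radius alone, the threshold [T] also on the starting point. *)
Definition lower_bd (z : X) := forall r : R, 0 < r ->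
  exists2 a : R, 0 < a & forall x, exists T : R, forall t, T <= t ->
  a <= Pop t \1_[set y | mdist z y < r] x.

Hypothesis mp : forall t A, measurable A -> measurable_fun [set: XB] (fun x => p t x A).
Hypothesis CK : forall s t x A, 0 <= s -> 0 <= t -> measurable A ->
  p (s + t) x A = (\int[p s x]_u p t u A)%E.

Local Notation bm := (@bounded_measurable _ XB R).

Lemma measurable_Pop t f : (forall x, itg (p t x) f) -> measurable_fun [set: XB] (Pop t f).
Proof. exact: (@measurable_Rint_bind _ _ XB XB R (p t) (mp t)). Qed.

Lemma Pop_le t f g x : bm f -> bm g -> (forall y, f y <= g y) -> Pop t f x <= Pop t g x.
Proof. by move=> bf bg fg; apply: Rint_le => //; exact: bm_itg. Qed.

Lemma Pop_cst t c x : Pop t (fun=> c) x = c. Proof. exact: Rint_cst. Qed.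

Lemma Pop_bound t f x M : measurable_fun [set: XB] (f : XB -> R) -> (forall y, `|f y| <= M) -> `|Pop t f x| <= M.
Proof.
move=> mf fM; have bf : bm f by split => //; exists M.
rewrite (le_trans (le_normr_Rintegral _ (bm_itg _ bf)))//.
rewrite -[leRHS](Pop_cst t M x); apply: Pop_le => //; [exact: bm_norm|exact: bm_cst].
Qed.

Lemma bm_Pop t f : bm f -> bm (Pop t f).
Proof.
move=> bf; split; first by apply: measurable_Pop => x; exact: bm_itg.
by case: bf => mf [M fM]; exists M => x; exact: Pop_bound.
Qed.

Lemma PopD s t f x : 0 <= s -> 0 <= t -> (forall u y, 0 <= u -> itg (p u y) f) ->
  Pop (s + t) f x = Pop s (Pop t f) x.
Proof.
move=> s0 t0 itf; apply: (@Rint_bind _ _ XB XB R (p s x) (p t) (p (s + t) x) (mp t)).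
- by move=> A mA; exact: CK.
- by apply: itf; rewrite addr_ge0.
- by move=> y; exact: itf.
Qed.

Lemma Pop_norm t f x : itg (p t x) f -> `|Pop t f x| <= Pop t (fun y => `|f y|) x.
Proof. by move=> ?; exact: le_normr_Rintegral. Qed.

(* One step of an independent coupling: with probability at least [a ^+ 2] both
   copies sit in the ball at time [T], where the limsup is small. *)
Lemma ev_cont_asym f z : bm f -> ev_cont f z -> lower_bd z ->
  forall x y e, 0 < e -> exists T : R, forall t, T <= t -> `|Pop t f x - Pop t f y| <= e.
Proof.
move=> bf ecf lbz; have [mf [M fM]] := bf.
have bPM t x : `|Pop t f x| <= M by exact: Pop_bound.
(* The supremum [D] of [S] is the largest limsup of [|P_t f x - P_t f y|] over all pairs; the goal
   is [D <= 0]. *)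
pose S := [set d : R | exists x y, forall T, exists2 t, T <= t &
   d <= `|Pop t f x - Pop t f y|].
have S0 : S 0 by exists x0, x0 => T; exists T.
have ubS : ubound S (M + M).
  move=> d [x [y /(_ 0)[t _]]] /le_trans; apply.
  by rewrite (le_trans (ler_normB _ _))// lerD.
have hsS : has_sup S by split; [exists 0|exists (M + M)].
set D := sup S.
have far u v d' : D < d' -> exists T : R, forall t, T <= t -> `|Pop t f u - Pop t f v| <= d'.
  move=> Dd'; apply: contrapT => /forallNP no.
  suff : S d' by move=> /(ub_le_sup (proj2 hsS)); rewrite leNgt Dd'.
  exists u, v => T; apply: contrapT => no2; apply: (no T) => t Tt.
  by rewrite leNgt; apply/negP => /ltW lt; apply: no2; exists t.
have [D0|D0] := leP D 0.
  by move=> x y e e0; apply: far; rewrite (le_lt_trans D0).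
exfalso.
have D8 : 0 < D / 8 by rewrite divr_gt0.
have [r r0 near_z] := ecf _ D8.
have [a a0 lb] := lbz _ r0.
set B : set XB := [set y | mdist z y < r] in lb.
have mB : measurable B by apply: borel_open; exact: open_mball.
(* A pair is chosen whose limsup misses [D] by less than the gain [D * (3 / 4) * a ^+ 2] that the
   coupling will yield. *)
have [|d Sd dD] := @sup_adherent _ S (D * (3 / 4) * a ^+ 2) _ hsS.
  by rewrite !mulr_gt0// exprn_gt0.
have [x [y xy]] := Sd.
have [Tx lbx] := lb x; have [Ty lby] := lb y.
pose T := Num.max 0 (Num.max Tx Ty).
have T0 : 0 <= T by rewrite le_max lexx.
have px : a <= Pop T \1_B x by apply: lbx; rewrite !le_max lexx orbT.
have py : a <= Pop T \1_B y by apply: lby; rewrite !le_max lexx !orbT.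
have /choice[s_ sP] : forall n : nat, exists s, n%:R <= s /\
    d <= `|Pop (T + s) f x - Pop (T + s) f y|.
  move=> n; have [t tn dt] := xy (T + n%:R).
  exists (t - T); split; first by rewrite lerBrDl.
  by rewrite (addrC T) subrK.
have s0 n : 0 <= s_ n by rewrite (le_trans _ (proj1 (sP n))).
(* [c u v] bounds the limsup from [(u, v)]: in general it is at most [D], and on [B] both terms are
   within [D / 8] of the value at [z], which leaves [D / 4]. Taking the maximum with [c] in [k]
   makes the integrand converge to [c]. *)
pose c (u v : X) : R := D - D * (3 / 4) * (\1_B u * \1_B v).
pose k n (u v : X) : R := Num.max `|Pop (s_ n) f u - Pop (s_ n) f v| (c u v).
have ind01 u : 0 <= (\1_B u : R) <= 1 by rewrite indicE; case: (_ \in _); rewrite ?lexx ?ler01.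
have c01 u v : 0 <= c u v <= D.
  rewrite /c; have /andP[u0 u1] := ind01 u; have /andP[v0 v1] := ind01 v.
  have : 0 <= (\1_B u : R) * \1_B v <= 1 by rewrite mulr_ge0//= mulr_ile1.
  by move: (_ * _) => w /andP[w0 w1]; apply/andP; split; nra.
have k0 n u v : 0 <= k n u v by rewrite le_max normr_ge0.
have kM n u v : `|k n u v| <= M + M + D.
  rewrite ger0_norm// ge_max; apply/andP; split.
    rewrite (le_trans (ler_normB _ _))// -[leLHS]addr0 lerD//; first exact: lerD.
    exact: ltW.
  have /andP[_ cD] := c01 u v; rewrite (le_trans cD)// lerDr.
  by rewrite addr_ge0// (le_trans _ (fM x0)).
have ks u v : (fun n => k n u v) @ \oo --> c u v.
  apply: cvg_max_cst => e e0.
  have [N NP] : exists N : R, forall t, N <= t -> `|Pop t f u - Pop t f v| <= c u v + e.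
    rewrite /c !indicE; case: (boolP (u \in B)) => [|_]; last first.
      by rewrite mul0r mulr0 subr0; apply: far; rewrite ltrDl.
    rewrite inE/= => uB; case: (boolP (v \in B)) => [|_]; last first.
      by rewrite mulr0 mulr0 subr0; apply: far; rewrite ltrDl.
    rewrite inE/= => vB.
    have [N1 H1] := near_z u uB; have [N2 H2] := near_z v vB.
    exists (Num.max N1 N2) => t; rewrite ge_max => /andP[/H1 h1 /H2 h2].
    move: h1 h2; rewrite !ler_distl => /andP[? ?] /andP[? ?].
    by apply/andP; split; lra.
  near=> n; apply: NP; apply: (le_trans _ (proj1 (sP n))).
  by near: n; exact: nbhs_infty_ger.
have mk2 n : measurable_fun [set: XB * XB] (fun w : XB * XB => k n w.1 w.2).
  have mP : measurable_fun [set: XB] (Pop (s_ n) f) := proj1 (bm_Pop _ bf).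
  have mI : measurable_fun [set: XB] (\1_B : XB -> R) by exact: measurable_indic.
  have mc1 (g : XB -> R) : measurable_fun setT g -> measurable_fun setT (fun w : XB * XB => g w.1).
    by move=> mg; exact: measurableT_comp.
  have mc2 (g : XB -> R) : measurable_fun setT g -> measurable_fun setT (fun w : XB * XB => g w.2).
    by move=> mg; exact: measurableT_comp.
  apply: measurable_maxr.
    by apply: measurableT_comp => //; apply: measurable_funB; [exact: mc1|exact: mc2].
  apply: measurable_funB => //; apply: measurable_funM => //.
  by apply: measurable_funM; [exact: mc1|exact: mc2].
have bk n u : bm (k n u).
  apply: bm_max.
    by apply/bm_norm/bmB; [exact: bm_cst|exact: bm_Pop].
  apply: bmB; first exact: bm_cst.
  apply: bmM; first exact: bm_cst.
  by apply: bmM; [exact: bm_cst|exact: bm_indic].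
pose I n u := \int[p T y]_v k n u v.
have mI n : measurable_fun [set: XB] (I n).
  apply: measurableT_comp => //.
  apply: (@measurable_fun_fubini_tonelli_F _ _ XB XB R (p T y)
    (fun w => (k n w.1 w.2)%:E)) => //.
  - exact/measurable_EFinP.
  - by move=> w; rewrite lee_fin.
have bI n u : `|I n u| <= M + M + D.
  by apply: (@Pop_bound T (k n u) y) => //; case: (bk n u).
have Is u : (fun n => I n u) @ \oo --> D - D * (3 / 4) * (\1_B u * Pop T \1_B y).
  rewrite (_ : D - _ = \int[p T y]_v c u v).
    by apply: (Rint_dct (M := M + M + D)) => //; move=> n; case: (bk n u).
  rewrite /c RintegralB//; last 2 first.
  - exact/bm_itg/bm_cst.
  - apply: itgZ; apply: itgZ; exact/bm_itg/bm_indic.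
  rewrite Rint_cst RintegralZl//; last by apply: itgZ; exact/bm_itg/bm_indic.
  by rewrite RintegralZl//; exact/bm_itg/bm_indic.
have IIs : (fun n => \int[p T x]_u I n u) @ \oo -->
    D - D * (3 / 4) * (Pop T \1_B x * Pop T \1_B y).
  rewrite (_ : D - _ = \int[p T x]_u (D - D * (3 / 4) * (\1_B u * Pop T \1_B y))).
    exact: (Rint_dct (M := M + M + D)).
  have iI : itg (p T x) (fun u => \1_B u * Pop T \1_B y).
    by apply/bm_itg/bmM; [exact: bm_indic|exact: bm_cst].
  rewrite RintegralB//; [|exact/bm_itg/bm_cst|exact: itgZ].
  rewrite Rint_cst RintegralZl// RintegralZr//; exact/bm_itg/bm_indic.
have dI n : d <= \int[p T x]_u I n u.
  apply: (le_trans (proj2 (sP n))).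
  have itf u v : 0 <= u -> itg (p u v) f by move=> _; exact: bm_itg.
  rewrite !(PopD _ T0 (s0 n) itf).
  have bPf := bm_Pop (s_ n) bf.
  rewrite -[X in _ - X](Pop_cst T _ x) -RintegralB//; [|exact: bm_itg|exact/bm_itg/bm_cst].
  apply: (le_trans (le_normr_Rintegral _ _)) => //.
    by apply/bm_itg/bmB => //; exact: bm_cst.
  apply: Rint_le.
  - by apply/bm_itg/bm_norm/bmB => //; exact: bm_cst.
  - by apply: bm_itg; split; [exact: mI|exists (M + M + D)].
  move=> u; rewrite -[X in `|X - _|](Pop_cst T _ y) -RintegralB//; [|exact/bm_itg/bm_cst|exact: bm_itg].
  have bu : bm (fun v => Pop (s_ n) f u - Pop (s_ n) f v) by apply: bmB => //; exact: bm_cst.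
  apply: (le_trans (le_normr_Rintegral _ _)) => //; first exact: bm_itg.
  apply: Rint_le; [exact/bm_itg/bm_norm|exact: bm_itg|].
  by move=> v; rewrite le_max lexx.
have dlim : d <= D - D * (3 / 4) * (Pop T \1_B x * Pop T \1_B y).
  rewrite -(cvg_lim _ IIs)//; apply: limr_ge; first by apply/cvg_ex; eexists; exact: IIs.
  exact: nearW.
have : a ^+ 2 <= Pop T \1_B x * Pop T \1_B y by rewrite expr2 ler_pM// ltW.
move: dlim dD; move: (Pop T \1_B x * _) (a ^+ 2) => q w; rewrite -/D => h1 h2 h3.
have : 0 <= D * (q - w) by rewrite mulr_ge0 ?subr_ge0// ltW.
lra.
Unshelve. all: by end_near. Qed.

End semigroup.

(** * Lipschitz bumps and Polish spaces *)

Section bump.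
Context (R : realType) (X : metricType R).
Implicit Types (A B : set X) (e : R) (x y : X).

(** The supremum of this set is [max 0 (1 - dist(x, A) / e)]; the explicit [0] covers the empty [A]
    and avoids a distance to a set. *)
Definition bump_set A e x := [set 0] `|` [set 1 - mdist x y / e | y in A].
Definition bump A e x : R := sup (bump_set A e x).

Variable (e : R) (e0 : 0 < e).

Lemma bump_has_sup A x : has_sup (bump_set A e x).
Proof.
split; first by exists 0; left.
exists 1 => _ [->//|[y _ <-]]; rewrite gerBl divr_ge0 ?mdist_ge0//; exact: ltW.
Qed.

Lemma bump_ge0 A x : 0 <= bump A e x.
Proof. by apply: ub_le_sup; [case: (bump_has_sup A x)|left]. Qed.

Lemma bump_ge A x y : A y -> 1 - mdist x y / e <= bump A e x.
Proof. by move=> Ay; apply: ub_le_sup; [case: (bump_has_sup A x)|right; exists y]. Qed.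

Lemma bump_leP A x c : 0 <= c -> (forall y, A y -> 1 - mdist x y / e <= c) -> bump A e x <= c.
Proof.
move=> c0 Ac; apply: ge_sup; first by case: (bump_has_sup A x).
by move=> _ [->//|[y Ay <-]]; exact: Ac.
Qed.

Lemma bump_le1 A x : bump A e x <= 1.
Proof.
by apply: bump_leP => // y _; rewrite gerBl divr_ge0 ?mdist_ge0//; exact: ltW.
Qed.

Lemma bump_norm A x : `|bump A e x| <= 1.
Proof. by rewrite ger0_norm ?bump_ge0// bump_le1. Qed.

Lemma bump1 A x : A x -> bump A e x = 1.
Proof.
move=> Ax; apply/eqP; rewrite eq_le bump_le1/=.
by have := bump_ge x Ax; rewrite mdistxx mul0r subr0.
Qed.

Lemma bumpS A B x : A `<=` B -> bump A e x <= bump B e x.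
Proof. by move=> AB; apply: bump_leP => [|y /AB]; [exact: bump_ge0|exact: bump_ge]. Qed.

Lemma bump_gt0 A x : 0 < bump A e x -> exists2 y, A y & mdist x y < e.
Proof.
move=> b0; apply: contrapT => no; move: b0; apply/negP; rewrite -leNgt.
apply: bump_leP => // y Ay; rewrite subr_le0 ler_pdivlMr// mul1r leNgt.
by apply/negP => xy; apply: no; exists y.
Qed.

Lemma bump_lip A x y : `|bump A e x - bump A e y| <= e^-1 * mdist x y.
Proof.
suff h u v : bump A e u <= bump A e v + e^-1 * mdist u v.
  rewrite ler_distl; apply/andP; split; last exact: h.
  by rewrite lerBlDr metric_sym; exact: h.
have ei : 0 < e^-1 by rewrite invr_gt0.
apply: bump_leP => [|w Aw].
  by rewrite addr_ge0 ?bump_ge0// mulr_ge0 ?mdist_ge0// ltW.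
apply: (@le_trans _ _ (1 - mdist v w / e + e^-1 * mdist u v)); last by rewrite lerD2r bump_ge.
have := ler_wpM2l (ltW ei) (metric_triangle v u w); rewrite (metric_sym v u) mulrDr.
by move: (mdist u v) (mdist u w) (mdist v w) => a b c h; lra.
Qed.

Lemma bump_bounded_lipschitz A : bounded_lipschitz (bump A e).
Proof. by split; [exists 1; exact: bump_norm|exists e^-1; exact: bump_lip]. Qed.

(** At distance [e + e] no point lies within [e] of both sets, so at most one of the two bumps is
    nonzero there. *)
Lemma bump_addS A B x : (forall a b, A a -> B b -> e + e <= mdist a b) ->
  bump A e x + bump B e x <= bump (A `|` B) e x.
Proof.
move=> sep; have [|/bump_gt0[a Aa xa]] := leP (bump A e x) 0.
  move=> bA; have -> : bump A e x = 0 by apply/eqP; rewrite eq_le bA bump_ge0.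
  by rewrite add0r bumpS.
have [|/bump_gt0[b Bb xb]] := leP (bump B e x) 0.
  move=> bB; have -> : bump B e x = 0 by apply/eqP; rewrite eq_le bB bump_ge0.
  by rewrite addr0 bumpS.
have := sep _ _ Aa Bb; rewrite leNgt (le_lt_trans (metric_triangle a x b))//.
by rewrite ltrD// metric_sym.
Qed.

End bump.

Section lipschitz.
Context (R : realType) (X : metricType R) (x0 : X).
Local Notation XB := (borel_of x0).

Lemma bounded_lipschitz_continuous (f : X -> R) : bounded_lipschitz f -> continuous f.
Proof.
move=> [_ [L fL]] x; apply/cvgrPdist_le => e e0.
pose M := `|L| + 1; have M0 : 0 < M by rewrite ltr_wpDl.
apply/nbhs_ballP; exists (e / M); first by rewrite /= divr_gt0.
move=> y; rewrite ballEmdist/= ltr_pdivlMr// => xy.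
rewrite (le_trans (fL x y))// ltW// (le_lt_trans _ xy)// mulrC ler_wpM2l ?mdist_ge0//.
by rewrite (le_trans (ler_norm _))// lerDl.
Qed.

Lemma bounded_lipschitz_bm (f : X -> R) : bounded_lipschitz f ->
  bounded_measurable (f : XB -> R).
Proof.
move=> bf; split; last by case: bf.
by apply: borel_continuous; exact: bounded_lipschitz_continuous.
Qed.

Lemma bounded_lipschitz_cst (c : R) : bounded_lipschitz (fun _ : X => c).
Proof.
split; first by exists (`|c|).
by exists 0 => x y; rewrite subrr normr0 mul0r.
Qed.

Lemma bounded_lipschitzD (f g : X -> R) : bounded_lipschitz f -> bounded_lipschitz g ->
  bounded_lipschitz (fun x => f x + g x).
Proof.
move=> [[M fM] [L fL]] [[N gN] [K gK]]; split.
  by exists (M + N) => x; rewrite (le_trans (ler_normD _ _))// lerD.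
exists (L + K) => x y; rewrite opprD addrACA mulrDl.
by rewrite (le_trans (ler_normD _ _))// lerD.
Qed.

Lemma bounded_lipschitzZ (c : R) (f : X -> R) : bounded_lipschitz f ->
  bounded_lipschitz (fun x => c * f x).
Proof.
move=> [[M fM] [L fL]]; split.
  by exists (`|c| * M) => x; rewrite normrM ler_wpM2l.
by exists (`|c| * L) => x y; rewrite -mulrBr normrM -mulrA ler_wpM2l.
Qed.

Lemma bump_cvg_indic (C : set X) : closed C ->
  forall x, (fun n => bump C n.+1%:R^-1 x) @ \oo --> (\1_C x : R).
Proof.
move=> cC x; apply: cvg_near_cst; rewrite indicE; case: (boolP (x \in C)) => [|xC].
  by rewrite inE => Cx; apply: nearW => n; rewrite bump1// invr_gt0.
have /open_nbhs_nbhs/nbhs_ballP[r /= r0 rC] : open_nbhs x (~` C).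
  by split; [exact: closed_openC|move=> Cx; move: xC; rewrite mem_set].
near=> n; apply/eqP; rewrite eq_le bump_ge0 ?invr_gt0// andbT leNgt; apply/negP.
have n0 : 0 < n.+1%:R^-1 :> R by rewrite invr_gt0.
move=> /(bump_gt0 n0)[y Cy xy].
suff : (~` C) y by [].
apply: rC; rewrite ballEmdist/= (lt_le_trans xy)// ltW//.
by near: n; exact: near_infty_natSinv_lt (PosNum r0).
Unshelve. all: by end_near. Qed.

End lipschitz.

Section polish.
Context (R : realType) (X : metricType R).
Hypothesis polX : polish X.

Lemma polish_complete (F : set_system X) : ProperFilter F ->
  (forall e : R, 0 < e -> exists x, F [set y | mdist x y < e]) -> exists l : X, F --> l.
Proof.
move=> PF Fe; apply: (proj1 polX) => //; apply: cauchy_exP => e e0.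
by have [x Fx] := Fe e e0; exists x; rewrite ballEmdist.
Qed.

Lemma polish_dense_seq (x0 : X) : exists d : nat -> X, forall x (e : R), 0 < e ->
  exists n, mdist (d n) x < e.
Proof.
have [_ [D [cD dD]]] := polX.
have /countable_injP[f injf] := cD.
have /choice[s sP] : forall n, exists x, forall y, D y -> f y = n -> x = y.
  move=> n; have [[y Dy fy]|no] := pselect (exists2 y, D y & f y = n).
    by exists y => u Du fu; apply: injf; rewrite ?inE// fy fu.
  by exists x0 => y Dy fy; case: no; exists y.
exists s => x e e0.
have [||y [/= xy Dy]] := dD [set y | mdist x y < e].
- by exists x => /=; rewrite mdistxx.
- exact: open_mball.
by exists (f y); rewrite (sP _ y Dy erefl) metric_sym.
Qed.

(* Lindelof's argument. *)
Lemma locally_null (x0 : X) (m : {measure set (borel_of x0) -> \bar R}) (U : set X) :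
  (forall y, U y -> exists2 r : R, 0 < r & m [set u | mdist y u < r] = 0%E) ->
  m.-negligible U.
Proof.
move=> nullU; have [d dP] := polish_dense_seq x0.
pose B k j : set X := [set u | mdist (d j) u < k.+1%:R^-1].
have mball w r : measurable ([set y | mdist w y < r] : set (borel_of x0)).
  by apply: borel_open; exact: open_mball.
pose G k j : set (borel_of x0) := [set u | m (B k j) = 0%E /\ B k j u].
have G0 k j : m.-negligible (G k j).
  have [B0|nB] := pselect (m (B k j) = 0%E).
    by exists (B k j); split; [exact: mball|exact: B0|move=> u []].
  by rewrite (_ : G k j = set0); [exact: negligible_set0|apply/seteqP; split => // u []].
apply: (@negligibleS _ _ _ m (\bigcup_k \bigcup_j G k j)); last first.
  by apply: negligible_bigcup => k; exact: negligible_bigcup.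
move=> y Uy; have [r r0 yr] := nullU y Uy.
have r2 : 0 < r / 2 by rewrite divr_gt0.
have := near_infty_natSinv_lt (PosNum r2); case=> k _ /(_ k (leqnn k)) /= kr.
have [j dj] := dP y (k.+1%:R^-1) ltac:(by rewrite invr_gt0).
exists k => //; exists j => //; split => //.
apply/eqP; rewrite eq_le measure_ge0 andbT -yr.
apply: le_measure; rewrite ?inE; [exact: mball|exact: mball|].
move=> v /= jv; rewrite (le_lt_trans (metric_triangle y (d j) v))//.
by rewrite metric_sym [ltRHS]splitr ltrD// ?(lt_trans dj)// (lt_trans jv).
Qed.

End polish.

(** * Tightness *)

Section tightness.
Context (R : realType) (X : metricType R) (x0 : X).
Local Notation XB := (borel_of x0).
Variable p : R -> XB -> probability XB R.
Local Notation P := (Pop p).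
Local Notation bm := (@bounded_measurable _ XB R).
Hypothesis polX : polish X.
Hypothesis mp : forall t A, measurable A -> measurable_fun [set: XB] (fun x => p t x A).
Hypothesis CK : forall s t x A, 0 <= s -> 0 <= t -> measurable A ->
  p (s + t) x A = (\int[p s x]_u p t u A)%E.
Hypothesis feller : forall t, 0 <= t -> forall g : X -> R, continuous g ->
  (exists M : R, forall x, `|g x| <= M) -> continuous (P t g).
Variable z : X.
Hypothesis lbz : lower_bd p z.
Hypothesis asymL : forall f : X -> R, bounded_lipschitz f -> forall x y e, 0 < e ->
  exists T : R, forall t, T <= t -> `|P t f x - P t f y| <= e.

Lemma PopDb s t f x : 0 <= s -> 0 <= t -> bm f -> P (s + t) f x = P s (P t f) x.
Proof. by move=> s0 t0 bf; apply: (PopD mp CK) => // u y _; exact: bm_itg. Qed.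

Lemma Pop_dct t x (f_ : nat -> X -> R) f (M : R) : (forall n, bm (f_ n)) ->
  (forall n y, `|f_ n y| <= M) -> (forall y, f_ ^~ y @ \oo --> f y) ->
  (fun n => P t (f_ n) x) @ \oo --> P t f x.
Proof. by move=> bf fM fs; apply: Rint_dct => // n; case: (bf n). Qed.

Lemma Pop_indicE t x (A : set X) : measurable (A : set XB) -> P t \1_A x = fine (p t x A).
Proof. exact: Rint_indic. Qed.

Lemma Pop_indic_gt0 t x (A : set X) : measurable (A : set XB) ->
  (0 < P t \1_A x) = (0 < p t x A)%E.
Proof.
by move=> mA; rewrite Pop_indicE// -lte_fin fineK// fin_num_measure.
Qed.

Lemma Pop_ge0 t f x : (forall y, 0 <= f y) -> 0 <= P t f x.
Proof. by move=> f0; apply: Rintegral_ge0. Qed.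

Lemma Pop_add t f g x : bm f -> bm g -> P t (fun y => f y + g y) x = P t f x + P t g x.
Proof. by move=> bf bg; apply: RintegralD => //; exact: bm_itg. Qed.

Lemma Pop_sub t f g x : bm f -> bm g -> P t (fun y => f y - g y) x = P t f x - P t g x.
Proof. by move=> bf bg; apply: RintegralB => //; exact: bm_itg. Qed.

Lemma Pop_scale t c f x : bm f -> P t (fun y => c * f y) x = c * P t f x.
Proof. by move=> bf; apply: RintegralZl => //; exact: bm_itg. Qed.

Lemma bm_bump A e : 0 < e -> bm (bump A e).
Proof. by move=> e0; apply: bounded_lipschitz_bm; exact: bump_bounded_lipschitz. Qed.

Lemma Pop_bump_continuous t A e : 0 <= t -> 0 < e -> continuous (P t (bump A e)).
Proof.
move=> t0 e0; apply: feller => //.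
  by apply: bounded_lipschitz_continuous; exact: bump_bounded_lipschitz.
by exists 1 => x; exact: bump_norm.
Qed.

Lemma open_Pop_bump_lt t A e c : 0 <= t -> 0 < e -> open [set y | P t (bump A e) y < c].
Proof.
move=> t0 e0; have /continuousP := Pop_bump_continuous (A := A) t0 e0.
by move/(_ [set x | x < c]); apply; exact: open_lt.
Qed.

(** Plays the role of a point of the support: if all small balls inside [U] were null, [U] would be
    null by Lindelof's argument. The closed ball is kept inside [U] so that a limit of nested
    centres does not escape. *)
Lemma charged_sub (U : set X) s e : open U -> 0 < P s \1_U z -> 0 < e ->
  exists w r, [/\ 0 < r, r <= e, forall y, mdist w y <= r -> U y &
    0 < P s \1_[set y | mdist w y < r] z].
Proof.
move=> oU; rewrite Pop_indic_gt0; last exact: borel_open.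
move=> U0 e0; apply: contrapT => no.
have : (p s z).-negligible (U : set XB).
  apply: (locally_null polX) => y Uy.
  have /nbhs_ballP[r /= r0 rU] := open_nbhs_nbhs (conj oU Uy).
  pose q := Num.min e (r / 2).
  have q0 : 0 < q by rewrite lt_min e0 divr_gt0.
  exists q => //; apply: contrapT => n0; apply: no; exists y, q; split => //.
  - by rewrite ge_min lexx.
  - move=> v yv; apply: rU; rewrite ballEmdist/= (le_lt_trans yv)//.
    by rewrite gt_min [X in _ || X]ltr_pdivrMr// mulr_natr mulr2n ltrDl r0 orbT.
  - rewrite Pop_indic_gt0; last by apply: borel_open; exact: open_mball.
    by rewrite lt0e measure_ge0 andbT; apply/eqP.
move=> /negligibleP -/(_ (borel_open oU)) pU0.
by move: U0; rewrite pU0 ltxx.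
Qed.

(** * Separated humps charged from [z] at large times *)

Section humps.
Variables (e eta : R) (e0 : 0 < e) (eta0 : 0 < eta).
Variables (H : nat -> set X) (ts : nat -> R).
Hypothesis Hsep : forall k l x y, (k < l)%N -> H k x -> H l y -> e + e <= mdist x y.
Hypothesis tsk : forall k, k%:R <= ts k.
Hypothesis Hmass : forall k, eta <= P (ts k) (bump (H k) e) z.

Let f k := bump (H k) e.
Let N k : set X := [set x | exists2 y, H k y & mdist x y < e].
Let W m : set X := \bigcup_(l in [set l | (m <= l)%N]) N l.

Let ts0 k : 0 <= ts k. Proof. exact: le_trans (tsk k). Qed.

Let oN k : open (N k).
Proof.
rewrite (_ : N k = \bigcup_(y in H k) [set x | mdist y x < e]).
  by apply: bigcup_open => y _; exact: open_mball.
by apply/seteqP; split => x [y Hy xy]; exists y => //=; rewrite metric_sym.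
Qed.

Let mW m : measurable (W m : set XB).
Proof. by apply: borel_open; apply: bigcup_open. Qed.

Let Ndisj k l x : N k x -> N l x -> k = l.
Proof.
wlog kl : k l / (k < l)%N.
  by move=> h Nk Nl; have [/h|/h h'|//] := ltngtP k l; [exact|apply/esym/h'].
move=> [a Ha xa] [b Hb xb]; have := Hsep kl Ha Hb.
by rewrite leNgt (le_lt_trans (metric_triangle a x b))// ltrD// metric_sym.
Qed.

(** The neighbourhoods [N l] are disjoint, so a point lies in at most one of them and has left [W m]
    as soon as [m] exceeds its index. *)
Let Wcvg t x : (fun m => P t \1_(W m) x) @ \oo --> (0 : R).
Proof.
rewrite -[X in _ --> X](Pop_cst p t 0 x); apply: (Pop_dct (M := 1)).
- by move=> n; exact: bm_indic.
- by move=> n y; rewrite indicE; case: (_ \in _); rewrite ?normr1// normr0.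
move=> y; apply: cvg_near_cst; have [[l Nl]|no] := pselect (exists l, N l y); last first.
  apply: nearW => m; rewrite indicE memNset// => -[l _ Nl].
  by apply: no; exists l.
exists l.+1 => // m /= lm; rewrite indicE memNset// => -[k /= mk Nk].
by move: lm; rewrite (Ndisj Nl Nk) ltnNge mk.
Qed.

(* Gliding hump: the bumps at well chosen indices add up to one Lipschitz
   function that separates [u] from [z] at arbitrarily large times. *)
Lemma no_gliding_hump (u : X) (k : nat -> nat) : (forall n, k n < k n.+1)%N ->
  (forall n, P (ts (k n)) (f (k n)) u <= eta / 2) -> False.
Proof.
move=> kS ku.
have kmono : {homo k : i j / (i < j)%N} by apply: homo_ltn => //; exact: ltn_trans.
have kge n : (n <= k n)%N.
  by elim: n => // n ih; exact: leq_ltn_trans ih (kS n).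
pose H' j := H (k j).
(* A state is the union of the humps chosen so far with the index of the next hump. The following
   index is taken so late that the later humps are hardly charged from [u] at the current time, and
   that the finite sum, current hump included, hardly distinguishes [u] from [z] afterwards. *)
have step (s : set X * nat) : exists s' : set X * nat,
  [/\ s'.1 = s.1 `|` H' s.2, (s.2 < s'.2)%N,
   P (ts (k s.2)) \1_(W (k s'.2)) u <= eta / 8 &
   forall t, s'.2%:R <= t -> `|P t (bump s'.1 e) u - P t (bump s'.1 e) z| <= eta / 8].
  have eta8 : 0 < eta / 8 by rewrite divr_gt0.
  have [T TP] := asymL (bump_bounded_lipschitz e0 (s.1 `|` H' s.2)) u z eta8.
  have /cvgrPdist_le /(_ _ eta8)[m _ mP] := Wcvg (ts (k s.2)) u.
  have [T' TT'] : exists T' : nat, T <= T'%:R.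
    exists (Num.truncn `|T|).+1; rewrite (le_trans (ler_norm _))// ltW//.
    exact: Num.Theory.truncnS_gt.
  exists (s.1 `|` H' s.2, (maxn s.2.+1 (maxn m T'))); split => //=.
  - by rewrite leq_max leqnn.
  - have := mP (k (maxn s.2.+1 (maxn m T'))); rewrite /= sub0r normrN ger0_norm//.
      by apply; rewrite (leq_trans _ (kge _))// !leq_max leqnn orbT.
    by apply: Pop_ge0 => y; rewrite indicE.
  - move=> t tT; apply: TP; rewrite (le_trans TT')// (le_trans _ tT)// ler_nat.
    by rewrite !leq_max leqnn !orbT.
have /choice[nx nxP] := step.
pose st i := iter i nx (set0, 0%N).
pose A i := (st i).1; pose j i := (st i).2.
have AS i : A i.+1 = A i `|` H' (j i) by have [] := nxP (st i).
have jS i : (j i < j i.+1)%N by have [] := nxP (st i).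
have jmono : {homo j : i i' / (i < i')%N} by apply: homo_ltn => //; exact: ltn_trans.
have jge i : (i <= j i)%N by elim: i => // i ih; exact: leq_ltn_trans ih (jS i).
pose Ai := \bigcup_i H' (j i).
have AE i x : A i x -> exists2 l, (l < i)%N & H' (j l) x.
  elim: i => [[]|i ih]; rewrite AS => -[/ih[l li Hl]|Hi]; first by exists l => //; exact: ltnW.
  by exists i.
have AH i l : (l < i)%N -> H' (j l) `<=` A i.
  elim: i => // i ih; rewrite ltnS leq_eqVlt AS => /predU1P[->|li]; first exact: subsetUr.
  by apply: subset_trans (ih li) _; exact: subsetUl.
(* At the time [t] of hump [i], the point [z] gains [eta] from it while [u] gains at most [eta / 2];
   the earlier and the later humps cost [eta / 8] each. The remaining gap [eta / 4] exceeds
   [eta / 9]. *)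
have eta8 : 0 < eta / 9 by rewrite divr_gt0.
have [T TP] := asymL (bump_bounded_lipschitz e0 Ai) u z eta8.
pose i := (Num.truncn `|T|).+1; pose t := ts (k (j i)).
have it : i%:R <= t.
  by rewrite (le_trans _ (tsk _))// ler_nat (leq_trans (jge i))// kge.
have Tt : T <= t.
  rewrite (le_trans _ it)// (le_trans (ler_norm _))// ltW//; exact: Num.Theory.truncnS_gt.
have hT := TP t Tt.
have hA : `|P t (bump (A i) e) u - P t (bump (A i) e) z| <= eta / 8.
  have [_ _ _] := nxP (st i.-1); apply.
  by rewrite (le_trans _ (tsk _))// ler_nat kge.
have hW : P t \1_(W (k (j i.+1))) u <= eta / 8 by have [] := nxP (st i).
have hz : P t (bump (A i) e) z + P t (f (k (j i))) z <= P t (bump Ai e) z.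
  rewrite -Pop_add; [|exact: bm_bump..].
  apply: Pop_le; [by apply: bmD; exact: bm_bump|exact: bm_bump|] => y.
  apply: (le_trans (bump_addS e0 _ _)).
    move=> a b /AE[l li Ha] Hb; apply: (@Hsep (k (j l)) (k (j i))) => //.
    exact/kmono/jmono.
  apply: bumpS => //; rewrite -AS => x /AE[l _ Hl]; by exists l.
have hu : P t (bump Ai e) u <= P t (bump (A i) e) u + P t (f (k (j i))) u +
    P t \1_(W (k (j i.+1))) u.
  rewrite -Pop_add; [|exact: bm_bump..].
  rewrite -Pop_add; [|by apply: bmD; exact: bm_bump|exact: bm_indic].
  apply: Pop_le; [exact: bm_bump| |].
    by apply: bmD; [by apply: bmD; exact: bm_bump|exact: bm_indic].
  move=> y; have b0 := bump_ge0 e0 (A i) y; have f0 := bump_ge0 e0 (H (k (j i))) y.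
  have w0 : 0 <= (\1_(W (k (j i.+1))) y : R) by rewrite indicE.
  apply: bump_leP => //; first by rewrite !addr_ge0.
  (* A later hump within [e] of [y] puts [y] into the tail [W], whose indicator absorbs the bump;
     one at distance at least [e] contributes nothing positive. *)
  move=> v [l _ Hv]; have [li|il|li] := ltngtP l i.
  - have Av : A i v by exact: AH Hv.
    by have := bump_ge e0 y Av; rewrite /f; lra.
  - have [yv|yv] := ltP (mdist y v) e.
      have Wy : W (k (j i.+1)) y.
        exists (k (j l)); last by exists v.
        rewrite /= leq_eqVlt; move: il; rewrite leq_eqVlt => /predU1P[->|il].
          by rewrite eqxx.
        by rewrite (kmono _ _ (jmono _ _ il)) orbT.
      rewrite indicE mem_set//=.
      have : 0 <= mdist y v / e by rewrite divr_ge0 ?mdist_ge0// ltW.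
      by rewrite /f; lra.
    have : 1 <= mdist y v / e by rewrite ler_pdivlMr// mul1r.
    by rewrite /f; lra.
  - have Hv' : H (k (j i)) v by rewrite -li.
    by have := bump_ge e0 y Hv'; rewrite /f; lra.
have hk := ku (j i); have hm := Hmass (k (j i)).
move: hT hA; rewrite !ler_distl => /andP[a1 a2] /andP[a3 a4].
rewrite -/(f _) -/t in hm hk; lra.
Qed.

(* By the Feller property and the lower bound, a ball charged once keeps a
   positive mass forever; if [P (ts k) (f k) >= eta / 2] held almost surely on it
   for all large [k], that mass would be sent to arbitrarily many disjoint sets. *)
Lemma charged_ball_escapes (w : X) (r s0 : R) m : 0 < r -> 0 <= s0 ->
  0 < P s0 \1_[set y | mdist w y < r] z ->
  exists2 k, (m <= k)%N & exists2 s, 0 <= s &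
   0 < P s \1_([set y | mdist w y < r] `&` [set y | P (ts k) (f k) y < eta / 2]) z.
Proof.
move=> r0 s00 ch; apply: contrapT => no.
set B := [set y | mdist w y < r] in ch no.
have oB : open B by exact: open_mball.
pose G k : set X := [set y | P (ts k) (f k) y < eta / 2].
have oG k : open (G k).
  exact: open_Pop_bump_lt.
have mB : measurable (B : set XB) by exact: borel_open.
have null k s : (m <= k)%N -> 0 <= s -> P s \1_(B `&` G k) z = 0.
  move=> mk s0'; apply/eqP; rewrite eq_le; apply/andP; split; last first.
    by apply: Pop_ge0 => y; rewrite indicE.
  by rewrite leNgt; apply/negP => lt; apply: no; exists k => //; exists s.
(* The Feller property acts on continuous functions, so the indicator of [B] is first replaced by a
   Lipschitz minorant that [P s0] still charges from [z]. *)
have [h [hL h0 hB [c c0 ch']]] : exists h : X -> R, [/\ bounded_lipschitz h, 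
    forall y, 0 <= h y, forall y, h y <= \1_B y & exists2 c, 0 < c & c < P s0 h z].
  pose hn n y : R := 1 - bump (~` B) n.+1%:R^-1 y.
  have ni n : 0 < n.+1%:R^-1 :> R by rewrite invr_gt0.
  have hnL n : bounded_lipschitz (hn n).
    apply: bounded_lipschitzD; first exact: bounded_lipschitz_cst.
    rewrite (_ : (fun _ => _) = fun y => -1 * bump (~` B) n.+1%:R^-1 y).
      by apply: bounded_lipschitzZ; exact: bump_bounded_lipschitz.
    by apply/funext => y; rewrite mulN1r.
  have hn0 n y : 0 <= hn n y by rewrite subr_ge0 bump_le1.
  have hn1 n y : hn n y <= \1_B y.
    rewrite indicE /hn; case: (boolP (y \in B)) => yB /=.
      by rewrite gerBl bump_ge0.
    by rewrite bump1 ?subrr// => yB'; move: yB; rewrite mem_set.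
  have hs : (fun n => P s0 (hn n) z) @ \oo --> P s0 \1_B z.
    apply: (Pop_dct (M := 1)).
    - by move=> n; exact: bounded_lipschitz_bm.
    - by move=> n y; rewrite ger0_norm// gerBl bump_ge0.
    move=> y; rewrite (_ : \1_B y = 1 - \1_(~` B) y).
      by apply: cvgB; [exact: cvg_cst|apply: bump_cvg_indic; exact: open_closedC].
    by rewrite !indicE in_setC; case: (y \in B); rewrite ?subrr ?subr0.
  have /cvgrPdist_lt/(_ _ ch)[n _ /(_ n (leqnn n)) /=] := hs.
  rewrite ltr_distl => /andP[_ lt]; exists (hn n); split => //.
  exists (P s0 (hn n) z / 2); first by rewrite divr_gt0// -(ltrD2r (P s0 \1_B z)) add0r.
  have : 0 < P s0 (hn n) z by rewrite -(ltrD2r (P s0 \1_B z)) add0r.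
  by move=> ?; rewrite ltr_pdivrMr// mulr_natr mulr2n ltrDl.
have bh : bm h by exact: bounded_lipschitz_bm.
have [d d0 dz] : exists2 d, 0 < d & forall u, mdist z u < d -> c < P s0 h u.
  have ctP : continuous (P s0 h).
    by apply: feller => //; [exact: bounded_lipschitz_continuous|case: hL].
  have : \forall u \near z, c < P s0 h u by apply: (cvgr_gt _ (ctP z)).
  move=> /nbhs_ballP[d /= d0 dP]; exists d => // u zu; apply: dP.
  by rewrite ballEmdist.
(* At every late time mass [a] sits near [z], and a further delay [s0] sends more than the fraction
   [c] of it into [B]. *)
have [a a0 /(_ z)[T TP]] := lbz d0.
pose S := Num.max T 0.
set D : set X := [set y | mdist z y < d] in TP.
have mD : measurable (D : set XB) by apply: borel_open; exact: open_mball.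
have bPh : bm (P s0 h) := bm_Pop mp s0 bh.
have bB : bm \1_B by exact: bm_indic.
have low s : S <= s -> c * a <= P (s + s0) \1_B z.
  rewrite ge_max => /andP[Ts s0'].
  apply: (@le_trans _ _ (P (s + s0) h z)); last exact: Pop_le.
  rewrite PopDb//; apply: (@le_trans _ _ (c * P s \1_D z)).
    by rewrite ler_wpM2l// ?TP// ltW.
  rewrite -Pop_scale; last exact: bm_indic.
  apply: Pop_le => //; first by apply: bmM; [exact: bm_cst|exact: bm_indic].
  move=> y; rewrite indicE; case: (boolP (y \in D)); rewrite ?inE => yD.
    by rewrite mulr1 ltW// dz.
  by rewrite mulr0; apply: Pop_ge0.
pose g := eta / 2 * (c * a); have g0 : 0 < g by rewrite !mulr_gt0.
have bf k : bm (f k) by exact: bm_bump.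
(* Since [B] meets [G k] in a null set at every time, the mass in [B] sits where [P (ts k) (f k)] is
   at least [eta / 2]. *)
have gP k t : (m <= k)%N -> S + s0 + ts k <= t -> g <= P t (f k) z.
  move=> mk tk; pose s := t - ts k - s0.
  have Ss : S <= s by rewrite /s lerBrDr lerBrDr.
  have s0' : 0 <= s by rewrite (le_trans _ Ss)// le_max lexx orbT.
  have -> : t = (s + s0) + ts k by rewrite /s subrK subrK.
  have ss0 : 0 <= s + s0 by rewrite addr_ge0.
  rewrite PopDb//.
  have mBG : measurable (B `&` G k : set XB) by apply: borel_open; exact: openI.
  apply: (@le_trans _ _ (eta / 2 * (P (s + s0) \1_B z - P (s + s0) \1_(B `&` G k) z))).
    rewrite null// subr0 ler_wpM2l ?low//; exact/ltW/divr_gt0.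
  rewrite -Pop_sub//; last exact: bm_indic.
  rewrite -Pop_scale; last by apply: bmB => //; exact: bm_indic.
  apply: Pop_le; [|exact: bm_Pop|].
    by apply: bmM; [exact: bm_cst|apply: bmB => //; exact: bm_indic].
  move=> y; have f0 : 0 <= P (ts k) (f k) y by apply: Pop_ge0 => v; exact: bump_ge0.
  have eta2 : 0 < eta / 2 by rewrite divr_gt0.
  rewrite !indicE in_setI; case: (boolP (y \in B)) => yB /=; last by rewrite subrr mulr0.
  case: (boolP (y \in G k)) => yG /=; first by rewrite subrr mulr0.
  rewrite subr0 mulr1 leNgt; apply/negP => lt; move/negP: yG; apply.
  by rewrite inE.
(* This makes [n * g > 1]: [n] disjoint humps carrying mass [g] each at a common time exceed total
   mass one. *)
pose n := (Num.truncn g^-1).+1.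
have [t tP] : exists t : R, forall i, (i < n)%N -> S + s0 + ts (m + i)%N <= t.
  elim: n => [|n' [t tP]]; first by exists 0.
  exists (Num.max t (S + s0 + ts (m + n')%N)) => i; rewrite ltnS leq_eqVlt.
  by move=> /predU1P[->|/tP h']; rewrite le_max ?lexx ?orbT// h'.
pose A i := \bigcup_(l in [set l | (l < i)%N]) H (m + l)%N.
have sum i : (i <= n)%N -> i%:R * g <= P t (bump (A i) e) z.
  elim: i => [_|i ih lin].
    by rewrite mul0r; apply: Pop_ge0 => y; exact: bump_ge0.
  rewrite -natr1 mulrDl mul1r.
  apply: (@le_trans _ _ (P t (bump (A i) e) z + P t (f (m + i)%N) z)).
    by rewrite lerD// ?ih// 1?ltnW// gP ?leq_addr// tP.
  rewrite -Pop_add//; last exact: bm_bump.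
  apply: Pop_le; [by apply: bmD => //; exact: bm_bump|exact: bm_bump|] => y.
  apply: (le_trans (bump_addS e0 _ _)).
    move=> a' b' [l /= li Ha] Hb; apply: Hsep Ha Hb; by rewrite ltn_add2l.
  apply: bumpS => // v [[l /= li Hl]|Hv]; first by exists l => //=; exact: ltnW.
  by exists i => /=.
have := sum n (leqnn n); apply/negP; rewrite -ltNge.
apply: (@le_lt_trans _ _ 1).
  rewrite -(Pop_cst p t 1 z); apply: Pop_le; [exact: bm_bump|exact: bm_cst|] => y.
  exact: bump_le1.
by rewrite -ltr_pdivrMr// div1r; exact: Num.Theory.truncnS_gt.
Qed.

(** Baire's argument on charged balls: [charged_ball_escapes] finds a later index and a charged open
    part of the current ball where that hump is small, and [charged_sub] puts a smaller closed ball
    inside it. Completeness gives a common point, which [no_gliding_hump] excludes. *)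
Lemma no_humps : False.
Proof.
have nest (s : X * R * nat) : (0 < s.1.2 /\ exists2 s0, 0 <= s0 &
    0 < P s0 \1_[set y | mdist s.1.1 y < s.1.2] z) ->
  exists s' : X * R * nat, [/\ 0 < s'.1.2 /\ exists2 s0, 0 <= s0 &
    0 < P s0 \1_[set y | mdist s'.1.1 y < s'.1.2] z,
    s'.1.2 <= s.1.2 / 2, (s.2 < s'.2)%N,
    forall y, mdist s'.1.1 y <= s'.1.2 -> mdist s.1.1 y < s.1.2 &
    forall y, mdist s'.1.1 y <= s'.1.2 -> P (ts s'.2) (f s'.2) y < eta / 2].
  move=> [r0 [s0 s00 ch]].
  have [k mk [s1 s10 ch1]] := charged_ball_escapes s.2.+1 r0 s00 ch.
  have oG : open [set y | P (ts k) (f k) y < eta / 2].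
    exact: open_Pop_bump_lt.
  have [||w [r [r0' rr ball ch2]]] := @charged_sub _ s1 (s.1.2 / 2) _ ch1.
  - by apply: openI => //; exact: open_mball.
  - by rewrite divr_gt0.
  exists (w, r, k); split => //=.
  - by split => //; exists s1.
  - by move=> y /ball[].
  - by move=> y /ball[].
have /choice[nx nxP] : forall s : X * R * nat, exists s' : X * R * nat,
   (0 < s.1.2 /\ exists2 s0, 0 <= s0 &
    0 < P s0 \1_[set y | mdist s.1.1 y < s.1.2] z) ->
   [/\ 0 < s'.1.2 /\ exists2 s0, 0 <= s0 &
    0 < P s0 \1_[set y | mdist s'.1.1 y < s'.1.2] z,
    s'.1.2 <= s.1.2 / 2, (s.2 < s'.2)%N,
    forall y, mdist s'.1.1 y <= s'.1.2 -> mdist s.1.1 y < s.1.2 &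
    forall y, mdist s'.1.1 y <= s'.1.2 -> P (ts s'.2) (f s'.2) y < eta / 2].
  move=> s; have [/nest[s' h]|no] := pselect (0 < s.1.2 /\ exists2 s0, 0 <= s0 &
    0 < P s0 \1_[set y | mdist s.1.1 y < s.1.2] z); first by exists s'.
  by exists s.
(* The unit ball at [z] is charged by the lower bound itself, so it can start the nesting. *)
pose st i := iter i nx (z, 1, 0%N).
have good i : 0 < (st i).1.2 /\ exists2 s0, 0 <= s0 &
    0 < P s0 \1_[set y | mdist (st i).1.1 y < (st i).1.2] z.
  elim: i => [|i /nxP[]//]; split => //=.
  have [a a0 /(_ z)[T TP]] := lbz ltr01.
  exists (Num.max T 0); first by rewrite le_max lexx orbT.
  by apply: lt_le_trans a0 _; apply: TP; rewrite le_max lexx.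
pose w i := (st i).1.1; pose r i := (st i).1.2; pose k i := (st i).2.
have rS i : r i.+1 <= r i / 2 by have [] := nxP _ (good i).
have kS i : (k i < k i.+1)%N by have [] := nxP _ (good i).
have bS i y : mdist (w i.+1) y <= r i.+1 -> mdist (w i) y < r i.
  by have [_ _ _ + _] := nxP _ (good i); exact.
have fS i y : mdist (w i.+1) y <= r i.+1 -> P (ts (k i.+1)) (f (k i.+1)) y < eta / 2.
  by have [_ _ _ _] := nxP _ (good i); exact.
have r0 i : 0 < r i by have [] := good i.
have bD i j y : mdist (w (i + j)%N) y <= r (i + j)%N -> mdist (w i) y <= r i.
  elim: j => [|j ih]; first by rewrite addn0.
  by rewrite addnS => /bS/ltW; exact: ih.
have rge i : r i <= i.+1%:R^-1.
  elim: i => [|i ih]; first by rewrite invr1.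
  apply: (le_trans (rS i)); apply: (@le_trans _ _ (i.+1%:R^-1 / 2)).
    by rewrite ler_pM2r.
  rewrite -invfM lef_pV2 ?posrE// -natrM ler_nat.
  by rewrite muln2 -addnn addSn ltnS leq_addl.
have [|u uP] := polish_complete polX (F := w @ \oo).
  move=> q q0; have := near_infty_natSinv_lt (PosNum q0); case=> n _ /(_ n (leqnn n)) /= nq.
  exists (w n); exists n => // i /= ni.
  rewrite (le_lt_trans _ nq)// (le_trans _ (rge n))//.
  by apply: (bD n (i - n)%N); rewrite subnKC// mdistxx ltW.
have uw i : mdist (w i) u <= r i.
  apply/ler_addgt0Pr => q q0.
  have : (w @ \oo) [set y | mdist u y < q].
    by apply: uP; apply/nbhs_ballP; exists q => // y; rewrite ballEmdist.
  case=> n _ /(_ (i + n)%N (leq_addl _ _)) /= un.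
  rewrite (le_trans (metric_triangle _ (w (i + n)%N) _))// lerD//.
    by apply: (bD i n); rewrite mdistxx ltW.
  by rewrite metric_sym ltW.
apply: (@no_gliding_hump u (fun i => k i.+1)) => i; first exact: kS.
by apply/ltW/fS; exact: uw.
Qed.

End humps.
End tightness.

(** This is how total boundedness yields Cauchy ultrafilters. *)
Lemma ultra_finite_union (T : Type) (V : set_system T) n (A : nat -> set T) :
  UltraFilter V -> V [set x | exists2 j, (j < n)%N & A j x] -> exists j, V (A j).
Proof.
move=> UV; elim: n => [|n ih] VA.
  have : V set0 by apply: filterS VA => x [].
  by move=> /filter_not_empty.
have [VAn|VnAn] := in_ultra_setVsetC (A n) UV; first by exists n.
apply: ih; apply: filterS2 VA VnAn => x [j jn Aj] nAn; exists j => //.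
by move: jn; rewrite ltnS leq_eqVlt => /predU1P[jn|//]; case: nAn; rewrite -jn.
Qed.

(** * From the absence of humps to smoothness along open covers *)

Section tightness.
Context (R : realType) (X : metricType R) (x0 : X).
Local Notation XB := (borel_of x0).
Variable p : R -> XB -> probability XB R.
Local Notation P := (Pop p).
Local Notation bm := (@bounded_measurable _ XB R).
Hypothesis polX : polish X.
Hypothesis mp : forall t A, measurable A -> measurable_fun [set: XB] (fun x => p t x A).
Hypothesis CK : forall s t x A, 0 <= s -> 0 <= t -> measurable A ->
  p (s + t) x A = (\int[p s x]_u p t u A)%E.
Hypothesis feller : forall t, 0 <= t -> forall g : X -> R, continuous g ->
  (exists M : R, forall x, `|g x| <= M) -> continuous (P t g).
Variable z : X.
Hypothesis lbz : lower_bd p z.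
Hypothesis asymL : forall f : X -> R, bounded_lipschitz f -> forall x y e, 0 < e ->
  exists T : R, forall t, T <= t -> `|P t f x - P t f y| <= e.

Definition ball_union (d : nat -> X) n (e : R) : set X :=
  [set x | exists2 j, (j < n)%N & mdist (d j) x < e].

Lemma open_ball_union d n e : open (ball_union d n e).
Proof.
rewrite (_ : ball_union d n e = \bigcup_(j in [set j | (j < n)%N]) [set x | mdist (d j) x < e]).
  by apply: bigcup_open => j _; exact: open_mball.
by apply/seteqP; split => x [j jn dj]; exists j.
Qed.

(** If tightness fails, some late time leaves mass more than [eta] outside the first [ns k] balls of
    radius [e], and finitely many balls of radius [e / 3] recover all but [eta / 2]. The difference
    [H k] has mass at least [eta / 2]. A point of [H k] is within [e / 3] of a centre from which
    later [H l] keep distance [e], hence the separation [2 e / 3] required of humps. *)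
Lemma asym_tight (d : nat -> X) (e eta : R) :
  (forall x (e : R), 0 < e -> exists n, mdist (d n) x < e) -> 0 < e -> 0 < eta ->
  exists n T, forall t : R, T <= t -> 1 - eta <= P t \1_(ball_union d n e) z.
Proof.
move=> dense_d e0 eta0; apply: contrapT => no.
pose de := e / 3; have de0 : 0 < de by rewrite divr_gt0.
have mU n r : measurable (ball_union d n r : set XB) by apply: borel_open; exact: open_ball_union.
have /choice[st stP] (nk : nat * nat) : exists tn : R * nat, [/\ nk.2%:R <= tn.1, (nk.1 < tn.2)%N,
    P tn.1 \1_(ball_union d nk.1 e) z < 1 - eta &
    1 - eta / 2 <= P tn.1 \1_(ball_union d tn.2 de) z].
  case: nk => n k /=.
  have [t kt small] : exists2 t : R, k%:R <= t & P t \1_(ball_union d n e) z < 1 - eta.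
    apply: contrapT => no2; apply: no; exists n, k%:R => t kt.
    by rewrite leNgt; apply/negP => lt; apply: no2; exists t.
  have : (fun m => P t \1_(ball_union d m de) z) @ \oo --> (1 : R).
    rewrite -[X in _ --> X](Pop_cst p t 1 z); apply: (Pop_dct (M := 1)).
    - by move=> m; exact: bm_indic.
    - by move=> m y; rewrite indicE; case: (_ \in _); rewrite ?normr1// normr0.
    move=> y; apply: cvg_near_cst; have [j dj] := dense_d y de de0.
    by exists j.+1 => // m /= jm; rewrite indicE mem_set//; exists j.
  have eta2 : 0 < eta / 2 by rewrite divr_gt0.
  move=> /cvgrPdist_le/(_ _ eta2)[m _ mP].
  exists (t, maxn n.+1 m); split => //=; first by rewrite leq_max leqnn.
  have := mP (maxn n.+1 m) (leq_maxr _ _).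
  by rewrite /= ler_distlC => /andP[].
(* Each stage avoids all the balls used by the previous ones and takes place at a time at least
   [k]. *)
pose ns := fix ns k := if k is k'.+1 then (st (ns k', k')).2 else 0%N.
pose ts k := (st (ns k, k)).1.
pose H k : set X := ball_union d (ns k.+1) de `\` ball_union d (ns k) e.
have nsS k : (ns k < ns k.+1)%N by have [] := stP (ns k, k).
have nsm : {homo ns : i j / (i <= j)%N}.
  by apply: homo_leq => //; [exact: leq_trans|move=> i; exact: ltnW].
have mH k : measurable (H k : set XB) by apply: measurableD.
have e3 : e = de + de + de by rewrite /de; lra.
apply: (@no_humps R X x0 p polX mp CK feller z lbz asymL de (eta / 2) de0 _ H ts).
- by rewrite divr_gt0.
- move=> k l x y kl [[j jk dx] _] [_ nV].
  have jl : (j < ns l)%N by rewrite (leq_trans jk)// nsm.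
  rewrite leNgt; apply/negP => xy; apply: nV; exists j => //.
  rewrite (le_lt_trans (metric_triangle (d j) x y))// e3 -addrA.
  by rewrite ltrD.
- by move=> k; have [] := stP (ns k, k).
- move=> k; have [_ _ h1 h2] := stP (ns k, k).
  have h3 : P (ts k) \1_(ball_union d (ns k.+1) de) z - P (ts k) \1_(ball_union d (ns k) e) z
      <= P (ts k) \1_(H k) z.
    rewrite -Pop_sub; [|exact: bm_indic..].
    apply: Pop_le; [apply: bmB; exact: bm_indic|exact: bm_indic|].
    move=> y; rewrite !indicE in_setD.
    by case: (y \in ball_union d (ns k) e); case: (y \in ball_union _ _ _); rewrite /=; lra.
  have h4 : P (ts k) \1_(H k) z <= P (ts k) (bump (H k) de) z.
    apply: Pop_le; [exact: bm_indic|exact: bm_bump|].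
    move=> y; rewrite indicE; case: (boolP (y \in H k)); rewrite ?inE => Hy.
      by rewrite bump1.
    exact: bump_ge0.
  move: h1 h2 h3 h4; rewrite -/(ns k.+1) -/(ts k) /=; lra.
Qed.

(** Each [K k] has mass near [1 - e] only after a time depending on [k], so the full intersection is
    out of reach. It suffices that some [K k] lies inside some [O n]: otherwise points of [K k]
    outside [O k] would accumulate, by total boundedness and completeness, at a point that no [O n]
    contains. *)
Lemma asym_sigma_smooth (O : nat -> set X) (e : R) :
  (forall n, open (O n)) -> (forall m n, (m <= n)%N -> O m `<=` O n) ->
  \bigcup_n O n = setT -> 0 < e ->
  exists n T, forall t : R, T <= t -> 1 - e <= P t \1_(O n) z.
Proof.
move=> oO ndO OT e0; have [d dP] := polish_dense_seq polX z.
have ei (i : nat) : 0 < e / 2 ^+ i.+1 by rewrite divr_gt0// exprn_gt0.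
have ii (i : nat) : 0 < i.+1%:R^-1 :> R by rewrite invr_gt0.
have /choice[ni niP] : forall i, exists n, exists T : R, forall t, T <= t ->
    1 - e / 2 ^+ i.+1 <= P t \1_(ball_union d n i.+1%:R^-1) z.
  by move=> i; exact: asym_tight.
pose K k : set X := [set x | forall i, (i < k)%N -> ball_union d (ni i) i.+1%:R^-1 x].
have KS k : K k.+1 = K k `&` ball_union d (ni k) k.+1%:R^-1.
  apply/seteqP; split => [x Kx|x [Kx Kk] i].
    by split; [move=> i ik; apply: Kx; exact: ltnW|exact: Kx].
  by rewrite ltnS leq_eqVlt => /predU1P[->//|]; exact: Kx.
have oK k : open (K k).
  elim: k => [|k ih]; first by rewrite (_ : K 0%N = setT)//; [exact: openT|apply/seteqP].
  by rewrite KS; apply: openI => //; exact: open_ball_union.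
have mK k : measurable (K k : set XB) by exact: borel_open.
(* The losses [e / 2 ^+ i.+1] for [i < k] add up to [e - e / 2 ^+ k]. *)
have PK k : exists T : R, forall t, T <= t -> 1 - e + e / 2 ^+ k <= P t \1_(K k) z.
  elim: k => [|k [T TP]].
    exists 0 => t _; rewrite (_ : K 0%N = setT); last by apply/seteqP.
    rewrite indicT Pop_cst expr0; lra.
  have [T' TP'] := niP k.
  exists (Num.max T T') => t; rewrite ge_max => /andP[/TP h1 /TP' h2].
  set B := ball_union _ _ _ in h2 KS *.
  have mB : measurable (B : set XB) by apply: borel_open; exact: open_ball_union.
  have h3 : P t \1_(K k) z + P t \1_B z - P t (fun=> 1) z <= P t \1_(K k.+1) z.
    rewrite -Pop_add; [|exact: bm_indic..].
    rewrite -Pop_sub; [|by apply: bmD; exact: bm_indic|exact: bm_cst].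
    apply: Pop_le; [|exact: bm_indic|].
      by apply: bmB; [apply: bmD; exact: bm_indic|exact: bm_cst].
    move=> y; rewrite KS !indicE in_setI.
    by case: (y \in K k); case: (y \in B); rewrite /=; lra.
  move: h1 h2 h3; rewrite Pop_cst exprS invfM.
  by move: (2 ^+ k)^-1 => q; lra.
suff [k [n Kn]] : exists k n, K k `<=` O n.
  have [T TP] := PK k; exists n, T => t /TP h.
  apply: (@le_trans _ _ (P t \1_(K k) z)).
    rewrite (le_trans _ h)// lerDl; apply: divr_ge0; [exact: ltW|exact: exprn_ge0].
  apply: Pop_le; [exact: bm_indic|apply: bm_indic; exact: borel_open|].
  move=> y; rewrite !indicE; case: (boolP (y \in K k)); rewrite ?inE => Ky.
    by rewrite mem_set//; exact: Kn.
  by case: (_ \in _).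
apply: contrapT => no.
have /choice[x xP] : forall k, exists x, K k x /\ ~ O k x.
  move=> k; apply: contrapT => no2; apply: no; exists k, k => x Kx.
  by apply: contrapT => nO; apply: no2; exists x.
(* Along [V] the points eventually lie in each finite union of balls of radius [i.+1%:R^-1], hence
   in one of these balls; the image ultrafilter is therefore Cauchy. *)
have [V [UV Voo]] := ultraFilterLemma (eventually_filter : ProperFilter \oo).
have PV : ProperFilter V by exact: ultra_proper.
have Vge n : V [set k | (n <= k)%N] by apply: Voo; exists n.
have [|l lP] := polish_complete polX (F := x @ V).
  move=> r r0; have := near_infty_natSinv_lt (PosNum r0).
  case=> i _ /(_ i (leqnn i)) /= ir.
  have [j Vj] : exists j, V [set k | mdist (d j) (x k) < i.+1%:R^-1].
    apply: (@ultra_finite_union _ V (ni i) (fun j k => mdist (d j) (x k) < i.+1%:R^-1)).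
    by apply: filterS (Vge i.+1) => k ik; have [Kk _] := xP k; exact: Kk.
  exists (d j); rewrite /fmap/=; apply: filterS Vj => k /lt_trans; exact.
have [n _ On] : (\bigcup_n O n) l by rewrite OT.
have : (x @ V) (O n) by apply: lP; apply: open_nbhs_nbhs.
rewrite /fmap/= => VO; have [k [/= nk Ok]] := filter_ex (filterI (Vge n) VO).
by have [_] := xP k; apply; apply: ndO Ok.
Qed.

End tightness.

(** * The countably additive part of a finitely additive set function *)

Section regular_part.
Context (R : realType) (X : metricType R) (x0 : X).
Local Notation XB := (borel_of x0).
Variable L : set X -> R.
Local Notation mbl := (@measurable _ XB).
Hypothesis L_ge0 : forall A, mbl A -> 0 <= L A.
Hypothesis L_superadd : forall A B C, mbl A -> mbl B -> mbl C ->
  A `&` B = set0 -> A `|` B `<=` C -> L A + L B <= L C.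
Hypothesis L_subadd : forall A B C, mbl A -> mbl B -> mbl C ->
  A `<=` B `|` C -> L A <= L B + L C.
Hypothesis L_setT : L setT = 1.
Hypothesis L_smooth : forall O : nat -> set X, (forall n, open (O n)) ->
  (forall m n, (m <= n)%N -> O m `<=` O n) -> \bigcup_n O n = setT ->
  forall e, 0 < e -> exists n, 1 - e <= L (O n).

Let L0 : L set0 = 0.
Proof.
have := @L_superadd set0 set0 set0 measurable0 measurable0 measurable0.
rewrite setI0 setU0 => /(_ erefl (fun _ => id)); rewrite gerDl => L0.
by apply/eqP; rewrite eq_le L0 L_ge0.
Qed.

Let L_mono A B : mbl A -> mbl B -> A `<=` B -> L A <= L B.
Proof.
move=> mA mB AB; rewrite -[leRHS]addr0 -L0; apply: L_subadd => //.
by rewrite setU0.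
Qed.

(* Caratheodory's construction of the countably additive part of [L]: on open
   sets take the supremum of [L] over the shrunken sets, then extend by outer
   regularity. *)
Definition shrink n (G : set X) : set X :=
  [set x | exists2 r, n.+1%:R^-1 < r & forall y, mdist x y < r -> G y].
(** The closed companion of [shrink]: distance at least, instead of greater than, [n.+1%:R^-1] from
    the complement. Its complement is open and disjoint from [shrink n G], so it can enter open
    covers and open splittings. *)
Definition cshrink n (G : set X) : set X :=
  [set x | forall y, mdist x y < n.+1%:R^-1 -> G y].

Let ii (n : nat) : 0 < n.+1%:R^-1 :> R. Proof. by rewrite invr_gt0. Qed.

Lemma open_shrink n G : open (shrink n G).
Proof.
rewrite openE => x [r nr rG]; apply/nbhs_ballP; exists ((r - n.+1%:R^-1) / 2).
  by rewrite /= divr_gt0// subr_gt0.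
move=> y; rewrite ballEmdist/= => xy; exists ((r + n.+1%:R^-1) / 2).
  by move: nr; set i := n.+1%:R^-1; lra.
move=> v yv; apply: rG; rewrite (le_lt_trans (metric_triangle x y v))//.
by move: xy yv; set i := n.+1%:R^-1; lra.
Qed.

Lemma open_cshrinkC n G : open (~` cshrink n G).
Proof.
rewrite openE => x /existsNP[y /not_implyP[xy nGy]].
apply/nbhs_ballP; exists (n.+1%:R^-1 - mdist x y); first by rewrite /= subr_gt0.
move=> u; rewrite ballEmdist/= => xu cu; apply: nGy; apply: cu.
by rewrite (le_lt_trans (metric_triangle u x y))// (metric_sym u x) -ltrBrDr.
Qed.

Lemma shrink_cshrink n G : shrink n G `<=` cshrink n G.
Proof. by move=> x [r nr rG] y xy; apply: rG; rewrite (lt_trans xy). Qed.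

Lemma cshrink_sub n G : cshrink n G `<=` G.
Proof. by move=> x; apply; rewrite mdistxx. Qed.

Lemma shrink_sub n G : shrink n G `<=` G.
Proof. exact: subset_trans (@shrink_cshrink n G) (@cshrink_sub n G). Qed.

Lemma shrinkS m n G G' : (m <= n)%N -> G `<=` G' -> shrink m G `<=` shrink n G'.
Proof.
move=> mn GG' x [r mr rG]; exists r; last by move=> y /rG/GG'.
by rewrite (le_lt_trans _ mr)// lef_pV2 ?posrE// ler_nat ltnS.
Qed.

Lemma bigcup_shrink G : open G -> G `<=` \bigcup_n shrink n G.
Proof.
move=> oG x Gx; have /nbhs_ballP[r /= r0 rG] := open_nbhs_nbhs (conj oG Gx).
have := near_infty_natSinv_lt (PosNum r0); case=> n _ /(_ n (leqnn n)) /= nr.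
by exists n => //; exists r => // y xy; apply: rG; rewrite ballEmdist.
Qed.

Let mshrink n G : mbl (shrink n G). Proof. by apply: borel_open; exact: open_shrink. Qed.

Local Open Scope ereal_scope.

Definition inner_lim (G : set X) : \bar R := ereal_sup [set (L (shrink n G))%:E | n in setT].

Lemma inner_lim_ub n G : (L (shrink n G))%:E <= inner_lim G.
Proof. by apply: ereal_sup_ubound; exists n. Qed.

Lemma inner_lim_ge0 G : 0 <= inner_lim G.
Proof. by apply: le_trans (inner_lim_ub 0 G); rewrite lee_fin L_ge0. Qed.

Lemma inner_limS G G' : G `<=` G' -> inner_lim G <= inner_lim G'.
Proof.
move=> GG'; apply: ge_ereal_sup => _ [n _ <-]; apply: le_trans (inner_lim_ub n G').
by rewrite lee_fin L_mono//; exact: shrinkS.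
Qed.

Lemma inner_lim_le (G : set X) : open G -> inner_lim G <= (L G)%:E.
Proof.
move=> oG; apply: ge_ereal_sup => _ [n _ <-]; rewrite lee_fin L_mono//.
  exact: borel_open.
exact: shrink_sub.
Qed.

Lemma inner_lim_setT : inner_lim setT = 1.
Proof.
apply/eqP; rewrite eq_le; apply/andP; split.
  by rewrite (le_trans (inner_lim_le _)) ?L_setT//; exact: openT.
rewrite (le_trans _ (inner_lim_ub 0 _))// lee_fin -L_setT L_mono//.
by move=> x _; exists 2%R => //; rewrite invr1 ltr1n.
Qed.

Lemma L_bigcup_ord N (A : nat -> set X) B : mbl B -> (forall i, mbl (A i)) ->
  forall C, mbl C -> C `<=` B `|` \bigcup_(i in [set i | (i < N)%N]) A i ->
  (L C <= L B + \sum_(i < N) L (A i))%R.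
Proof.
move=> mB mA; elim: N => [C mC CB|N ih C mC CB]; rewrite !(big_ord0, big_ord_recr)/=.
  by rewrite addr0; apply: L_mono => // x /CB[//|[]].
have mU : mbl (B `|` \bigcup_(i in [set i | (i < N)%N]) A i).
  by apply: measurableU => //; exact: bigcup_measurable.
have h : (L C <= L (B `|` \bigcup_(i in [set i | (i < N)%N]) A i) + L (A N))%R.
  apply: L_subadd => // x /CB[Bx|[i /= iN Ai]]; first by left; left.
  move: iN; rewrite ltnS leq_eqVlt => /predU1P[iN|iN]; first by right; rewrite -iN.
  by left; right; exists i.
by rewrite addrA (le_trans h)// lerD2r ih.
Qed.

(** Smoothness replaces compactness here: up to an error [e] in mass, finitely many shrunken [G i]
    already cover the shrunken union. *)
Lemma inner_lim_bigcup (G : nat -> set X) : (forall n, open (G n)) ->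
  inner_lim (\bigcup_n G n) <= \sum_(n <oo) inner_lim (G n).
Proof.
move=> oG; apply: ge_ereal_sup => _ [n _ <-]; apply/lee_addgt0Pr => e e0.
set U := \bigcup_n G n.
(* An increasing open cover of the whole space; [N] serves both as the number of sets and as the
   shrinking level. Within [shrink n U] the first term is absent. *)
pose O N : set X := ~` cshrink n U `|` \bigcup_(i in [set i | (i < N)%N]) shrink N (G i).
have [||||N NP] := @L_smooth O _ _ _ e.
- move=> N; apply: openU; first exact: open_cshrinkC.
  by apply: bigcup_open => i _; exact: open_shrink.
- move=> a b ab x [cx|[i /= ia sx]]; [by left|right; exists i => /=].
    exact: leq_trans ab.
  by apply: shrinkS sx.
- apply/seteqP; split => // x _; have [cx|ncx] := pselect (cshrink n U x); last first.
    by exists 0%N => //; left.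
  have [i _ Gi] := cshrink_sub cx; have [k _ sk] := bigcup_shrink (oG i) Gi.
  exists (maxn i.+1 k) => //; right; exists i => /=; first by rewrite leq_max leqnn.
  by apply: shrinkS sk => //; exact: leq_maxr.
- done.
have mO : mbl (O N).
  apply: borel_open; apply: openU; first exact: open_cshrinkC.
  by apply: bigcup_open => i _; exact: open_shrink.
have LOC : (L (~` O N) <= e)%R.
  have := @L_superadd (O N) (~` O N) setT mO (measurableC mO) measurableT.
  rewrite setICr setUCr L_setT => /(_ erefl (fun _ => id)); lra.
have : (L (shrink n U) <= L (~` O N) + \sum_(i < N) L (shrink N (G i)))%R.
  apply: (@L_bigcup_ord N (fun i => shrink N (G i))) => //; first exact: measurableC.
  move=> x sx; have [[|[i /= iN si]]|nO] := pselect (O N x); last by left.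
    by case; exact: shrink_cshrink.
  by right; exists i.
move=> h; apply: (@le_trans _ _ (\sum_(i < N) inner_lim (G i) + e%:E)).
  rewrite addeC; apply: (@le_trans _ _ (e%:E + \sum_(i < N) (L (shrink N (G i)))%:E)).
    by rewrite sumEFin lee_fin (le_trans h)// lerD2r.
  by apply: leeD2l; apply: lee_sum => i _; exact: inner_lim_ub.
rewrite leeD2r// -(big_mkord xpredT (fun i => inner_lim (G i))).
by apply: nneseries_lim_ge => i _ _; exact: inner_lim_ge0.
Qed.

Definition outer_lim (A : set X) : \bar R :=
  ereal_inf [set inner_lim G | G in [set G | open G /\ A `<=` G]].

Lemma outer_lim_lb A G : open G -> A `<=` G -> outer_lim A <= inner_lim G.
Proof. by move=> oG AG; apply: ereal_inf_lbound; exists G. Qed.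

Lemma outer_lim_ge0 A : 0 <= outer_lim A.
Proof. by apply: le_ereal_inf_tmp => _ [G _ <-]; exact: inner_lim_ge0. Qed.

Lemma outer_lim_open G : open G -> outer_lim G = inner_lim G.
Proof.
move=> oG; apply/eqP; rewrite eq_le outer_lim_lb//=.
by apply: le_ereal_inf_tmp => _ [G' [_ GG'] <-]; exact: inner_limS.
Qed.

Lemma outer_lim_le1 A : outer_lim A <= 1.
Proof. by rewrite -inner_lim_setT outer_lim_lb//; exact: openT. Qed.

Lemma outer_lim_fin A : outer_lim A \is a fin_num.
Proof.
by rewrite ge0_fin_numE ?outer_lim_ge0// (le_lt_trans (outer_lim_le1 A))// ltey.
Qed.

Lemma outer_lim0 : outer_lim set0 = 0.
Proof.
apply/eqP; rewrite eq_le outer_lim_ge0 andbT outer_lim_open; last exact: open0.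
by rewrite (le_trans (inner_lim_le open0))// L0.
Qed.

Lemma outer_limS : {homo outer_lim : A B / A `<=` B >-> A <= B}.
Proof.
move=> A B AB; apply: ereal_inf_le_tmp => _ [G [oG BG] <-].
by exists G => //; split => //; exact: subset_trans BG.
Qed.

Lemma outer_lim_sigma_subadditive : sigma_subadditive outer_lim.
Proof.
move=> A; apply/lee_addgt0Pr => e e0.
rewrite (le_trans _ (epsilon_trick _ _ (ltW e0)))//; last by move=> n; exact: outer_lim_ge0.
have /choice[G GP] : forall n, exists G : set X, [/\ open G, A n `<=` G &
    inner_lim G <= outer_lim (A n) + (e / (2 ^ n.+1)%:R)%:E].
  move=> n; have en : (0 < e / (2 ^ n.+1)%:R)%R by rewrite divr_gt0// ltr0n expn_gt0.
  have [_ [G [oG AG] <-] lt] := lb_ereal_inf_adherent en (outer_lim_fin (A n)).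
  by exists G; split => //; exact: ltW.
apply: (@le_trans _ _ (inner_lim (\bigcup_n G n))).
  apply: outer_lim_lb; first by apply: bigcup_open => n _; have [] := GP n.
  by move=> x [n _ An]; exists n => //; have [_ + _] := GP n; exact.
apply: (le_trans (inner_lim_bigcup _)); first by move=> n; have [] := GP n.
apply: lee_nneseries => [n _ _|n _]; first exact: inner_lim_ge0.
by have [] := GP n.
Qed.

HB.instance Definition _ := isOuterMeasure.Build R (pointed_of x0) outer_lim
  outer_lim0 outer_lim_ge0 outer_limS outer_lim_sigma_subadditive.

(** Caratheodory's inequality for open [G] and open test set [O]. Removing [cshrink n (O & G)] from
    [O] leaves an open set that still covers the part of [O] outside [G] and is disjoint from
    [shrink n (O & G)], so superadditivity of [L] applies. *)
Lemma outer_lim_open_split (O G : set X) : open O -> open G ->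
  inner_lim (O `&` G) + outer_lim (O `&` ~` G) <= inner_lim O.
Proof.
move=> oO oG; rewrite -leeBrDr; last exact: outer_lim_fin.
apply: ge_ereal_sup => _ [n _ <-]; rewrite leeBrDr ?outer_lim_fin// addeC -leeBrDr//.
pose W : set X := O `&` ~` cshrink n (O `&` G).
have oW : open W by apply: openI => //; exact: open_cshrinkC.
apply: (@le_trans _ _ (inner_lim W)).
  apply: outer_lim_lb => // x [Ox nGx]; split => // cx.
  by have [_] := cshrink_sub cx; exact: nGx.
apply: ge_ereal_sup => _ [k _ <-]; rewrite leeBrDr//.
apply: le_trans (inner_lim_ub (maxn n k) O); rewrite -EFinD lee_fin.
apply: L_superadd => //.
  apply/seteqP; split => // x [/shrink_sub[_ ncx] /shrink_cshrink cx].
  exact: ncx.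
move=> x [sx|sx].
  apply: shrinkS sx; [exact: leq_maxr|exact: subIsetl].
apply: shrinkS sx; [exact: leq_maxl|exact: subIsetl].
Qed.

(** The Caratheodory sets form a sigma-algebra, so it is enough to treat open sets, and by outer
    regularity open test sets are enough. *)
Lemma outer_lim_caratheodory (A : set XB) : measurable A ->
  (outer_lim : set (pointed_of x0) -> \bar R).-caratheodory A.
Proof.
pose mu : {outer_measure set (pointed_of x0) -> \bar R} := outer_lim.
have sub : <<s (@open X : set (set (pointed_of x0))) >> `<=` mu.-caratheodory.
  apply: smallest_sub.
    split.
    - exact: caratheodory_measurable_set0.
    - by move=> B mB; rewrite setTD; exact: caratheodory_measurable_setC.
    - by move=> B mB; exact: caratheodory_measurable_bigcup.
  move=> G oG; apply: le_caratheodory_measurable => B.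
  apply: le_ereal_inf_tmp => _ [V [oV BV] <-].
  apply: le_trans (outer_lim_open_split oV oG); apply: leeD.
    rewrite -outer_lim_open; last exact: openI.
    by apply: outer_limS; exact: setSI.
  by apply: outer_limS; exact: setSI.
exact: sub.
Qed.

Definition regular_part (A : set XB) : \bar R := outer_lim A.

Let rp0 : regular_part set0 = 0. Proof. exact: outer_lim0. Qed.
Let rp_ge0 A : 0 <= regular_part A. Proof. exact: outer_lim_ge0. Qed.
Let rp_sigma : semi_sigma_additive regular_part.
Proof.
move=> F mF tF mU.
pose mu : {outer_measure set (pointed_of x0) -> \bar R} := outer_lim.
apply: (@caratheodory_measure_sigma_additive R _ mu F) => //.
- by move=> n; exact: outer_lim_caratheodory.
- exact: outer_lim_caratheodory.
Qed.

HB.instance Definition _ := isMeasure.Build _ XB R regular_part rp0 rp_ge0 rp_sigma.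

Let rp_setT : regular_part setT = 1.
Proof. by rewrite /regular_part outer_lim_open ?inner_lim_setT//; exact: openT. Qed.

HB.instance Definition _ := Measure_isProbability.Build _ XB R regular_part rp_setT.

(** Shrinking may lose mass, so only an upper bound on open sets is claimed; equality of the total
    masses will later turn it into equality on continuous functions. *)
Lemma exists_regular_part : exists mu : probability XB R,
  forall G : set X, open G -> mu G <= (L G)%:E.
Proof.
exists regular_part => G oG; rewrite -[leLHS]/(outer_lim G).
by rewrite outer_lim_open// inner_lim_le.
Qed.

End regular_part.

(** * The invariant probability measure *)

Lemma ultra_fmap (T U : Type) (f : T -> U) (V : set_system T) :
  UltraFilter V -> UltraFilter (f @ V).
Proof.
move=> UV; split; first exact: fmap_proper_filter.
move=> G PG VG; apply/seteqP; split => [A GA|//].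
have [//|VnA] := in_ultra_setVsetC (f @^-1` A) UV.
have : G (~` A) by apply: VG.
by move=> GnA; have := filter_not_empty G; rewrite -(setICr A); case; exact: filterI.
Qed.

Lemma ultra_bounded_cvg (R : realType) (I : Type) (V : set_system I) (a : I -> R) (M : R) :
  UltraFilter V -> (forall i, `|a i| <= M) -> exists l : R, a @ V --> l.
Proof.
move=> UV aM; have UaV : UltraFilter (a @ V) by exact: ultra_fmap.
have := @segment_compact R (- M) M; rewrite compact_ultra => /(_ (a @ V) UaV).
case; last by move=> l [_ al]; exists l.
by rewrite /fmap/=; apply: filterE => i /=; rewrite in_itv/= -ler_norml.
Qed.

(** * Bounded Lipschitz functions determine a measure *)

Section unique.
Context (R : realType) (X : metricType R) (x0 : X).
Local Notation XB := (borel_of x0).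

Lemma bump_compl_lip (G : set X) n : bounded_lipschitz (fun y => 1 - bump (~` G) (n.+1%:R^-1 : R) y).
Proof.
apply: bounded_lipschitzD; first exact: bounded_lipschitz_cst.
rewrite (_ : (fun _ => _) = fun y => -1 * bump (~` G) n.+1%:R^-1 y).
  by apply: bounded_lipschitzZ; apply: bump_bounded_lipschitz; rewrite invr_gt0.
by apply/funext => y; rewrite mulN1r.
Qed.

Lemma bump_compl_norm (G : set X) n y : `|1 - bump (~` G) (n.+1%:R^-1 : R) y| <= 1.
Proof.
have n0 : 0 < n.+1%:R^-1 :> R by rewrite invr_gt0.
by rewrite ger0_norm ?subr_ge0 ?bump_le1// gerBl bump_ge0.
Qed.

Lemma bump_compl_cvg (G : set X) : open G ->
  forall x, (fun n => 1 - bump (~` G) (n.+1%:R^-1 : R) x) @ \oo --> (\1_G x : R).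
Proof.
move=> oG x; rewrite (_ : \1_G x = 1 - \1_(~` G) x).
  by apply: cvgB; [exact: cvg_cst|apply: bump_cvg_indic; exact: open_closedC].
by rewrite !indicE in_setC; case: (x \in G); rewrite ?subrr ?subr0.
Qed.

(** Indicators of open sets are bounded pointwise limits of Lipschitz functions, and open sets form
    a pi-system generating the Borel sets. Subprobabilities are allowed because that is the type of
    a Giry bind. *)
Lemma eq_lipschitz_measure (m1 m2 : subprobability XB R) :
  (forall f : X -> R, bounded_lipschitz f -> (forall x, 0 <= f x <= 1) ->
     \int[m1]_x f x = \int[m2]_x f x) ->
  forall A : set XB, measurable A -> m1 A = m2 A.
Proof.
move=> eqf; apply: (measure_unique (@open X : set (set XB)) (fun=> setT)) => //.
- by move=> A B; exact: openI.
- by move=> _; exact: openT.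
- by rewrite bigcup_const.
- move=> G oG; have mG : measurable (G : set XB) by exact: borel_open.
  pose h n (y : X) : R := 1 - bump (~` G) n.+1%:R^-1 y.
  have n0 n : 0 < n.+1%:R^-1 :> R by rewrite invr_gt0.
  have c (m : subprobability XB R) : (fun n => \int[m]_x h n x) @ \oo --> fine (m G).
    rewrite -Rint_indic//; apply: (Rint_dct (M := 1)).
    - by move=> n; have [] := bounded_lipschitz_bm x0 (bump_compl_lip G n).
    - by move=> n x; exact: bump_compl_norm.
    - exact: bump_compl_cvg.
  have c1 := c m1; have c2 := c m2.
  suff : fine (m1 G) = fine (m2 G).
    by move=> e; rewrite -[LHS]fineK ?fin_num_measure// [in LHS]e fineK// fin_num_measure.
  have E : (fun n => \int[m1]_x h n x) = (fun n => \int[m2]_x h n x).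
    apply/funext => n; apply: eqf; first exact: bump_compl_lip.
    by move=> x; rewrite subr_ge0 bump_le1//= gerBl bump_ge0.
  by rewrite E in c1; exact: (cvg_unique _ c1 c2).
- by move=> _; rewrite (le_lt_trans sprobability_setT)// ltey.
Qed.

End unique.

Section invariant_measure.
Context (R : realType) (X : metricType R) (x0 : X).
Local Notation XB := (borel_of x0).
Variable p : R -> XB -> probability XB R.
Local Notation P := (Pop p).
Local Notation bm := (@bounded_measurable _ XB R).
Hypothesis polX : polish X.
Hypothesis mp : forall t A, measurable A -> measurable_fun [set: XB] (fun x => p t x A).
Hypothesis CK : forall s t x A, 0 <= s -> 0 <= t -> measurable A ->
  p (s + t) x A = (\int[p s x]_u p t u A)%E.
Hypothesis feller : forall t, 0 <= t -> forall g : X -> R, continuous g ->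
  (exists M : R, forall x, `|g x| <= M) -> continuous (P t g).
Variable z : X.
Hypothesis lbz : lower_bd p z.
Hypothesis asymL : forall f : X -> R, bounded_lipschitz f -> forall x y e, 0 < e ->
  exists T : R, forall t, T <= t -> `|P t f x - P t f y| <= e.

Definition inv_meas (mu : probability XB R) := forall t, 0 <= t -> forall A : set XB, measurable A ->
  (\int[mu]_x p t x A = mu A)%E.

Lemma inv_Rint (mu : probability XB R) t f : 0 <= t -> inv_meas mu -> itg mu f ->
  (forall x, itg (p t x) f) -> \int[mu]_x P t f x = \int[mu]_x f x.
Proof.
move=> t0 im imf itf; apply/esym.
by apply: (@Rint_bind _ _ XB XB R mu (p t) mu (mp t)) => // A mA; rewrite im.
Qed.

Lemma cvg_pinfty_of_le (a : R -> R) (l : R) :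
  (forall e, 0 < e -> exists T : R, forall t, T <= t -> `|a t - l| <= e) -> a @ +oo --> l.
Proof.
move=> h; apply/cvgrPdist_le => e e0; have [T TP] := h e e0.
near=> t; rewrite distrC; apply: TP; near: t; exact: nbhs_pinfty_ge (num_real T).
Unshelve. all: by end_near. Qed.

(** Bounded convergence passes the asymptotic equality to any initial law. The law at time [s] from
    [z] gives invariance under time shifts, and an invariant law gives convergence. *)
Lemma asym_cvg_integral (m : probability XB R) f : bounded_lipschitz f ->
  (fun t => \int[m]_x P t f x - P t f z) @ +oo --> (0 : R).
Proof.
move=> bf; have bmf : bm f by exact: bounded_lipschitz_bm.
have [mf [M fM]] := bmf.
apply/cvg_pinftyP => u uoo.
rewrite (_ : (fun n => _) = fun n => \int[m]_x (P (u n) f x - P (u n) f z)); last first.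
  apply/funext => n; rewrite RintegralB//; [|exact/bm_itg/bm_Pop|exact/bm_itg/bm_cst].
  by rewrite Rint_cst.
rewrite -[X in _ --> X](Rint_cst m (0 : R)).
apply: (Rint_dct (M := M + M)).
- by move=> n; apply: measurable_funB => //; have [] := bm_Pop mp (u n) bmf.
- by move=> n x; rewrite (le_trans (ler_normB _ _))// lerD// Pop_bound.
move=> x; have : (fun t => P t f x - P t f z) @ +oo --> (0 : R).
  by apply: cvg_pinfty_of_le => e e0; have [T TP] := asymL bf x z e0;
     exists T => t /TP; rewrite subr0.
by move/cvg_pinftyP/(_ u uoo).
Qed.

Lemma asym_cvg_shift f s : bounded_lipschitz f -> 0 <= s ->
  (fun t => P (s + t) f z - P t f z) @ +oo --> (0 : R).
Proof.
move=> bf s0; apply: cvg_trans (asym_cvg_integral (p s z) bf).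
apply: near_eq_cvg; near=> t; congr (_ - _).
apply/esym/PopDb => //; last exact: bounded_lipschitz_bm.
Unshelve. all: by end_near. Qed.

(** * Limits of the laws from [z] along an ultrafilter of times *)

Section ultralimit.
Variables (V : set_system R) (UV : UltraFilter V) (Voo : (+oo : set_system R) `<=` V).

Let L (f : X -> R) : R := lim ((fun t => P t f z) @ V).

Lemma ulim_cvg f : bm f -> (fun t => P t f z) @ V --> L f.
Proof.
move=> [mf [M fM]]; apply/cvg_ex.
by apply: (ultra_bounded_cvg (M := M)) => t; exact: Pop_bound.
Qed.

Lemma ulimD f g : bm f -> bm g -> L (fun x => f x + g x) = L f + L g.
Proof.
move=> bf bg; apply: cvg_lim => //.
rewrite (_ : (fun t => _) = fun t => P t f z + P t g z).
  by apply: cvgD; exact: ulim_cvg.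
by apply/funext => t; exact: Pop_add.
Qed.

Lemma ulimZ c f : bm f -> L (fun x => c * f x) = c * L f.
Proof.
move=> bf; apply: cvg_lim => //.
rewrite (_ : (fun t => _) = fun t => c * P t f z).
  by apply: cvgMr; exact: ulim_cvg.
by apply/funext => t; exact: Pop_scale.
Qed.

Lemma ulim_le f g : bm f -> bm g -> (forall x, f x <= g x) -> L f <= L g.
Proof.
move=> bf bg fg; apply: ler_lim.
- by apply/cvg_ex; eexists; exact: ulim_cvg.
- by apply/cvg_ex; eexists; exact: ulim_cvg.
by apply: nearW => t; exact: Pop_le.
Qed.

Lemma ulim_cst c : L (fun=> c) = c.
Proof.
apply: cvg_lim => //; rewrite (_ : (fun t => _) = fun=> c); first exact: cvg_cst.
by apply/funext => t; exact: Pop_cst.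
Qed.

Variable mu : probability XB R.
Hypothesis muL : forall G : set X, open G -> (mu G <= (L \1_G)%:E)%E.

(** Layer-cake sum with step [i]: the increment from [H K] to [H K.+1] lies between [i] times the
    indicators of [G K.+1] and [G K]. Bounding the integral with the larger and [L] with the smaller
    indicator leaves a telescoping error of at most [i], which is below [e]. *)
Lemma integral_le_ulim (h : X -> R) : continuous h -> (forall x, 0 <= h x <= 1) ->
  \int[mu]_x h x <= L h.
Proof.
move=> ch h01; apply/ler_addgt0Pr => e e0.
have [N NP] : exists N : nat, N.+1%:R^-1 < e.
  by have := near_infty_natSinv_lt (PosNum e0); case=> n _ /(_ n (leqnn n)); exists n.
set i := N.+1%:R^-1 in NP; have i0 : 0 < i by rewrite invr_gt0.
pose H K x := Num.min (h x) (K%:R * i).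
have cH K : continuous (H K).
  by move=> x; apply: (@continuous_min R X h (cst (K%:R * i)) x); [exact: ch|exact: cst_continuous].
have bH K : bm (H K).
  split; first exact: borel_continuous.
  exists 1 => x; have /andP[h0 h1] := h01 x.
  have Ki : 0 <= K%:R * i by rewrite mulr_ge0// ltW.
  by rewrite ger0_norm ?le_min ?h0 ?Ki// ge_min h1.
pose G K : set X := [set x | K%:R * i < h x].
have oG K : open (G K).
  have /continuousP/(_ [set y | K%:R * i < y]) := ch; apply; exact: open_gt.
have mG K : measurable (G K : set XB) by exact: borel_open.
have bG K : bm \1_(G K) by exact: bm_indic.
have key K : \int[mu]_x H K x <= L (H K) + i * (L \1_(G 0%N) - L \1_(G K)).
  elim: K => [|K ih].
    have -> : H 0%N = fun=> 0.
      by apply/funext => x; rewrite /H mul0r min_r//; have /andP[] := h01 x.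
    by rewrite Rint_cst ulim_cst subrr mulr0 addr0.
  have KS : K.+1%:R * i = K%:R * i + i by rewrite -natr1 mulrDl mul1r.
  have up x : H K.+1 x <= H K x + i * \1_(G K) x.
    rewrite /H indicE KS; have [hK|hK] := ltP (K%:R * i) (h x).
      rewrite mem_set// mulr1; apply: (@le_trans _ _ (K%:R * i + i)).
        by rewrite ge_min lexx orbT.
      by [].
    rewrite memNset ?mulr0 ?addr0; last by rewrite /G /= ltNge hK.
    by rewrite ge_min lexx.
  have lo x : H K x + i * \1_(G K.+1) x <= H K.+1 x.
    rewrite /H indicE KS; have [hK|hK] := ltP (K%:R * i + i) (h x).
      rewrite mem_set ?mulr1; last by rewrite /G /= KS.
      by rewrite lerD2r ge_min lexx orbT.
    rewrite memNset ?mulr0 ?addr0; last by rewrite /G /= KS ltNge hK.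
    by rewrite ge_min lexx.
  have biG K' : bm (fun x => i * \1_(G K') x) by apply: bmM => //; exact: bm_cst.
  have h1 : \int[mu]_x H K.+1 x <= \int[mu]_x H K x + i * L \1_(G K).
    apply: (@le_trans _ _ (\int[mu]_x (H K x + i * \1_(G K) x))).
      by apply: Rint_le => //; apply: bm_itg => //; apply: bmD.
    rewrite RintegralD//; [|exact: bm_itg..].
    rewrite lerD2l RintegralZl//; last exact: bm_itg.
    rewrite ler_pM2l// Rint_indic// -lee_fin fineK ?fin_num_measure//.
    exact: muL.
  have h2 : L (H K) + i * L \1_(G K.+1) <= L (H K.+1).
    rewrite -ulimZ// -ulimD//; apply: ulim_le => //.
    exact: bmD.
  by move: h1 h2 ih; rewrite !mulrBr; lra.
have HN : H N.+1 = h.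
  apply/funext => x; rewrite /H /i divff// min_l//; by have /andP[] := h01 x.
have := key N.+1; rewrite HN.
have l1 : L \1_(G 0%N) <= 1.
  apply: (@le_trans _ _ (L (fun=> 1))); last by rewrite ulim_cst.
  apply: ulim_le => [//||x]; first exact: bm_cst.
  by rewrite indicE; case: (_ \in _); rewrite ?ler01.
have l0 : 0 <= L \1_(G N.+1).
  apply: (@le_trans _ _ (L (fun=> 0))); first by rewrite ulim_cst.
  by apply: ulim_le => [||x]; [exact: bm_cst|done|rewrite indicE].
move=> h3; apply: (le_trans h3); rewrite lerD2l.
have : i * (L \1_(G 0%N) - L \1_(G N.+1)) <= i * 1 by rewrite ler_wpM2l ?(ltW i0)//; lra.
by rewrite mulr1; lra.
Qed.

(** The inequality is used for [h] and for [1 - h]; both functionals give constants their own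
    value. *)
Lemma integral_eq_ulim (h : X -> R) : continuous h -> (forall x, 0 <= h x <= 1) ->
  \int[mu]_x h x = L h.
Proof.
move=> ch h01; have bh : bm h.
  split; first exact: borel_continuous.
  by exists 1 => x; have /andP[h0 h1] := h01 x; rewrite ger0_norm.
apply/eqP; rewrite eq_le integral_le_ulim//=.
have := @integral_le_ulim (fun x => 1 + -1 * h x).
have bNh : bm (fun x => -1 * h x) by apply: bmM => //; exact: bm_cst.
rewrite RintegralD//; [|exact/bm_itg/bm_cst|exact: bm_itg].
rewrite RintegralZl//; last exact: bm_itg.
rewrite Rint_cst ulimD//; last exact: bm_cst.
rewrite ulimZ// ulim_cst => h'; suff : 1 + -1 * \int[mu]_x h x <= 1 + -1 * L h by lra.
apply: h'.
  move=> x; apply: cvgD; first exact: cvg_cst.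
  by apply: cvgMr; exact: ch.
by move=> x; have /andP[h0 h1] := h01 x; lra.
Qed.

(** The Feller property keeps [P s f] continuous, so its integral is again the limit along [V], and
    that limit is insensitive to the time shift [s]. *)
Lemma ulim_inv : inv_meas mu.
Proof.
move=> s s0 A mA.
have mk := @measurable_giry_codensity _ XB _ XB R setT (p s : XB -> giry XB R) measurableT (mp s).
have nuE B : measurable B -> giry_bind (mu : giry XB R) mk B = (\int[mu]_x p s x B)%E.
  by move=> mB; rewrite [LHS]giry_int_map//; exact: measurable_giry_ev.
rewrite -nuE//; apply: (@eq_lipschitz_measure R X x0 (giry_bind (mu : giry XB R) mk) mu) => // f bf f01.
have bmf : bm f by exact: bounded_lipschitz_bm.
rewrite (@Rint_bind _ _ XB XB R mu (p s) (giry_bind (mu : giry XB R) mk) (mp s) nuE);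
  [|exact: bm_itg|by move=> x; exact: bm_itg].
have Pf01 x : 0 <= P s f x <= 1.
  apply/andP; split; first by apply: Pop_ge0 => y; have /andP[] := f01 y.
  rewrite -(Pop_cst p s 1 x); apply: Pop_le => //; first exact: bm_cst.
  by move=> y; have /andP[] := f01 y.
have cf := bounded_lipschitz_continuous bf.
rewrite -/(P s f) (@integral_eq_ulim (P s f))//; last first.
  by apply: feller => //; have [_] := bmf.
rewrite integral_eq_ulim//.
have c1 : (fun t => P t (P s f) z - P t f z) @ V --> (0 : R).
  apply: cvg_trans (cvg_trans _ (asym_cvg_shift bf s0)); last first.
    exact: (cvg_app _ Voo).
  apply: near_eq_cvg; near=> t.
  have t0 : 0 <= t by near: t; apply: Voo; exact: nbhs_pinfty_ge.
  by rewrite -PopDb// (addrC t).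
have c2 : (fun t => P t (P s f) z - P t f z) @ V --> L (P s f) - L f.
  by apply: cvgB; apply: ulim_cvg => //; exact: bm_Pop.
have : L (P s f) - L f = 0 by apply: (cvg_unique _ c2 c1).
by move/eqP; rewrite subr_eq0 => /eqP.
Unshelve. all: by end_near. Qed.

End ultralimit.

Lemma exists_inv_meas : exists mu : probability XB R, inv_meas mu.
Proof.
have [V [UV Voo]] := ultraFilterLemma (@proper_pinfty_nbhs R).
pose Lf (f : X -> R) : R := lim ((fun t => P t f z) @ V).
pose L (A : set X) : R := Lf \1_A.
have Lc c : Lf (fun=> c) = c by exact: ulim_cst.
have LD f g : bm f -> bm g -> Lf (fun x => f x + g x) = Lf f + Lf g by exact: ulimD.
have Lle f g : bm f -> bm g -> (forall x, f x <= g x) -> Lf f <= Lf g by exact: ulim_le.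
have [A mA|A B C mA mB mC AB ABC|A B C mA mB mC ABC|||mu muP] := @exists_regular_part R X x0 L.
- rewrite -[leLHS]Lc; apply: Lle; [exact: bm_cst|exact: bm_indic|].
  by move=> x; rewrite indicE.
- rewrite /L -LD; [|exact: bm_indic..].
  apply: Lle; [by apply: bmD; exact: bm_indic|exact: bm_indic|].
  move=> x; rewrite !indicE; case: (boolP (x \in A)) => xA; case: (boolP (x \in B)) => xB.
  + by have : set0 x by rewrite -AB; split; exact: set_mem.
  + by rewrite (_ : x \in C) ?addr0//; apply/mem_set/ABC; left; exact: set_mem.
  + by rewrite (_ : x \in C) ?add0r//; apply/mem_set/ABC; right; exact: set_mem.
  + by rewrite addr0.
- rewrite /L -LD; [|exact: bm_indic..].
  apply: Lle; [exact: bm_indic|by apply: bmD; exact: bm_indic|].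
  move=> x; rewrite !indicE; case: (boolP (x \in A)) => xA; last by rewrite addr_ge0.
  have [xB|xC] : (B `|` C) x by apply: ABC; exact: set_mem.
    by rewrite (mem_set xB) lerDl.
  by rewrite (mem_set xC) lerDr.
- by rewrite /L indicT; exact: Lc.
- move=> O oO ndO OT e e0.
  have [n [T TP]] := asym_sigma_smooth polX mp CK feller lbz asymL oO ndO OT e0.
  exists n; apply: limr_ge.
    by apply/cvg_ex; eexists; apply: ulim_cvg => //; apply: bm_indic; exact: borel_open.
  near=> t; apply: TP; near: t; apply: Voo; exact: nbhs_pinfty_ge (num_real T).
by exists mu; exact: (ulim_inv UV Voo muP).
Unshelve. all: by end_near. Qed.

(** The integral of [P t f] against [mu] is constant in [t] and asymptotically equal to [P t f z],
    hence to [P t f x]. *)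
Lemma lipschitz_cvg (mu : probability XB R) f x : inv_meas mu -> bounded_lipschitz f ->
  (fun t => P t f x) @ +oo --> \int[mu]_y f y.
Proof.
move=> im bf; have bmf : bm f by exact: bounded_lipschitz_bm.
have c1 : (fun t => P t f x - P t f z) @ +oo --> (0 : R).
  by apply: cvg_pinfty_of_le => e e0; have [T TP] := asymL bf x z e0;
     exists T => t /TP; rewrite subr0.
have c2 : (fun t => P t f x - P t f z - (\int[mu]_y P t f y - P t f z) + \int[mu]_y f y) @ +oo -->
    0 - 0 + \int[mu]_y f y.
  by apply: cvgD; [apply: cvgB => //; exact: asym_cvg_integral|exact: cvg_cst].
rewrite subr0 add0r in c2; apply: cvg_trans c2; apply: near_eq_cvg; near=> t.
have t0 : 0 <= t by near: t; exact: nbhs_pinfty_ge.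
rewrite inv_Rint//; [by ring|exact: bm_itg|by move=> y; exact: bm_itg].
Unshelve. all: by end_near. Qed.

Lemma inv_meas_unique (mu nu : probability XB R) : inv_meas mu -> inv_meas nu ->
  forall A : set XB, measurable A -> nu A = mu A.
Proof.
move=> im iv; apply: (@eq_lipschitz_measure R X x0 nu mu) => f bf _.
have c1 := lipschitz_cvg z im bf; have c2 := lipschitz_cvg z iv bf.
exact: (cvg_unique _ c2 c1).
Qed.

End invariant_measure.

(** * Mixing *)

Section L1_density.
Context (R : realType) (X : metricType R) (x0 : X).
Local Notation XB := (borel_of x0).
Variable mu : probability XB R.
Local Notation bm := (@bounded_measurable _ XB R).

Definition lip_approx (g : X -> R) := itg mu g /\ forall e, 0 < e ->
  exists2 f : X -> R, bounded_lipschitz f & \int[mu]_x `|g x - f x| <= e.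

Let lip_itg f : bounded_lipschitz f -> itg mu f.
Proof. by move=> bf; apply: bm_itg; exact: bounded_lipschitz_bm. Qed.

Let itg_dist g f : itg mu g -> itg mu f -> itg mu (fun x => `|g x - f x|).
Proof. by move=> ig jf; apply/itg_norm/itgB. Qed.

Lemma Rint_dist_triangle g f h : itg mu g -> itg mu f -> itg mu h ->
  \int[mu]_x `|g x - h x| <= \int[mu]_x `|g x - f x| + \int[mu]_x `|f x - h x|.
Proof.
move=> ig jf ih; rewrite -RintegralD//; [|exact: itg_dist..].
apply: Rint_le; [exact: itg_dist|by apply: itgD; exact: itg_dist|].
by move=> x; exact: ler_distD.
Qed.

Lemma lip_approx_lim g : itg mu g ->
  (forall e, 0 < e -> exists2 g', lip_approx g' & \int[mu]_x `|g x - g' x| <= e) ->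
  lip_approx g.
Proof.
move=> ig lim; split => // e e0; have e2 : 0 < e / 2 by rewrite divr_gt0.
have [g' [ig' /(_ _ e2)[f bf fe]] gg'] := lim _ e2; exists f => //.
apply: (le_trans (Rint_dist_triangle ig ig' (lip_itg bf))).
by rewrite (splitr e) lerD.
Qed.

Lemma lip_approx_lip f : bounded_lipschitz f -> lip_approx f.
Proof.
move=> bf; split; first exact: lip_itg.
move=> e e0; exists f => //; under eq_Rintegral do rewrite subrr normr0.
by rewrite Rint_cst ltW.
Qed.

Lemma lip_approxD g h : lip_approx g -> lip_approx h -> lip_approx (fun x => g x + h x).
Proof.
move=> [ig ag] [ih ah]; split; first exact: itgD.
move=> e e0; have e2 : 0 < e / 2 by rewrite divr_gt0.
have [f bf fe] := ag _ e2; have [k bk ke] := ah _ e2.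
exists (fun x => f x + k x); first exact: bounded_lipschitzD.
have jf := lip_itg bf; have ik := lip_itg bk.
apply: (@le_trans _ _ (\int[mu]_x (`|g x - f x| + `|h x - k x|))).
  apply: Rint_le; [by apply: itg_dist; exact: itgD|by apply: itgD; exact: itg_dist|].
  by move=> x; rewrite opprD addrACA; exact: ler_normD.
rewrite RintegralD//; [|exact: itg_dist..].
by rewrite (splitr e) lerD.
Qed.

Lemma lip_approxZ c g : lip_approx g -> lip_approx (fun x => c * g x).
Proof.
move=> [ig ag]; split; first exact: itgZ.
move=> e e0; have c1 : 0 < `|c| + 1 by rewrite ltr_wpDl.
have e2 : 0 < e / (`|c| + 1) by rewrite divr_gt0.
have [f bf fe] := ag _ e2; have jf := lip_itg bf.
exists (fun x => c * f x); first exact: bounded_lipschitzZ.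
under eq_Rintegral do rewrite -mulrBr normrM.
rewrite RintegralZl//; last exact: itg_dist.
apply: (@le_trans _ _ (`|c| * (e / (`|c| + 1)))); first by rewrite ler_wpM2l.
by rewrite mulrCA ler_piMr ?(ltW e0)// ler_pdivrMr// mul1r lerDl.
Qed.

Lemma lip_approx_sum (I : eqType) (s : seq I) (g : I -> X -> R) :
  (forall i, i \in s -> lip_approx (g i)) -> lip_approx (fun x => \sum_(i <- s) g i x).
Proof.
elim: s => [_|i s ih gs].
  under eq_fun do rewrite big_nil.
  by apply: lip_approx_lip; exact: bounded_lipschitz_cst.
under eq_fun do rewrite big_cons.
apply: lip_approxD; first by apply: gs; rewrite mem_head.
by apply: ih => j js; apply: gs; rewrite in_cons js orbT.
Qed.

Lemma lip_approx_dct (g_ : nat -> X -> R) g M : (forall n, lip_approx (g_ n)) ->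
  (forall n x, `|g_ n x| <= M) -> (forall x, g_ ^~ x @ \oo --> g x) -> bm g ->
  lip_approx g.
Proof.
move=> ag gM gs bg; apply: lip_approx_lim; first exact: bm_itg.
have mg_ n : measurable_fun [set: XB] (g_ n) := itg_measurable (proj1 (ag n)).
have [mg [N gN]] := bg.
have c : (fun n => \int[mu]_x `|g x - g_ n x|) @ \oo --> (0 : R).
  rewrite -[X in _ --> X](Rint_cst mu (0 : R)); apply: (Rint_dct (M := N + M)).
  - by move=> n; apply: measurableT_comp => //; exact: measurable_funB.
  - by move=> n x; rewrite normr_id (le_trans (ler_normB _ _))// lerD.
  - move=> x; rewrite -(normr0 R) -(subrr (g x)); apply: cvg_norm.
    by apply: cvgB; [exact: cvg_cst|exact: gs].
move=> e e0; have /cvgrPdist_le/(_ _ e0)[n _ /(_ n (leqnn n))] := c.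
rewrite /= sub0r normrN => ne; exists (g_ n) => //.
exact: le_trans (ler_norm _) ne.
Qed.

Let indic_norm (A : set X) x : `|\1_A x : R| <= 1.
Proof. by rewrite indicE; case: (_ \in _); rewrite ?normr1// normr0. Qed.

(** Dynkin induction from open sets: approximable functions are stable under sums, scalings and
    bounded pointwise limits, which covers complements and disjoint unions. *)
Lemma lip_approx_indic (A : set XB) : measurable A -> lip_approx \1_A.
Proof.
move: A; apply: (@dynkin_induction _ XB (@open X : set (set XB)) (fun A => lip_approx \1_A)) => //.
- by move=> A B; exact: openI.
- by rewrite indicT; apply: lip_approx_lip; exact: bounded_lipschitz_cst.
- move=> G oG; have mG : measurable (G : set XB) by exact: borel_open.
  apply: (@lip_approx_dct (fun n x => 1 - bump (~` G) n.+1%:R^-1 x) _ 1).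
  + by move=> n; apply: lip_approx_lip; exact: bump_compl_lip.
  + by move=> n x; exact: bump_compl_norm.
  + exact: bump_compl_cvg.
  + exact: bm_indic.
- move=> A mA aA; rewrite (_ : \1_(~` A) = fun x => 1 + -1 * \1_A x).
    apply: lip_approxD; last exact: lip_approxZ.
    by apply: lip_approx_lip; exact: bounded_lipschitz_cst.
  by apply/funext => x; rewrite !indicE in_setC; case: (x \in A); rewrite /=; lra.
- move=> F mF tF aF.
  have E n x : \sum_(i <- iota 0 n) (\1_(F i) x : R) = \1_(\bigcup_(i in [set i | (i < n)%N]) F i) x.
    elim: n => [|n ih]; first by rewrite big_nil indicE memNset// => -[].
    rewrite -addn1 iotaD big_cat/= ih big_seq1 add0n addn1 !indicE.
    have [Fn|nFn] := pselect (F n x).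
      have h1 : (\bigcup_(i in [set i | (i < n.+1)%N]) F i) x by exists n => /=.
      have h0 : ~ (\bigcup_(i in [set i | (i < n)%N]) F i) x.
        move=> [i /= iN Fi]; have ie : i = n by apply: tF => //; exists x.
        by move: iN; rewrite ie ltnn.
      by rewrite (mem_set Fn) (mem_set h1) (memNset h0) add0r.
    rewrite (memNset nFn) addr0; congr (_%:R); congr (nat_of_bool _); apply/idP/idP; rewrite !inE.
      by move=> [i /= iN Fi]; exists i => //=; exact: ltnW.
    move=> [i /= iN Fi]; exists i => //=; move: iN; rewrite ltnS leq_eqVlt.
    by move=> /predU1P[iN|//]; case: nFn; rewrite -iN.
  apply: (@lip_approx_dct (fun n x => \sum_(i <- iota 0 n) \1_(F i) x) _ 1).
  + by move=> n; apply: lip_approx_sum.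
  + by move=> n x; rewrite E.
  + move=> x; apply: cvg_near_cst; have [[i _ Fi]|nF] := pselect ((\bigcup_i F i) x).
      exists i.+1 => // n /= iN; rewrite E !indicE !mem_set//; first by exists i.
      by exists i.
    apply: nearW => n; rewrite E !indicE !memNset// => -[i _ Fi].
    by apply: nF; exists i.
  + by apply: bm_indic; exact: bigcup_measurable.
Qed.

Import HBSimple.

Lemma lip_approx_sfun (h : {sfun XB >-> R}) : lip_approx h.
Proof.
rewrite (_ : (h : _ -> _) = fun x => \sum_(r <- finmap.enum_fset (fset_set (range h))) r * \1_(h @^-1` [set r]) x).
  apply: lip_approx_sum => r _; apply: lip_approxZ; apply: lip_approx_indic.
  exact: measurable_sfunP.
by apply/funext => x; rewrite {1}fimfunE fsbig_finite.
Qed.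

Lemma lip_approx_itg g : itg mu g -> lip_approx g.
Proof.
move=> ig; apply: lip_approx_lim => // e e0.
have [g_ [ig_ _ c]] := approximation_sfun_integrable measurableT ig.
have : (fun n => \int[mu]_x `|g x - g_ n x|) @ \oo --> (0 : R).
  by apply: fine_cvg; exact: c.
move=> /cvgrPdist_le/(_ _ e0)[n _ /(_ n (leqnn n))].
rewrite /= sub0r normrN => ne; exists (g_ n); first exact: lip_approx_sfun.
exact: le_trans (ler_norm _) ne.
Qed.

End L1_density.

(** * Convergence in [L^1(mu)], and at the point [z] *)

Section mixing.
Context (R : realType) (X : metricType R) (x0 : X).
Local Notation XB := (borel_of x0).
Variable p : R -> XB -> probability XB R.
Local Notation P := (Pop p).
Local Notation bm := (@bounded_measurable _ XB R).
Hypothesis mp : forall t A, measurable A -> measurable_fun [set: XB] (fun x => p t x A).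
Hypothesis CK : forall s t x A, 0 <= s -> 0 <= t -> measurable A ->
  p (s + t) x A = (\int[p s x]_u p t u A)%E.
Variable mu : probability XB R.
Hypothesis inv_mu : inv_meas p mu.
Hypothesis lip_cvg : forall f x, bounded_lipschitz f -> (fun t => P t f x) @ +oo --> \int[mu]_y f y.

Definition ev_itg (f : X -> R) := forall t x, 0 <= t -> itg (p t x) f.

Lemma bm_ev_itg f : bm f -> ev_itg f. Proof. by move=> bf t x _; exact: bm_itg. Qed.

Lemma inv_bindE t : 0 <= t -> forall A, measurable A -> mu A = (\int[mu]_x p t x A)%E.
Proof. by move=> t0 A mA; rewrite inv_mu. Qed.

Lemma itg_Pop t f : 0 <= t -> itg mu f -> ev_itg f -> itg mu (P t f).
Proof.
move=> t0 imf ef.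
by apply: (@itg_bind _ _ XB XB R mu (p t) mu (mp t) (inv_bindE t0)) => // x; exact: ef.
Qed.

Lemma Pop_L1_contraction t f : 0 <= t -> itg mu f -> ev_itg f ->
  \int[mu]_x `|P t f x| <= \int[mu]_x `|f x|.
Proof.
move=> t0 imf ef.
have inf : itg mu (fun x => `|f x|) by exact: itg_norm.
have enf : ev_itg (fun x => `|f x|) by move=> s x s0; apply/itg_norm/ef.
have -> : \int[mu]_x `|f x| = \int[mu]_x P t (fun y => `|f y|) x.
  by rewrite (@inv_Rint R X x0 p mp mu t (fun y => `|f y|))// => x; exact: enf.
apply: Rint_le; [exact/itg_norm/itg_Pop|exact: itg_Pop|].
by move=> x; apply: Pop_norm; exact: ef.
Qed.

(** A Lipschitz [g] close to [f] costs one third for [P t (f - g)], uniformly in [t] by contraction,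
    and one third for the difference of the means; for [g] itself bounded convergence applies. *)
Lemma mixing f : itg mu f -> ev_itg f -> forall e, 0 < e -> exists2 T : R, 0 <= T &
  forall t, T <= t -> \int[mu]_x `|P t f x - \int[mu]_y f y| <= e.
Proof.
move=> imf ef e e0; have e3 : 0 < e / 3 by rewrite divr_gt0.
have [_ /(_ _ e3)[g bg ge]] := lip_approx_itg imf.
have bmg : bm g by exact: bounded_lipschitz_bm.
have [mg [M gM]] := bmg.
have ig : itg mu g by exact: bm_itg.
have eg := bm_ev_itg bmg.
pose c := \int[mu]_y f y; pose d := \int[mu]_y g y.
have cg : (fun t => \int[mu]_x `|P t g x - d|) @ +oo --> (0 : R).
  apply/cvg_pinftyP => u uoo.
  rewrite -[X in _ --> X](Rint_cst mu (0 : R)); apply: (Rint_dct (M := M + `|d|)).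
  - move=> n; apply: measurableT_comp => //; apply: measurable_funB => //.
    by have [] := bm_Pop mp (u n) bmg.
  - by move=> n x; rewrite normr_id (le_trans (ler_normB _ _))// lerD// Pop_bound.
  - move=> x; rewrite -(normr0 R) -(subrr d); apply: cvg_norm.
    apply: cvgB; last exact: cvg_cst.
    by have /cvg_pinftyP/(_ u uoo) := lip_cvg x bg.
have /cvgrPdist_le/(_ _ e3)[T [_ TP]] := cg.
exists (Num.max (T + 1) 0); first by rewrite le_max lexx orbT.
move=> t; rewrite ge_max => /andP[Tt t0].
have ht : \int[mu]_x `|P t g x - d| <= e / 3.
  have := TP t; rewrite /= sub0r normrN => h; apply: le_trans (ler_norm _) (h _).
  by rewrite (lt_le_trans _ Tt)// ltrDl.
have ifg : itg mu (fun x => f x - g x) by exact: itgB.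
have efg : ev_itg (fun x => f x - g x) by move=> s x s0; apply: itgB; [exact: ef|exact: eg].
have h1 : \int[mu]_x `|P t (fun y => f y - g y) x| <= e / 3.
  exact: le_trans (Pop_L1_contraction t0 ifg efg) ge.
have h2 : `|d - c| <= e / 3.
  rewrite distrC /c /d -RintegralB//; apply: le_trans ge; exact: le_normr_Rintegral.
have iPf := itg_Pop t0 imf ef; have iPg := itg_Pop t0 ig eg.
have iPfg := itg_Pop t0 ifg efg.
have ic (q : R) : itg mu (fun=> q) by exact/bm_itg/bm_cst.
apply: (@le_trans _ _ (\int[mu]_x (`|P t (fun y => f y - g y) x| + `|P t g x - d| + `|d - c|))).
  apply: Rint_le.
  - by apply/itg_norm/itgB.
  - by apply: itgD => //; apply: itgD; [exact: itg_norm|apply/itg_norm/itgB].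
  move=> x; have -> : P t (fun y => f y - g y) x = P t f x - P t g x.
    by apply: RintegralB => //; [exact: ef|exact: eg].
  rewrite -/c (_ : P t f x - c = (P t f x - P t g x) + (P t g x - d) + (d - c)); last first.
    by rewrite !subrKA.
  by rewrite (le_trans (ler_normD _ _))// lerD2r ler_normD.
have i1 : itg mu (fun x => `|P t (fun y => f y - g y) x|) by exact: itg_norm.
have i2 : itg mu (fun x => `|P t g x - d|) by apply/itg_norm/itgB.
rewrite RintegralD//; [|exact: itgD|exact: ic].
rewrite RintegralD// Rint_cst; lra.
Qed.

(* Mixing is tested against the set where all the [P_n |f|] are at most [M]. *)
Lemma inv_itg f : measurable_fun [set: XB] (f : XB -> R) -> ev_itg f ->
  (forall x, exists M : R, forall t, 0 <= t -> P t (fun y => `|f y|) x <= M) -> itg mu f.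
Proof.
move=> mf ef bdf.
pose nf y := `|f y|.
have enf : ev_itg nf by move=> s x s0; apply/itg_norm/ef.
have mPn n : measurable_fun [set: XB] (P n%:R nf) by apply: measurable_Pop => // x; exact: enf.
(* Integer times keep the intersection countable. All of them are included because the time supplied
   by mixing depends on the truncation level [K]. *)
pose E M : set XB := \bigcap_n [set u | P n%:R nf u <= M].
have mE M : measurable (E M).
  apply: bigcapT_measurable => n.
  have := measurable_fun_ler (mPn n) (@measurable_cst _ _ XB R setT M).
  by move/(_ measurableT [set true]); rewrite setTI => h; apply: h.
have [M ME] : exists M : nat, (0 < mu (E M%:R))%E.
  apply: contrapT => no.
  have : mu setT = 0%E.
    rewrite (_ : setT = \bigcup_(k : nat) E k%:R).
      apply/eqP; rewrite eq_le measure_ge0 andbT.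
      apply: (le_trans (measure_sigma_subadditive _ _ _ (@subset_refl _ _))) => //.
        exact: bigcup_measurable.
      rewrite eseries0// => k _ _; apply/eqP; rewrite eq_le measure_ge0 andbT leNgt.
      by apply/negP => kE; apply: no; exists k.
    apply/seteqP; split => // u _; have [K KP] := bdf u.
    exists (Num.truncn `|K|).+1 => // n _ /=; rewrite (le_trans (KP _ _))//.
    by rewrite (le_trans (ler_norm _))// ltW// Num.Theory.truncnS_gt.
  by rewrite probability_setT => /eqP; rewrite onee_eq0.
set b := fine (mu (E M%:R)).
have b0 : 0 < b by rewrite -lte_fin fineK// fin_num_measure.
pose g (K : nat) y := Num.min (nf y) K%:R.
have nf0 y : 0 <= nf y by exact: normr_ge0.
have g0 K y : 0 <= g K y by rewrite le_min nf0 ler0n.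
have mnf : measurable_fun [set: XB] nf by exact: measurableT_comp.
have bg K : bm (g K).
  split; first exact: measurable_minr.
  by exists K%:R => y; rewrite ger0_norm// ge_min lexx orbT.
(* On [E], of mass [b > 0], the function [P n (g K)] is at most [M], yet it is close to the mean [c]
   in [L^1]; thus [b * c <= b * (M + e)]. The bound is free of [K], so monotone convergence removes
   the truncation. *)
have gM K : \int[mu]_y g K y <= M%:R.
  have ig : itg mu (g K) by exact: bm_itg.
  have eg := bm_ev_itg (bg K).
  set c := \int[mu]_y g K y.
  apply/ler_addgt0Pr => e e0.
  have be : 0 < b * e by rewrite mulr_gt0.
  have [T T0 TP] := mixing ig eg be.
  pose n := (Num.truncn `|T|).+1.
  have Tn : T <= n%:R by rewrite (le_trans (ler_norm _))// ltW// Num.Theory.truncnS_gt.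
  have h := TP _ Tn; rewrite -/c in h.
  have bPg := bm_Pop mp n%:R (bg K).
  have bI : bm \1_(E M%:R) by exact: bm_indic.
  have h1 : \int[mu]_x (c * \1_(E M%:R) x) <=
     \int[mu]_x (M%:R * \1_(E M%:R) x + `|P n%:R (g K) x - c|).
    apply: Rint_le.
    - by apply/bm_itg/bmM => //; exact: bm_cst.
    - apply/bm_itg/bmD; first by apply: bmM => //; exact: bm_cst.
      by apply/bm_norm/bmB => //; exact: bm_cst.
    move=> x; rewrite indicE; case: (boolP (x \in E M%:R)) => [|_]; last first.
      by rewrite !mulr0 add0r normr_ge0.
    rewrite inE !mulr1 => Ex.
    have : P n%:R (g K) x <= M%:R.
      apply: le_trans (Ex n I); apply: Rint_le; [exact: bm_itg|exact: enf|].
      by move=> y; rewrite ge_min lexx.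
    have := ler_norm (c - P n%:R (g K) x); rewrite distrC; lra.
  move: h1; rewrite RintegralD//; last 2 first.
  - by apply/bm_itg/bmM => //; exact: bm_cst.
  - by apply/bm_itg/bm_norm/bmB => //; exact: bm_cst.
  rewrite !RintegralZl//; [|exact: bm_itg..].
  rewrite Rint_indic// -/b => h1.
  have : b * c <= b * (M%:R + e) by rewrite mulrDr; lra.
  by rewrite ler_pM2l.
apply/integrableP; split; first exact/measurable_EFinP.
apply: (@le_lt_trans _ _ (M%:R)%:E); last exact: ltry.
have cvgm : (\int[mu]_x (g K x)%:E)%E @[K --> \oo] --> (\int[mu]_x (nf x)%:E)%E.
  rewrite (_ : (\int[mu]_x (nf x)%:E)%E = (\int[mu]_x (limn (fun K => (g K x)%:E)))%E); last first.
    apply: eq_integral => x _; apply/esym/cvg_lim => //.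
    apply: cvg_near_cst; exists (Num.truncn (nf x)).+1 => // K /= nK.
    rewrite /g min_l// ltW// (lt_le_trans (Num.Theory.truncnS_gt _))// ler_nat.
    exact: nK.
  apply: cvg_monotone_convergence => //.
  - by move=> K; apply/measurable_EFinP; have [] := bg K.
  - by move=> K x _; rewrite lee_fin.
  - move=> x _ K K' KK'; rewrite lee_fin /g le_min ge_min lexx/=.
    by rewrite ge_min ler_nat KK' orbT.
rewrite -(cvg_lim _ cvgm)//; apply: lime_le; first by apply/cvg_ex; eexists; exact: cvgm.
apply: nearW => K; have fg : (\int[mu]_x (g K x)%:E \is a fin_num)%E.
  by apply: integrable_fin_num => //; exact: bm_itg.
by rewrite -(fineK fg) lee_fin; exact: gM.
Qed.

(** Because the threshold in [ev_cont] depends on [u], one point [u] near [z] must be good at all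
    the bad times [t n] at once. Mixing makes the exceptional sets summable with total mass below
    that of the ball, so such a [u] exists. *)
Lemma ev_cont_cvg f z : itg mu f -> ev_itg f -> lower_bd p z -> ev_cont p f z ->
  forall e, 0 < e -> exists T : R, forall t, T <= t -> `|P t f z - \int[mu]_y f y| <= e.
Proof.
move=> imf ef lbz ecf e0 e00; set c := \int[mu]_y f y.
pose e := e0 / 2; have e_gt0 : 0 < e by rewrite divr_gt0.
have [r r0 rP] := ecf _ e_gt0.
set B : set X := [set y | mdist z y < r].
have mB : measurable (B : set XB) by apply: borel_open; exact: open_mball.
have b0 : (0 < mu B)%E.
  have r2 : 0 < r / 2 by rewrite divr_gt0.
  have [a a0 /(_ z)[T TP]] := lbz _ r2.
  set C : set X := [set y | mdist z y < r / 2] in TP.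
  have mC : measurable (C : set XB) by apply: borel_open; exact: open_mball.
  have bl : bounded_lipschitz (bump C (r / 2)) by exact: bump_bounded_lipschitz.
  have bmb : bm (bump C (r / 2)) by exact: bounded_lipschitz_bm.
  have ha : a <= \int[mu]_y bump C (r / 2) y.
    have cl := lip_cvg z bl; rewrite -(cvg_lim _ cl)//.
    apply: limr_ge; first by apply/cvg_ex; eexists; exact: cl.
    near=> t; apply: (@le_trans _ _ (P t \1_C z)).
      by apply: TP; near: t; exact: nbhs_pinfty_ge (num_real T).
    apply: Pop_le => //; first exact: bm_indic.
    move=> y; rewrite indicE; case: (boolP (y \in C)); rewrite ?inE => Cy.
      by rewrite bump1.
    exact: bump_ge0.
  have hB : \int[mu]_y bump C (r / 2) y <= fine (mu B).
    rewrite -Rint_indic//; apply: Rint_le; [exact: bm_itg|exact/bm_itg/bm_indic|].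
    move=> y; have [|y0] := leP (bump C (r / 2) y) 0; first by move/le_trans; apply; rewrite indicE.
    have [v Cv yv] := bump_gt0 r2 y0.
    rewrite indicE mem_set; first exact: bump_le1.
    rewrite /B /= (le_lt_trans (metric_triangle z v y))// [ltRHS]splitr ltrD//.
    by rewrite metric_sym.
  rewrite -[mu B]fineK ?fin_num_measure// lte_fin.
  by apply: lt_le_trans a0 _; exact: le_trans ha hB.
set b := fine (mu B).
have bE : mu B = b%:E by rewrite fineK// fin_num_measure.
have b_gt0 : 0 < b by rewrite -lte_fin -bE.
apply: contrapT => /forallNP no.
(* By Markov's inequality this [L^1] accuracy gives [Bad n] mass at most [b / 2 / 2 ^ n.+1]; the
   total [b / 2] is less than [mu B = b]. *)
have en (n : nat) : 0 < e * (b / 2 / (2 ^ n.+1)%:R).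
  by rewrite mulr_gt0// divr_gt0// ?divr_gt0// ltr0n expn_gt0.
have /choice[t tP] : forall n : nat, exists t : R, [/\ n%:R <= t, e0 < `|P t f z - c| &
    \int[mu]_x `|P t f x - c| <= e * (b / 2 / (2 ^ n.+1)%:R)].
  move=> n; have [T T0 TP] := mixing imf ef (en n).
  have /existsNP[t /not_implyP[]] := no (Num.max n%:R T).
  rewrite ge_max => /andP[nt Tt] /negP; rewrite -ltNge => lt.
  by exists t; split => //; exact: TP.
have t0 n : 0 <= t n by have [nt _ _] := tP n; exact: le_trans nt.
pose Bad n : set XB := [set u | e < `|P (t n) f u - c|].
have iD n : itg mu (fun x => `|P (t n) f x - c|).
  by apply/itg_norm/itgB; [exact: itg_Pop|exact/bm_itg/bm_cst].
have mBad n : measurable (Bad n).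
  have := measurable_fun_ltr (@measurable_cst _ _ XB R setT e) (itg_measurable (iD n)).
  by move/(_ measurableT [set true]); rewrite setTI => h; apply: h.
have BadE n : (mu (Bad n) <= (b / 2 / (2 ^ n.+1)%:R)%:E)%E.
  have [_ _ h] := tP n.
  rewrite -[leLHS]fineK ?fin_num_measure// lee_fin -(ler_pM2l e_gt0).
  apply: le_trans h; rewrite -Rint_indic// -RintegralZl//; last exact/bm_itg/bm_indic.
  apply: Rint_le => //; first by apply/bm_itg/bmM; [exact: bm_cst|exact: bm_indic].
  move=> x; rewrite indicE; case: (boolP (x \in Bad n)); rewrite ?inE => Bx.
    by rewrite mulr1 ltW.
  by rewrite mulr0.
have [u Bu nBad] : exists2 u, B u & forall n, ~ Bad n u.
  apply: contrapT => no2.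
  have sub : (B : set XB) `<=` \bigcup_n Bad n.
    move=> u Bu; apply: contrapT => nu; apply: no2; exists u => // n Bn.
    by apply: nu; exists n.
  have := measure_sigma_subadditive mu mBad mB sub.
  rewrite [leLHS]bE leNgt; apply/negP; rewrite negbK.
  apply: (@le_lt_trans _ _ (\sum_(0 <= n <oo) (b / 2 / (2 ^ n.+1)%:R)%:E)%E).
    by apply: lee_nneseries => // n _; exact: BadE.
  apply: (le_lt_trans (epsilon_trick0 _ _)); first by rewrite divr_ge0// ltW.
  by rewrite lte_fin ltr_pdivrMr// mulr_natr mulr2n ltrDl.
have [T TP] := rP u Bu.
pose n := (Num.truncn `|T|).+1.
have [nt lt _] := tP n.
have Tt : T <= t n.
  by rewrite (le_trans _ nt)// (le_trans (ler_norm _))// ltW// Num.Theory.truncnS_gt.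
have h1 := TP _ Tt; have /negP := nBad n; rewrite -leNgt => h2.
move: lt; apply/negP; rewrite -leNgt.
rewrite (_ : P (t n) f z - c = - (P (t n) f u - P (t n) f z) + (P (t n) f u - c)); last by ring.
rewrite (le_trans (ler_normD _ _))// normrN [leRHS]splitr; exact: lerD.
Unshelve. all: by end_near. Qed.

End mixing.

(** * Uniformly integrable observables *)

Section restriction.
Context d (T : measurableType d) (R : realType).

(** The restriction is built as the mixture of [M] with the kernel sending [v] to the Dirac mass if
    [v] is in [D] and to zero otherwise, so that the formulas for mixtures give its integrals. *)
Lemma exists_restriction (M : giry T R) (D : set T) : measurable D ->
  exists m : giry T R, forall g : T -> R, itg M g -> itg m g /\
    \int[m]_y g y = \int[M]_y (g y * \1_D y).
Proof.
move=> mD; pose k v : giry T R := if v \in D then giry_ret v else mzero.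
have kE v (A : set T) : k v A = (\1_D v * \1_A v)%:E.
  rewrite /k indicE; case: ifPn => _; last by rewrite mul0r.
  by rewrite mul1r /giry_ret/= diracE indicE.
have mk A : measurable A -> measurable_fun [set: T] (k ^~ A).
  move=> mA; under eq_fun do rewrite kE.
  by apply/measurable_EFinP; apply: measurable_funM; exact: measurable_indic.
have mk' := measurable_giry_codensity measurableT mk.
have mE A : measurable A -> giry_bind M mk' A = (\int[M]_v k v A)%E.
  by move=> mA; rewrite [LHS]giry_int_map//; exact: measurable_giry_ev.
have kg (g : T -> R) v : measurable_fun [set: T] g -> itg (k v) g /\
    \int[k v]_y g y = g v * \1_D v.
  move=> mg; have mEg : measurable_fun setT (EFin \o g) by exact/measurable_EFinP.
  rewrite /k indicE /itg /Rintegral; case: ifPn => _.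
    split; last by rewrite integral_dirac// diracT mul1e mulr1.
    apply/integrableP; split => //; rewrite integral_dirac//; last exact: measurableT_comp.
    by rewrite diracT mul1e ltry.
  split; last by rewrite integral_measure_zero mulr0.
  by apply/integrableP; split => //; rewrite integral_measure_zero.
exists (giry_bind M mk') => g ig; have mg := itg_measurable ig.
have ikg v : itg (k v) g by have [] := kg g v mg.
have ib : itg (giry_bind M mk') g.
  apply: (itg_of_bind mk mE) => //.
  rewrite (_ : (fun _ => _) = fun v => `|g v| * \1_D v).
    exact/itg_mul_indic/itg_norm.
  apply/funext => v; have [|_ ->//] := kg (fun y => `|g y|) v.
  exact: measurableT_comp.
split => //; rewrite (Rint_bind mk mE)//; apply: eq_Rintegral => v _.
by have [] := kg g v mg.
Qed.

End restriction.

Section convergence.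
Context (R : realType) (X : metricType R) (x0 : X).
Local Notation XB := (borel_of x0).
Variable p : R -> XB -> probability XB R.
Local Notation P := (Pop p).
Local Notation bm := (@bounded_measurable _ XB R).
Local Notation ev_itg := (ev_itg p).
Hypothesis mp : forall t A, measurable A -> measurable_fun [set: XB] (fun x => p t x A).
Hypothesis CK : forall s t x A, 0 <= s -> 0 <= t -> measurable A ->
  p (s + t) x A = (\int[p s x]_u p t u A)%E.

Lemma ev_itg_Pop t g : 0 <= t -> ev_itg g -> ev_itg (P t g).
Proof.
move=> t0 eg s u s0.
apply: (@itg_bind _ _ XB XB R (p s u) (p t) (p (s + t) u) (mp t)).
- by move=> A mA; exact: CK.
- by apply: eg; rewrite addr_ge0.
- by move=> v; exact: eg.
Qed.

Lemma ev_itg_norm g : ev_itg g -> ev_itg (fun y => `|g y|).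
Proof. by move=> eg t y t0; apply/itg_norm/eg. Qed.

Lemma ev_itg_measurable g : ev_itg g -> measurable_fun [set: XB] (g : XB -> R).
Proof. by move=> eg; exact: itg_measurable (eg 0 x0 (lexx 0)). Qed.

Variable f : X -> R.
Hypothesis ef : ev_itg f.
Let tailf (K : R) (y : X) := `|f y| * \1_[set y | K <= `|f y|] y.
Hypothesis UI : forall x e, 0 < e -> exists2 K : R, 0 <= K &
  forall t, 0 <= t -> P t (tailf K) x <= e.
Variable x : X.

(** The inequality [m <= P_S(x, .)] in tested form, integrability included: [m] is a piece of the
    law at time [S] from [x]. *)
Definition dominated (m : giry XB R) (S : R) := forall g : X -> R,
  (forall y, 0 <= g y) -> ev_itg g -> itg m g /\ \int[m]_y g y <= P S g x.

Let mtail K : measurable ([set y | K <= `|f y|] : set XB).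
Proof.
have mf : measurable_fun [set: XB] (fun y => `|f y|).
  by apply: measurableT_comp => //; exact: ev_itg_measurable.
have := measurable_fun_ler (@measurable_cst _ _ XB R setT K) mf.
by move/(_ measurableT [set true]); rewrite setTI => h; apply: h.
Qed.

Let ev_tail K : ev_itg (tailf K).
Proof. by move=> t y t0; apply: itg_mul_indic => //; apply: ev_itg_norm. Qed.

Let tail_ge0 K y : 0 <= tailf K y.
Proof. by rewrite mulr_ge0// indicE. Qed.

Let le_tail K y : 0 <= K -> `|f y| <= K + tailf K y.
Proof.
move=> K0; rewrite /tailf indicE; case: (boolP (y \in _)); rewrite ?inE /= => h.
  by rewrite mulr1 lerDr.
by rewrite mulr0 addr0 ltW// ltNge; apply/negP => h'; move: h; rewrite mem_set.
Qed.

Let Pnorm_tail K t u : 0 <= K -> 0 <= t -> `|P t f u| <= K + P t (tailf K) u.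
Proof.
move=> K0 t0; apply: (le_trans (Pop_norm (ef u t0))).
rewrite -[X in X + _](Pop_cst p t K u) -RintegralD//; [|exact/bm_itg/bm_cst|exact: ev_tail].
apply: Rint_le; [exact: ev_itg_norm|by apply: itgD; [exact/bm_itg/bm_cst|exact: ev_tail]|].
by move=> y; exact: le_tail.
Qed.

Lemma dominated_itg m S g : dominated m S -> ev_itg g -> itg m g.
Proof.
move=> dm eg; have [|h _] := dm (fun y => `|g y|) _ (ev_itg_norm eg); first by [].
by apply: le_itg h _ => //; exact: ev_itg_measurable.
Qed.

(* Egorov-type step, by dominated convergence of truncations; the tails are
   controlled by uniform integrability along the path started at [x]. *)
Lemma dominated_limit (M : giry XB R) S (B : set X) (c e : R) : 0 <= S -> dominated M S ->
  measurable (B : set XB) -> 0 <= e ->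
  (forall u, B u -> exists T : R, forall t, T <= t -> `|P t f u - c| <= e) ->
  forall d, 0 < d -> exists T : R, forall t, T <= t ->
   `|\int[M]_u ((P t f u - c) * \1_B u)| <= e * \int[M]_u \1_B u + d.
Proof.
move=> S0 dM mB e0 Bc d d0; apply: contrapT => /forallNP no.
have bB : bm \1_B by exact: bm_indic.
have d2 : 0 < d / 2 by rewrite divr_gt0.
have [K K0 KP] := UI x d2.
have /choice[t tP] : forall n : nat, exists t : R, n%:R <= t /\
    e * \int[M]_u \1_B u + d < `|\int[M]_u ((P t f u - c) * \1_B u)|.
  move=> n; have /existsNP[t /not_implyP[nt /negP]] := no n%:R.
  by rewrite -ltNge => h; exists t.
have t0 n : 0 <= t n by have [nt _] := tP n; exact: le_trans nt.
pose q := K + `|c|; have q0 : 0 <= q by rewrite addr_ge0.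
pose h n (u : X) := `|P (t n) f u - c| * \1_B u.
(* The minimum with [q] bounds the integrand and the maximum makes it converge. The excess of [h n]
   over [q = K + |c|] is at most [P (t n) (tailf K)], whose integral against [M] is controlled at
   [x]. *)
pose k n (u : X) := Num.max (Num.min (h n u) q) (e * \1_B u).
have eP n : ev_itg (P (t n) f) by exact: ev_itg_Pop.
have ec : ev_itg (fun=> c) by apply: bm_ev_itg; exact: bm_cst.
have iPc n : itg M (fun u => P (t n) f u - c).
  by apply: itgB; [exact: dominated_itg dM (eP n)|exact: dominated_itg dM ec].
have ih n : itg M (h n) by apply: itg_mul_indic => //; exact: itg_norm.
have h0 n u : 0 <= h n u by rewrite mulr_ge0// indicE.
have I01 u : 0 <= (\1_B u : R) <= 1 by rewrite indicE; case: (_ \in _); rewrite ?lexx ?ler01.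
have kb n u : `|k n u| <= q + e.
  have /andP[i0 i1] := I01 u.
  have e1 : 0 <= e * \1_B u by rewrite mulr_ge0.
  rewrite ger0_norm; last by rewrite le_max e1 orbT.
  rewrite ge_max; apply/andP; split; first by rewrite ge_min lerDl e0 orbT.
  by rewrite -[leLHS]add0r lerD// ler_piMr.
have mk n : measurable_fun [set: XB] (k n).
  apply: measurable_maxr.
    by apply: measurable_minr => //; exact: itg_measurable (ih n).
  by apply: measurable_funM => //; have [] := bB.
have ck : (fun n => \int[M]_u k n u) @ \oo --> e * \int[M]_u \1_B u.
  rewrite -RintegralZl//; last exact: bm_itg.
  apply: (Rint_dct (M := q + e)) => // u.
  apply: cvg_near_cst; rewrite /k /h indicE; case: (boolP (u \in B)) => [|_]; last first.
    by apply: nearW => n; rewrite !mulr0 min_l// maxxx.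
  rewrite inE => /Bc[T TP]; near=> n; rewrite !mulr1 max_r//.
  rewrite ge_min TP//; have [nt _] := tP n; apply: le_trans nt; near: n.
  exact: nbhs_infty_ger.
have /cvgrPdist_lt/(_ _ d2)[n _ /(_ n (leqnn n)) /=] := ck.
rewrite ltr_distlC => /andP[_ kn].
have [_ tn] := tP n; move: tn; apply/negP; rewrite -leNgt.
have etl : ev_itg (P (t n) (tailf K)) by exact: ev_itg_Pop.
have tl0 u : 0 <= P (t n) (tailf K) u by apply: Rintegral_ge0 => y _; exact: tail_ge0.
have [itl tle] := dM _ tl0 etl.
have ik : itg M (k n) by apply: bm_itg; split => //; exists (q + e) => u; exact: kb.
apply: (@le_trans _ _ (\int[M]_u h n u)).
  apply: (le_trans (le_normr_Rintegral _ _)) => //; first exact: itg_mul_indic.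
  apply: Rint_le => //; first by apply/itg_norm/itg_mul_indic.
  by move=> u; have /andP[i0 _] := I01 u; rewrite normrM /h ler_wpM2l// ger0_norm.
apply: (@le_trans _ _ (\int[M]_u (k n u + P (t n) (tailf K) u))).
  apply: Rint_le => //; first exact: itgD.
  move=> u; have [hq|hq] := leP (h n u) q.
    by rewrite -[leLHS]addr0 lerD// /k min_l// le_max lexx.
  apply: (@le_trans _ _ (q + P (t n) (tailf K) u)).
    have /andP[i0 i1] := I01 u.
    apply: (@le_trans _ _ (`|P (t n) f u - c|)); first by rewrite /h ler_piMr.
    rewrite (le_trans (ler_normB _ _))// /q addrAC lerD2r.
    exact: Pnorm_tail.
  by rewrite lerD2r /k (min_r (ltW hq)) le_max lexx.
rewrite RintegralD//.
have : P S (P (t n) (tailf K)) x <= d / 2.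
  rewrite -(PopD mp CK)//; last by move=> *; exact: ev_tail.
  by apply: KP; rewrite addr_ge0.
by move: kn tle; lra.
Unshelve. all: by end_near. Qed.

(** Lets the piece [m] evolve for a further time [T]; Chapman-Kolmogorov keeps it below the law at
    time [S + T]. *)
Lemma dominated_bind (m : giry XB R) S T : 0 <= S -> 0 <= T -> dominated m S ->
  exists M : giry XB R, dominated M (S + T) /\
    forall g, ev_itg g -> \int[M]_y g y = \int[m]_y P T g y.
Proof.
move=> S0 T0 dm.
have mk := @measurable_giry_codensity _ XB _ XB R setT (p T : XB -> giry XB R) measurableT (mp T).
have ME B : measurable B -> giry_bind m mk B = (\int[m]_u p T u B)%E.
  by move=> mB; rewrite [LHS]giry_int_map//; exact: measurable_giry_ev.
have iM g : ev_itg g -> itg (giry_bind m mk) g.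
  move=> eg; apply: (@itg_of_bind _ _ XB XB R m (p T) _ (mp T) ME).
  - exact: ev_itg_measurable.
  - by move=> v; exact: eg.
  - have eng : ev_itg (P T (fun y => `|g y|)) by apply/ev_itg_Pop/ev_itg_norm.
    exact: dominated_itg dm eng.
have IM g : ev_itg g -> \int[giry_bind m mk]_y g y = \int[m]_y P T g y.
  move=> eg; apply: (@Rint_bind _ _ XB XB R m (p T) _ (mp T) ME); first exact: iM.
  by move=> u; exact: eg.
exists (giry_bind m mk); split => // g g0 eg; split; first exact: iM.
rewrite IM// (PopD mp CK)//.
have [|_ ->//] := dm (P T g) _ (ev_itg_Pop T0 eg).
by move=> y; apply: Rintegral_ge0.
Qed.

Variables (z : X) (c : R).
Hypothesis cvz : forall e, 0 < e -> exists T : R, forall t, T <= t -> `|P t f z - c| <= e.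
Hypothesis ecf : ev_cont p f z.
Hypothesis lbz : lower_bd p z.

Let bmass (m : giry XB R) := \int[m]_y (1 : R).

(* At suitable times a fixed fraction of the remaining mass [m] sits in [B], where
   the limit is known up to [e]; this part is removed from [m]. *)
Lemma peeling (B : set X) (a e : R) : measurable (B : set XB) -> 0 <= e -> 0 < a -> a <= 1 ->
  (forall u, B u -> exists T : R, forall t, T <= t -> `|P t f u - c| <= e) ->
  (forall u, exists T : R, forall t, T <= t -> a <= P t \1_B u) ->
  forall n, exists (S : R) (m : giry XB R), [/\ 0 <= S, dominated m S,
    bmass m <= (1 - a / 2) ^+ n & forall d, 0 < d -> exists T : R, forall t, T <= t ->
    `|P (S + t) f x - \int[m]_u P t f u - c * (1 - bmass m)| <= e * (1 - bmass m) + d].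
Proof.
move=> mB e0 a0 a1 Bc lb; elim=> [|n [S [m [S0 dm mn lim]]]].
  exists 0, (p 0 x : giry XB R); split => //.
  - by move=> g g0 eg; split => //; exact: eg.
  - by rewrite /bmass Rint_cst expr0.
  move=> d d0; exists 0 => t t0.
  rewrite (PopD mp CK)//.
  rewrite /bmass Rint_cst !subrr mulr0 subrr normr0 mulr0 add0r.
  exact: ltW.
have bB : bm \1_B by exact: bm_indic.
have eB : ev_itg \1_B by exact: bm_ev_itg.
have e1 : ev_itg (fun=> 1) by apply: bm_ev_itg; exact: bm_cst.
have m0 : 0 <= bmass m by apply: Rintegral_ge0.
(* The fraction [a] is reached from each [u] only after a time depending on [u]. Bounded convergence
   yields it in the limit for the whole of [m], hence half of it at one fixed time. *)
have [T T0 TP] : exists2 T : R, 0 <= T & a / 2 * bmass m <= \int[m]_u P T \1_B u.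
  have PB0 t u : 0 <= P t \1_B u by apply: Rintegral_ge0 => y _; rewrite indicE.
  move: m0; rewrite le_eqVlt => /predU1P[m0|m0].
    exists 0 => //; rewrite -m0 mulr0; exact: Rintegral_ge0.
  have ck : (fun n : nat => \int[m]_u Num.min (P n%:R \1_B u) a) @ \oo --> a * bmass m.
    rewrite /bmass -RintegralZl//; last exact/bm_itg/bm_cst.
    apply: (Rint_dct (M := a)).
    - by move=> k; apply: measurable_minr => //; have [] := bm_Pop mp k%:R bB.
    - move=> k u; rewrite ger0_norm; last by rewrite le_min PB0 ltW.
      by rewrite ge_min lexx orbT.
    move=> u; apply: cvg_near_cst; have [T TP] := lb u; near=> k.
    rewrite mulr1 min_r// TP//; near: k; exact: nbhs_infty_ger.
  have am : 0 < a / 2 * bmass m by rewrite !mulr_gt0.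
  have /cvgrPdist_le/(_ _ am)[k _ /(_ k (leqnn k)) /=] := ck.
  rewrite ler_distlC => /andP[h _]; exists k%:R => //.
  apply: (@le_trans _ _ (\int[m]_u Num.min (P k%:R \1_B u) a)); first lra.
  have bPB := bm_Pop mp k%:R bB.
  apply: Rint_le; [|exact: bm_itg|by move=> u; rewrite ge_min lexx].
  apply: bm_itg; split; first by apply: measurable_minr => //; have [] := bPB.
  exists a => u; rewrite ger0_norm; last by rewrite le_min PB0 ltW.
  by rewrite ge_min lexx orbT.
have [M [dM IM]] := dominated_bind S0 T0 dm.
(* The new remainder is the evolved mass outside [B]; the part in [B] is settled by
   [dominated_limit]. *)
have [m' m'P] := exists_restriction M (measurableC mB).
have ST0 : 0 <= S + T by rewrite addr_ge0.
have indC u : (\1_(~` B) u : R) = 1 - \1_B u.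
  by rewrite !indicE in_setC; case: (u \in B); rewrite ?subrr ?subr0.
have iM g : ev_itg g -> itg M g by move=> eg; exact: dominated_itg dM eg.
have m'E g : ev_itg g -> \int[m']_u g u = \int[M]_u g u - \int[M]_u (g u * \1_B u).
  move=> eg; have ig := iM g eg; have [_ ->] := m'P g ig.
  rewrite -RintegralB//; last exact: itg_mul_indic.
  by apply: eq_Rintegral => u _; rewrite indC mulrBr mulr1.
have MB : \int[M]_u \1_B u = \int[m]_u P T \1_B u by exact: IM.
have M1 : bmass M = bmass m.
  by rewrite /bmass IM//; apply: eq_Rintegral => u _; rewrite Pop_cst.
have m'1 : bmass m' = bmass m - \int[M]_u \1_B u.
  rewrite /bmass (m'E (fun=> 1) e1) -/(bmass M) M1; congr (_ - _).
  by apply: eq_Rintegral => u _; rewrite mul1r.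
exists (S + T), m'; split => //.
- move=> g g0 eg; have ig := iM g eg; have [ig' E'] := m'P g ig; split => //.
  have [_ le] := dM g g0 eg; apply: le_trans le; rewrite E'.
  apply: Rint_le => //; first by apply: itg_mul_indic => //; exact: measurableC.
  by move=> u; apply: ler_piMr => //; rewrite indicE; case: (u \in _); rewrite ?ler01.
- rewrite m'1 exprS MB.
  apply: (@le_trans _ _ ((1 - a / 2) * bmass m)); first lra.
  by rewrite ler_wpM2l//; lra.
move=> d d0; have d2 : 0 < d / 2 by rewrite divr_gt0.
have [T1 T1P] := lim _ d2.
have [T2 T2P] := dominated_limit ST0 dM mB e0 Bc d2.
exists (Num.max 0 (Num.max T1 T2)) => t; rewrite !ge_max => /andP[t0 /andP[t1 t2]].
have h1 := T1P (T + t) ltac:(by rewrite (le_trans t1)// lerDr).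
have h2 := T2P t t2.
have ePt : ev_itg (P t f) by exact: ev_itg_Pop.
have E1 : \int[m]_u P (T + t) f u = \int[M]_u P t f u.
  rewrite IM//; apply: eq_Rintegral => u _; by apply: (PopD mp CK).
have E2 : \int[M]_u ((P t f u - c) * \1_B u) =
    \int[M]_u (P t f u * \1_B u) - c * \int[M]_u \1_B u.
  rewrite -RintegralZl//; last exact: iM.
  rewrite -RintegralB//; [|by apply: itg_mul_indic => //; exact: iM|exact/itgZ/iM].
  by apply: eq_Rintegral => u _; rewrite mulrBl.
rewrite m'1 (m'E _ ePt) -(addrA S T t).
move: h1 h2; rewrite E1 E2 !ler_norml => /andP[a2 a3] /andP[a4 a5].
apply/andP; split; lra.
Unshelve. all: by end_near. Qed.

(** After enough peelings the remainder has tiny mass, and uniform integrability bounds its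
    contribution by [K] times that mass plus [d]. The errors are [d + d] from [B], [d] from the
    peeling, [d] from the tail and [d] from the remaining mass: five, within the six available. *)
Lemma ui_cvg e : 0 < e -> exists T : R, forall t, T <= t -> `|P t f x - c| <= e.
Proof.
move=> e'0; pose d := e / 6; have d0 : 0 < d by rewrite divr_gt0.
have [r r0 rP] := ecf d0.
set B : set X := [set y | mdist z y < r] in rP.
have mB : measurable (B : set XB) by apply: borel_open; exact: open_mball.
have [a a0 aP] := lbz r0; rewrite -/B in aP.
have a1 : a <= 1.
  have [T TP] := aP z; apply: (le_trans (TP T (lexx T))).
  rewrite -(Pop_cst p T 1 z); apply: Pop_le; [exact: bm_indic|exact: bm_cst|].
  by move=> y; rewrite indicE; case: (_ \in _); rewrite ?ler01.
have Bc u : B u -> exists T : R, forall t, T <= t -> `|P t f u - c| <= d + d.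
  move=> Bu; have [T1 T1P] := rP u Bu; have [T2 T2P] := cvz d0.
  exists (Num.max T1 T2) => t; rewrite ge_max => /andP[/T1P h1 /T2P h2].
  by rewrite -(subrKA (P t f z)) (le_trans (ler_normD _ _))// lerD.
have [K K0 KP] := UI x d0.
(* The remainder enters with weight [K + |c|]; the added [1] only makes [q] positive for the
   division. *)
pose q := K + `|c| + 1; have q0 : 0 < q by rewrite ltr_wpDl// addr_ge0.
have [n nP] : exists n : nat, (1 - a / 2) ^+ n <= d / q.
  have cv : (fun n : nat => (1 - a / 2) ^+ n) @ \oo --> (0 : R).
    by apply: cvg_expr; rewrite ger0_norm; lra.
  have dq : 0 < d / q by rewrite divr_gt0.
  have /cvgrPdist_le/(_ _ dq)[n _ /(_ n (leqnn n)) /=] := cv.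
  by rewrite sub0r normrN => h; exists n; exact: le_trans (ler_norm _) h.
have dd0 : 0 <= d + d by rewrite addr_ge0// ltW.
have [S [m [S0 dm mn lim]]] := peeling mB dd0 a0 a1 Bc aP n.
have [T TP] := lim d d0.
exists (S + Num.max T 0) => t Tt.
pose s := t - S; have sT : Num.max T 0 <= s by rewrite /s lerBrDl.
have [s1 s0] : T <= s /\ 0 <= s by move: sT; rewrite ge_max => /andP[].
have := TP s s1; rewrite (_ : S + s = t); last by rewrite /s addrC subrK.
have m0 : 0 <= bmass m by apply: Rintegral_ge0.
have eN : ev_itg (P s f) by exact: ev_itg_Pop.
have eT : ev_itg (P s (tailf K)) by exact: ev_itg_Pop.
have T0 u : 0 <= P s (tailf K) u by apply: Rintegral_ge0 => y _; exact: tail_ge0.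
have [iT lT] := dm _ T0 eT.
have e1 : ev_itg (fun=> 1) by apply: bm_ev_itg; exact: bm_cst.
have i1 : itg m (fun=> 1) := dominated_itg dm e1.
have h1 : `|\int[m]_u P s f u| <= K * bmass m + d.
  have iN := dominated_itg dm eN.
  apply: (le_trans (le_normr_Rintegral _ iN)) => //.
  apply: (@le_trans _ _ (\int[m]_u (K * 1 + P s (tailf K) u))).
    apply: Rint_le; [exact: itg_norm|by apply: itgD => //; exact: itgZ|].
    by move=> u; rewrite mulr1; exact: Pnorm_tail.
  rewrite RintegralD//; last exact: itgZ.
  rewrite RintegralZl// lerD2l (le_trans lT)// -(PopD mp CK)//; last by move=> *; exact: ev_tail.
  by apply: KP; rewrite addr_ge0.
have h2 : (K + `|c|) * bmass m <= d.
  apply: (@le_trans _ _ (q * bmass m)); first by rewrite ler_wpM2r// lerDl.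
  apply: (@le_trans _ _ (q * (d / q))); first by rewrite ler_pM2l// (le_trans mn).
  by rewrite mulrCA divff ?mulr1// gt_eqF.
have h3 : `|c * bmass m| = `|c| * bmass m by rewrite normrM (ger0_norm m0).
have h4 : (d + d) * (1 - bmass m) <= d + d.
  by rewrite ler_piMr// gerBl.
move=> h5; have de : e = d + d + d + d + d + d by rewrite /d; lra.
rewrite (_ : P t f x - c = (P t f x - \int[m]_u P s f u - c * (1 - bmass m)) +
   (\int[m]_u P s f u - c * bmass m)); last by ring.
apply: (le_trans (ler_normD _ _)).
have := ler_normB (\int[m]_u P s f u) (c * bmass m); rewrite h3.
by move: h2; rewrite mulrDl; lra.
Qed.

End convergence.

(** * The equivalence *)

Section limsup.
Context (R : realType).
Local Open Scope ereal_scope.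

Lemma limf_esup_lt (T : topologicalType) (g : T -> \bar R) (F : set_system T) y :
  limf_esup g F < y -> exists2 V, F V & forall x, V x -> g x < y.
Proof.
rewrite limf_esupE => /ereal_inf_lt[_ [V FV <-] supV]; exists V => // x Vx.
by apply: le_lt_trans supV; apply: ereal_sup_ubound; exists x.
Qed.

Lemma limf_esup_le (T : topologicalType) (g : T -> \bar R) (F : set_system T) y :
  F [set x | g x <= y] -> limf_esup g F <= y.
Proof.
move=> Fy; rewrite limf_esupE; apply: ge_ereal_inf; exists (ereal_sup (g @` [set x | g x <= y])).
  by exists [set x | g x <= y].
by apply: ge_ereal_sup => _ [x gx <-].
Qed.

Lemma limf_einf_gt (T : topologicalType) (g : T -> \bar R) (F : set_system T) y :
  y < limf_einf g F -> exists2 V, F V & forall x, V x -> y < g x.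
Proof.
rewrite limf_einfE => /ereal_sup_gt[_ [V FV <-] infV]; exists V => // x Vx.
by apply: lt_le_trans infV _; apply: ereal_inf_lbound; exists x.
Qed.

Lemma limf_einf_ge (T : topologicalType) (g : T -> \bar R) (F : set_system T) y :
  F [set x | y <= g x] -> y <= limf_einf g F.
Proof.
move=> Fy; rewrite limf_einfE; apply: le_ereal_sup_tmp; exists (ereal_inf (g @` [set x | y <= g x])).
  by exists [set x | y <= g x].
by apply: le_ereal_inf_tmp => _ [x gx <-].
Qed.

Lemma ereal_gt0_ex (y : \bar R) : 0 < y -> exists2 a : R, (0 < a)%R & a%:E < y.
Proof.
case: y => [r r0|_|//]; last by exists 1%R => //; rewrite ltry.
exists (r / 2)%R; first by rewrite divr_gt0.
by rewrite lte_fin ltr_pdivrMr// mulr_natr mulr2n ltrDl.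
Qed.

End limsup.

Section pushforward_probability.
Context d1 d2 (T1 : measurableType d1) (T2 : measurableType d2) (R : realType).
Variables (m : probability T1 R) (f : T1 -> T2) (mf : measurable_fun [set: T1] f).

Let image := pushforward m f.

Let image0 : image set0 = 0%E. Proof. exact: measure0. Qed.
Let image_ge0 A : (0 <= image A)%E. Proof. exact: measure_ge0. Qed.
Let image_sigma : semi_sigma_additive image.
Proof.
move=> F mF tF mUF; rewrite /image /pushforward preimage_bigcup.
apply: measure_semi_sigma_additive.
- by move=> n; rewrite -[X in measurable X]setTI; exact: mf.
- apply/trivIsetP => /= i j _ _ ij; rewrite -preimage_setI.
  by move/trivIsetP : tF => /(_ i j Logic.I Logic.I ij) ->; rewrite preimage_set0.
- by rewrite -preimage_bigcup -[X in measurable X]setTI; exact: mf.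
Qed.

HB.instance Definition _ := isMeasure.Build _ _ _ image image0 image_ge0 image_sigma.

Let image_setT : image setT = 1%E.
Proof. by rewrite /image /pushforward preimage_setT; exact: probability_setT. Qed.

HB.instance Definition _ := Measure_isProbability.Build _ _ _ image image_setT.

Lemma exists_pushforward : exists q : probability T2 R, (q : set T2 -> \bar R) = pushforward m f.
Proof. by exists image. Qed.

End pushforward_probability.

(** * From the process to its transition semigroup, and back *)

Section main.
Context (R : realType) (X : metricType R) (x0 : X).
Context (dO : measure_display) (Omega : measurableType dO).
Variables (Ft : R -> set (set Omega)) (Phi : R -> Omega -> X)
  (Px : X -> probability Omega R) (F : set (X -> R)).
Local Notation XB := (borel_of x0).
Local Notation Pt0 := (@Pt R X x0 dO Omega Phi Px).
Hypothesis polX : polish X.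
Hypothesis markov : cadlag_feller_markov_family x0 Ft Phi Px.

Lemma markov_measurable t : 0 <= t -> measurable_fun [set: Omega] (Phi t : Omega -> XB).
Proof.
have [_ [Fm [_ [FPhi _]]]] := markov; move=> t0 _ A mA; rewrite setTI.
by apply: (Fm t t0); apply: (FPhi t t0 A mA).
Qed.

(** Negative times are sent to [0], so that [p t x] is a probability for every real [t].
    Chapman-Kolmogorov is the Markov property on the full event. *)
Lemma markov_semigroup : exists p : R -> XB -> probability XB R,
  [/\ forall t x, 0 <= t -> Pt0 t x = p t x,
   forall t A, measurable A -> measurable_fun [set: XB] (fun x => p t x A),
   forall s t x A, 0 <= s -> 0 <= t -> measurable A ->
     p (s + t) x A = (\int[p s x]_u p t u A)%E &
   forall t, 0 <= t -> forall g : X -> R, continuous g ->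
     (exists M : R, forall x, `|g x| <= M) -> continuous (Pop p t g)].
Proof.
pose ph t : Omega -> XB := Phi (Num.max t 0).
have mph t : measurable_fun [set: Omega] (ph t).
  by apply: markov_measurable; rewrite le_max lexx orbT.
have phE t : 0 <= t -> ph t = Phi t by move=> t0; rewrite /ph max_l.
have /choice[q qE] : forall tx : R * X, exists q : probability XB R,
    (q : set XB -> \bar R) = pushforward (Px tx.2) (ph tx.1).
  by move=> [t x]; exact: exists_pushforward.
pose p t (x : XB) := q (t, x).
have pE t x : (p t x : set XB -> \bar R) = pushforward (Px x) (ph t) by rewrite /p qE.
have PtE t x : 0 <= t -> Pt0 t x = p t x by move=> t0; rewrite pE phE.
have [Fsig [_ [_ [_ [mP [_ [mark [_ [_ fel]]]]]]]]] := markov.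
have mp t A : measurable A -> measurable_fun [set: XB] (fun x => p t x A).
  move=> mA; rewrite (_ : (fun x => _) = fun x : XB => Px x (ph t @^-1` A)).
    by apply: mP; rewrite -[X in measurable X]setTI; exact: mph.
  by apply/funext => x; rewrite pE.
exists p; split => //.
- move=> s t x A s0 t0 mA.
  have FT : Ft s setT by have [h0 hC _] := Fsig s s0; rewrite -(setD0 setT); exact: hC.
  have := mark x s t A setT s0 t0 mA FT.
  have -> : p (s + t) x A = Px x (Phi (s + t) @^-1` A) by rewrite -PtE ?addr_ge0.
  rewrite setTI => ->.
  rewrite pE ge0_integral_pushforward//; last exact: mp.
  rewrite preimage_setT; apply: eq_integral => w _ /=.
  by rewrite PtE// phE.
- move=> t t0 g cg bg.
  rewrite (_ : Pop p t g = fun x => fine (\int[Pt0 t x]_(y in [set: XB]) (g y)%:E)%E).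
    exact: fel.
  by apply/funext => x; rewrite PtE.
Qed.

Variable p : R -> XB -> probability XB R.
Hypothesis PtE : forall t x, 0 <= t -> Pt0 t x = p t x.
Hypothesis mp : forall t A, measurable A -> measurable_fun [set: XB] (fun x => p t x A).
Hypothesis CK : forall s t x A, 0 <= s -> 0 <= t -> measurable A ->
  p (s + t) x A = (\int[p s x]_u p t u A)%E.
Hypothesis feller : forall t, 0 <= t -> forall g : X -> R, continuous g ->
  (exists M : R, forall x, `|g x| <= M) -> continuous (Pop p t g).
Hypothesis borF : forall f, F f -> borel_fun x0 f.
Hypothesis lipF : forall f, bounded_lipschitz f -> F f.
Hypothesis H1 : hyp_H1 Phi Px F.

Local Notation P := (Pop p).
Local Notation bm := (@bounded_measurable _ XB R).

Lemma PtfE t f x : 0 <= t -> Ptf x0 Phi Px t f x = P t f x.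
Proof. by move=> t0; rewrite /Ptf /Pop /Rintegral PtE. Qed.

Lemma ev_cont_of f x : F f -> eventually_continuous_at x0 Phi Px F x -> ev_cont p f x.
Proof.
move=> Ff /(_ f Ff) ec e e0.
have : (limf_esup (fun x' : X =>
   limf_esup (fun t : R => (`|Ptf x0 Phi Px t f x' - Ptf x0 Phi Px t f x|)%:E)
     (+oo%R : set_system R)) (nbhs x) < e%:E)%E by rewrite ec lte_fin.
move=> /limf_esup_lt[V /nbhs_ballP[r /= r0 rV] Ve]; exists r => // u xu.
have /limf_esup_lt[W [M [_ MW]] We] : (limf_esup (fun t : R =>
    (`|Ptf x0 Phi Px t f u - Ptf x0 Phi Px t f x|)%:E) (+oo%R : set_system R) < e%:E)%E.
  by apply: Ve; apply: rV; rewrite ballEmdist.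
exists (Num.max (M + 1) 0) => t; rewrite ge_max => /andP[Mt t0].
have := We t; rewrite !PtfE// lte_fin => h; apply/ltW/h/MW.
by rewrite (lt_le_trans _ Mt)// ltrDl.
Qed.

Lemma eventually_continuous_of x : (forall f e, F f -> 0 < e ->
  forall u, exists T : R, forall t, T <= t -> `|P t f u - P t f x| <= e) ->
  eventually_continuous_at x0 Phi Px F x.
Proof.
move=> h f Ff; apply/eqP; rewrite eq_le; apply/andP; split; last first.
  apply: limf_esup_ge0; first exact: filter_not_empty.
  by move=> u; apply: limf_esup_ge0; [exact: filter_not_empty|move=> t; rewrite lee_fin].
apply/lee_addgt0Pr => e e0; rewrite add0e; apply: limf_esup_le.
apply: nearW => u; apply: limf_esup_le.
have [T TP] := h f e Ff e0 u.
near=> t; have t0 : 0 <= t by near: t; exact: nbhs_pinfty_ge.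
rewrite /= !PtfE// lee_fin; apply: TP; near: t; exact: nbhs_pinfty_ge (num_real T).
Unshelve. all: by end_near. Qed.

Let ball_sym_set z r : [set y : X | mdist y z < r] = [set y | mdist z y < r].
Proof. by apply/seteqP; split => y /=; rewrite metric_sym. Qed.

Let mball z r : measurable ([set y | mdist z y < r] : set XB).
Proof. by apply: borel_open; exact: open_mball. Qed.

Lemma lower_bd_of z : lower_bound_C1 x0 Phi Px z -> lower_bd p z.
Proof.
move=> c1 r r0; have /ereal_gt0_ex[a a0 ainf] := c1 r r0; exists a => // x.
have : (a%:E < limf_einf (fun t => Pt0 t x [set y | (mdist y z < r)%R])
    (+oo%R : set_system R))%E.
  by apply: lt_le_trans ainf _; apply: ereal_inf_lbound; exists x.
move=> /limf_einf_gt[V [M [_ MV]] Va].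
exists (Num.max (M + 1) 0) => t; rewrite ge_max => /andP[Mt t0].
have /Va : V t by apply: MV; rewrite (lt_le_trans _ Mt)// ltrDl.
rewrite ball_sym_set PtE// Pop_indicE// => h.
by rewrite -lee_fin fineK ?fin_num_measure// ltW.
Qed.

Lemma lower_bound_C1_of z : lower_bd p z -> lower_bound_C1 x0 Phi Px z.
Proof.
move=> lb r r0; have [a a0 ah] := lb r r0.
apply: (@lt_le_trans _ _ a%:E); first by rewrite lte_fin.
apply: le_ereal_inf_tmp => _ [x _ <-]; apply: limf_einf_ge.
have [T TP] := ah x.
near=> t; have t0 : 0 <= t by near: t; exact: nbhs_pinfty_ge.
rewrite /= ball_sym_set PtE//.
have := TP t; rewrite Pop_indicE// => h.
rewrite -[leRHS]fineK ?fin_num_measure// lee_fin; apply: h.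
near: t; exact: nbhs_pinfty_ge (num_real T).
Unshelve. all: by end_near. Qed.

Lemma unif_integrable_tail f x e : F f -> 0 < e -> exists2 K : R, 0 <= K &
  forall t, 0 <= t ->
  (\int[p t x]_y (`|f y| * \1_[set y | K <= `|f y|] y)%:E <= e%:E)%E.
Proof.
move=> Ff e0; have ui := H1 Ff x.
have e0' : nbhs (0%E : \bar R) [set y | (y < e%:E)%E].
  by exists e => //= r /=; rewrite sub0r normrN lte_fin => /(le_lt_trans (ler_norm _)).
have : \forall K \near (+oo : set_system R), 0 <= K /\ (ereal_sup
     [set (\int[Px x]_(w in [set w | (K <= `|f (Phi t w)|)%R]) (`|f (Phi t w)|)%:E)%E
     | t in [set t : R | (0 <= t)%R]] < e%:E)%E.
  near=> K; split; first by near: K; exact: nbhs_pinfty_ge.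
  by near: K; exact: (ui _ e0').
move=> [M [_ MP]]; have [K0 Ksup] := MP (M + 1) ltac:(by rewrite ltrDl).
set K := M + 1 in K0 Ksup; exists K => // t t0.
have mf : measurable_fun [set: XB] (fun y => `|f y|) by apply: measurableT_comp => //; exact: borF.
have mD : measurable ([set y | K <= `|f y|] : set XB).
  have := measurable_fun_ler (@measurable_cst _ _ XB R setT K) mf.
  by move/(_ measurableT [set true]); rewrite setTI => h; apply: h.
pose h (y : XB) : \bar R := (`|f y| * \1_[set y | K <= `|f y|] y)%:E.
have mh : measurable_fun [set: XB] h.
  by apply/measurable_EFinP; apply: measurable_funM => //; exact: measurable_indic.
have h0 : {in [set: XB], forall y, (0 <= h y)%E}.
  by move=> y _; rewrite lee_fin mulr_ge0// indicE.
rewrite -/h -PtE//.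
rewrite (@ge0_integral_pushforward _ _ _ _ _ _ (markov_measurable t0) (Px x) _ h measurableT mh h0).
rewrite preimage_setT; apply: le_trans (ltW Ksup); apply: ereal_sup_ubound.
exists t => //; rewrite [LHS]integral_mkcond; apply: eq_integral => w _ /=.
rewrite patchE /h indicE; case: ifPn => Kw.
  by rewrite (mem_set (A := [set y | K <= `|f y|])) ?mulr1//; move: Kw; rewrite inE.
by rewrite (memNset (A := [set y | K <= `|f y|])) ?mulr0// => Kw'; move: Kw; rewrite mem_set.
Unshelve. all: by end_near. Qed.

(** [|f|] is at most [K] plus its tail above [K], whose integral uniform integrability makes at most
    one. *)
Lemma F_ev_itg f : F f -> ev_itg p f.
Proof.
move=> Ff t x t0; have [K K0 KP] := unif_integrable_tail x Ff ltr01.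
have mf : measurable_fun [set: XB] (f : XB -> R) by exact: borF.
have mnf : measurable_fun [set: XB] (fun y => `|f y|) by exact: measurableT_comp.
have mD : measurable ([set y | K <= `|f y|] : set XB).
  have := measurable_fun_ler (@measurable_cst _ _ XB R setT K) mnf.
  by move/(_ measurableT [set true]); rewrite setTI => h; apply: h.
have mt : measurable_fun [set: XB] (fun y => `|f y| * \1_[set y | K <= `|f y|] y : R).
  by apply: measurable_funM => //; exact: measurable_indic.
have it : itg (p t x) (fun y => `|f y| * \1_[set y | K <= `|f y|] y).
  apply/integrableP; split; first exact/measurable_EFinP.
  under eq_integral do rewrite /= ger0_norm ?mulr_ge0// ?indicE//.
  by apply: le_lt_trans (KP t t0) _; exact: ltry.
have iK : itg (p t x) (fun=> K) by exact/bm_itg/bm_cst.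
apply: (@le_itg _ XB R (p t x) f _ mf (itgD iK it)) => y /=.
rewrite indicE; case: (boolP (y \in _)); rewrite ?inE /= => h.
  by rewrite mulr1 lerDr.
by rewrite mulr0 addr0 ltW// ltNge; apply/negP => h'; move: h; rewrite mem_set.
Qed.

Lemma F_ui f x e : F f -> 0 < e -> exists2 K : R, 0 <= K & forall t, 0 <= t ->
  P t (fun y => `|f y| * \1_[set y | K <= `|f y|] y) x <= e.
Proof.
move=> Ff e0; have [K K0 KP] := unif_integrable_tail x Ff e0; exists K => // t t0.
have := KP t t0; rewrite -lee_fin => h; apply: le_trans h.
rewrite /Pop /Rintegral; set I := (\int[_]_(y in _) _)%E.
have : (0 <= I)%E by apply: integral_ge0 => y _; rewrite lee_fin mulr_ge0// indicE.
by case: I => [r _|_|//] /=; rewrite ?leey.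
Qed.

Lemma F_bounded f x : F f -> exists M : R, forall t, 0 <= t -> P t (fun y => `|f y|) x <= M.
Proof.
move=> Ff; have [K K0 KP] := F_ui x Ff ltr01; exists (K + 1) => t t0.
have mnf : measurable_fun [set: XB] (fun y => `|f y|).
  by apply: measurableT_comp => //; exact: borF.
have mD : measurable ([set y | K <= `|f y|] : set XB).
  have := measurable_fun_ler (@measurable_cst _ _ XB R setT K) mnf.
  by move/(_ measurableT [set true]); rewrite setTI => h; apply: h.
have inf : itg (p t x) (fun y => `|f y|) by apply: itg_norm; exact: F_ev_itg.
have it := itg_mul_indic mD inf.
apply: (@le_trans _ _ (\int[p t x]_y (K + `|f y| * \1_[set y | K <= `|f y|] y))).
  apply: Rint_le => //; first by apply: itgD => //; exact/bm_itg/bm_cst.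
  move=> y; rewrite indicE; case: (boolP (y \in _)); rewrite ?inE /= => h.
    by rewrite mulr1 lerDr.
  by rewrite mulr0 addr0 ltW// ltNge; apply/negP => h'; move: h; rewrite mem_set.
rewrite RintegralD//; [|exact/bm_itg/bm_cst].
by rewrite Rint_cst lerD2l; exact: KP.
Qed.

Lemma stable_of_ev_cont z : eventually_continuous_at x0 Phi Px F z ->
  lower_bound_C1 x0 Phi Px z -> asymptotically_stable x0 Phi Px F.
Proof.
move=> ec /lower_bd_of lb.
have asymL (f : X -> R) : bounded_lipschitz f -> forall x y e, 0 < e ->
    exists T : R, forall t, T <= t -> `|P t f x - P t f y| <= e.
  move=> bf; apply: (ev_cont_asym mp CK (z := z)) => //.
    exact: bounded_lipschitz_bm.
  by apply: ev_cont_of => //; exact: lipF.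
have [mu im] := exists_inv_meas polX mp CK feller lb asymL.
have lc f x : bounded_lipschitz f -> (fun t => P t f x) @ +oo --> \int[mu]_y f y.
  by move=> bf; apply: (lipschitz_cvg mp z asymL).
have iF f : F f -> itg mu f.
  move=> Ff; apply: (inv_itg mp im lc); [exact: borF|exact: F_ev_itg|].
  by move=> x; exact: F_bounded.
have invE (nu : probability XB R) : Defs.invariant Phi Px nu <-> inv_meas p nu.
  split => h t t0 A mA; have := h t t0 A mA; rewrite -[RHS]/(nu A) => <-;
  by apply: eq_integral => x _; rewrite PtE.
exists mu; split; first exact/invE.
split; first by move=> nu /invE inu; exact: (inv_meas_unique mp z asymL im inu).
split; first exact: iF.
move=> x f Ff; rewrite -[X in _ --> X](normr0 R); apply: cvg_norm.
rewrite -(subrr (pairing f mu)); apply: cvgB; last exact: cvg_cst.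
have cz : forall e, 0 < e -> exists T : R, forall t, T <= t -> `|P t f z - \int[mu]_y f y| <= e.
  apply: (ev_cont_cvg mp im lc) => //; [exact: iF|exact: F_ev_itg|exact: ev_cont_of].
have cx : (fun t => P t f x) @ +oo --> \int[mu]_y f y.
  apply: cvg_pinfty_of_le => e e0.
  apply: (@ui_cvg R X x0 p mp CK f (F_ev_itg Ff) _ x z _ cz (ev_cont_of Ff ec) lb e e0).
  by move=> y d d0; exact: F_ui.
apply: cvg_trans cx; apply: near_eq_cvg; near=> t.
by rewrite PtfE//; near: t; exact: nbhs_pinfty_ge.
Unshelve. all: by end_near. Qed.

Lemma ev_cont_of_stable : asymptotically_stable x0 Phi Px F ->
  eventually_continuous x0 Phi Px F /\ exists z : X, lower_bound_C1 x0 Phi Px z.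
Proof.
move=> [mu [im [_ [iF cF]]]].
have cvF f x e : F f -> 0 < e -> exists T : R, forall t, T <= t -> `|P t f x - pairing f mu| <= e.
  move=> Ff e0; have /cvgrPdist_le/(_ _ e0)[T [_ TP]] := cF x f Ff.
  exists (Num.max (T + 1) 0) => t; rewrite ge_max => /andP[Tt t0].
  have := TP t; rewrite /= sub0r normrN normr_id PtfE//; apply.
  by rewrite (lt_le_trans _ Tt)// ltrDl.
split.
  move=> x; apply: eventually_continuous_of => f e Ff e0 u.
  have e2 : 0 < e / 2 by rewrite divr_gt0.
  have [T1 H1'] := cvF f u _ Ff e2; have [T2 H2] := cvF f x _ Ff e2.
  exists (Num.max T1 T2) => t; rewrite ge_max => /andP[/H1' h1 /H2 h2].
  rewrite -(subrKA (pairing f mu)) (le_trans (ler_normD _ _))// [leRHS]splitr.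
  by rewrite lerD// distrC.
(* If every point had a null ball, Lindelof's argument would make the whole space null; hence the
   support is not empty. *)
have [z zP] : exists z : X, forall r : R, 0 < r -> (0 < mu [set y | (mdist z y < r)%R])%E.
  apply: contrapT => no.
  have : mu.-negligible [set: X].
    apply: (locally_null polX) => y _; apply: contrapT => nr; apply: no; exists y => r r0.
    rewrite lt0e measure_ge0 andbT; apply/eqP => r'.
    by apply: nr; exists r.
  move=> /(negligibleP mu measurableT).
  by rewrite [X in X = _]probability_setT => /eqP; rewrite onee_eq0.
exists z; apply: lower_bound_C1_of => r r0.
have r2 : 0 < r / 2 by rewrite divr_gt0.
set C : set X := [set y | mdist z y < r / 2].
have bl : bounded_lipschitz (bump C (r / 2)) by exact: bump_bounded_lipschitz.
have bmb : bm (bump C (r / 2)) by exact: bounded_lipschitz_bm.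
have c0 : 0 < pairing (bump C (r / 2)) mu.
  apply: (@lt_le_trans _ _ (fine (mu C))).
    by rewrite -lte_fin fineK ?fin_num_measure//; [exact: zP|exact: mball].
  rewrite -Rint_indic; last exact: mball.
  apply: Rint_le; [apply/bm_itg/bm_indic; exact: mball|exact: bm_itg|].
  move=> y; rewrite indicE; case: (boolP (y \in C)); rewrite ?inE => Cy.
    by rewrite bump1.
  exact: bump_ge0.
(* The bump lies between the indicators of the balls of radius [r / 2] and [r]. Its mean [c] is
   positive and is the limit from every [x], so [c / 2] is a bound independent of [x]. *)
set c := pairing _ _ in c0; have c2 : 0 < c / 2 by rewrite divr_gt0.
exists (c / 2) => // x; have [T TP] := cvF _ x _ (lipF bl) c2.
exists T => t /TP; rewrite -/c ler_distl => /andP[h _].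
apply: (@le_trans _ _ (P t (bump C (r / 2)) x)); first lra.
apply: Pop_le => //; first by apply: bm_indic; exact: mball.
move=> y; have [|y0] := leP (bump C (r / 2) y) 0.
  by move/le_trans; apply; rewrite indicE.
have [v Cv yv] := bump_gt0 r2 y0.
rewrite indicE mem_set; first exact: bump_le1.
rewrite /= (le_lt_trans (metric_triangle z v y))// [ltRHS]splitr ltrD//.
by rewrite metric_sym.
Qed.

End main.

Theorem mainTheorem1 (R : realType) (X : metricType R) (x0 : X)
  (dO : measure_display) (Omega : measurableType dO)
  (Ft : R -> set (set Omega)) (Phi : R -> Omega -> X)
  (Px : X -> probability Omega R) (F : set (X -> R)) :
  polish X ->
  cadlag_feller_markov_family x0 Ft Phi Px ->
  (forall f, F f -> borel_fun x0 f) ->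
  (forall f, bounded_lipschitz f -> F f) ->
  hyp_H1 Phi Px F ->
  (asymptotically_stable x0 Phi Px F <->
     (eventually_continuous x0 Phi Px F /\
      exists z : X, lower_bound_C1 x0 Phi Px z)) /\
  ((eventually_continuous x0 Phi Px F /\
      exists z : X, lower_bound_C1 x0 Phi Px z) <->
     (exists z : X, eventually_continuous_at x0 Phi Px F z /\
                    lower_bound_C1 x0 Phi Px z)).
Proof.
move=> polX markov borF lipF H1.
have [p [PtE mp CK feller]] := markov_semigroup markov.
have one_two := ev_cont_of_stable polX PtE lipF.
have three_one z := stable_of_ev_cont polX markov PtE mp CK feller borF lipF H1 (z := z).
split; split => //.
- by move=> [ec [z lb]]; apply: (three_one z).
- by move=> [ec [z lb]]; exists z.
- by move=> [z [ec lb]]; apply/one_two/(three_one z).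
Qed.
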